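(* Let $\xi$ and $\zeta$ be real random variables, and assume $\xi$ has unit variance. For each $n \geq 1$, let $\mathbf{W}_n$ be an $n \times n$ real symmetric Wigner matrix with atom variables $\xi$ and $\zeta$, and let $\mathbf{P}_n$ be an arbitrary $n \times n$ deterministic matrix (with complex entries). If $$\lim_{n \to \infty} \frac{1}{\sqrt{n}} \| \mathbf{P}_n \|_2 = 0,$$ then, with probability $1$, the empirical spectral measure $\mu_{\frac{1}{\sqrt{n}}\mathbf{W}_n + \mathbf{P}_n}$ of $\frac{1}{\sqrt{n}} \mathbf{W}_n + \mathbf{P}_n$ converges weakly on $\mathbb{C}$ as $n \to \infty$ to the (non-random) measure $\mu_{\mathrm{sc}}$.
   Context: A real symmetric Wigner matrix of size $n$ with atom variables $\xi$ and $\zeta$ is a random real symmetric $n\times n$ matrix $\mathbf{W}=(w_{ij})$ such that $\{w_{ij}:1\le i\le j\le n\}$ are independent, $\{w_{ij}:1\le i<j\le n\}$ are iid copies of $\xi$, and $\{w_{ii}\}$ are iid copies of $\zeta$. $\|\mathbf{P}\|_2=\sqrt{\operatorname{tr}(\mathbf{P}\mathbf{P}^* )}$ is the Frobenius norm. The empirical spectral measure of an $n\times n$ matrix $\mathbf{A}$ with eigenvalues $\lambda_1(\mathbf{A}),\dots,\lambda_n(\mathbf{A})$ (counted with multiplicity) is $\mu_{\mathbf{A}}=\frac1n\sum_{k=1}^n\delta_{\lambda_k(\mathbf{A})}$, a probability measure on $\mathbb{C}$. $\mu_{\mathrm{sc}}$ is the semicircle law, the measure with density $\rho_{\mathrm{sc}}(x)=\frac1{2\pi}\sqrt{4-x^2}$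 on $[-2,2]$ (and $0$ elsewhere on $\mathbb{R}$), viewed as a measure on $\mathbb{C}$ supported on the real line. Random probability measures $\mu_n$ converge weakly to $\mu$ on $\mathbb{C}$ with probability $1$ if for all bounded continuous $f:\mathbb{C}\to\mathbb{R}$, $\lim_{n\to\infty}\int f\,d\mu_n=\int f\,d\mu$ almost surely. *)

(* Defs.v *)
From HB Require Import structures.
From mathcomp Require Import all_boot all_order all_algebra.
From mathcomp Require Import complex.
From mathcomp Require Import all_classical all_reals all_analysis.
From mathcomp Require Import measurable_realfun.

Set Implicit Arguments.
Unset Strict Implicit.
Unset Printing Implicit Defensive.

Import Order.TTheory GRing.Theory Num.Theory.
Import numFieldNormedType.Exports.

Local Open Scope classical_set_scope.
Local Open Scope complex_scope.
Local Open Scope ring_scope.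

(* MathComp-Analysis puts the norm topology on K^o for an abstract
   K : numFieldType; transport it to the concrete field R[i]. *)
HB.instance Definition _ (R : rcfType) :=
  PseudoMetricNormedZmod.copy R[i] R[i]^o.

Notation borelC R := (g_sigma_algebraType (@open (R : realType)[i])).

Section RandomVariables.
Context {R : realType}.

(* Laws are compared on measurable sets only: the value of P on other sets is
   unspecified. *)
Definition same_law d1 (T1 : measurableType d1) (P1 : probability T1 R)
    d2 (T2 : measurableType d2) (P2 : probability T2 R)
    (X1 : T1 -> R) (X2 : T2 -> R) : Prop :=
  forall B : set R, measurable B -> P1 (X1 @^-1` B) = P2 (X2 @^-1` B).

Definition mutually_independent d (T : measurableType d) (P : probability T R)
    (I : finType) (D : {set I}) (X : I -> T -> R) : Prop :=
  forall (J : {set I}) (B : I -> set R), J \subset D ->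
    (forall i, i \in J -> measurable (B i)) ->
    P (\bigcap_(i in [set` J]) (X i @^-1` B i)) =
    (\prod_(i in J) P (X i @^-1` B i))%E.

Record wigner_matrix d (T : measurableType d) (P : probability T R)
    d1 (T1 : measurableType d1) (P1 : probability T1 R) (xi : T1 -> R)
    d2 (T2 : measurableType d2) (P2 : probability T2 R) (zeta : T2 -> R)
    (n : nat) (W : T -> 'M[R]_n) : Prop := {
  wigner_measurable : forall i j, measurable_fun setT (fun t => W t i j);
  wigner_symmetric : forall t, (W t)^T = W t;
  wigner_independent : mutually_independent P
    [set ij : 'I_n * 'I_n | (ij.1 <= ij.2)%N]%SET (fun ij t => W t ij.1 ij.2);
  wigner_offdiag : forall i j : 'I_n, (i < j)%N ->
    same_law P P1 (fun t => W t i j) xi;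
  wigner_diag : forall i : 'I_n, same_law P P2 (fun t => W t i i) zeta
}.

End RandomVariables.

Section Matrices.
Context {R : realType}.

(* \tr (A A^* ) is a nonnegative real element of R[i]; Re casts it to R. *)
Definition frobenius_norm n (A : 'M[R[i]]_n) : R :=
  Num.sqrt (complex.Re (\tr (A *m (map_mx Num.conj A)^T))).

(* The roots of the characteristic polynomial, with multiplicity. *)
Definition eigenvalues n (A : 'M[R[i]]_n) : seq R[i] :=
  sval (closed_field_poly_normal (char_poly A)).

Definition empirical_spectral_measure n (A : 'M[R[i]]_n) :
    {measure set (borelC R) -> \bar R} :=
  mscale (n%:R^-1)%:nng
    (msum (fun k => \d_((eigenvalues A)`_k : borelC R)) n).

End Matrices.

Section Semicircle.
Context {R : realType}.

Definition semicircle_density (x : R) : R :=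
  if x \in `[-2, 2] then (2 * pi)^-1 * Num.sqrt (4 - x ^+ 2) else 0.

Definition semicircle_law (A : set (borelC R)) : \bar R :=
  (\int[lebesgue_measure]_(x in [set x | A x%:C]) (semicircle_density x)%:E)%E.

Lemma semicircle_densityE :
  semicircle_density = fun x => (2 * pi)^-1 * Num.sqrt (4 - x ^+ 2).
Proof.
apply/funext => x; rewrite /semicircle_density in_itv /=.
case: ifPn => // /negP xN; rewrite ler0_sqrtr ?mulr0 // leNgt.
apply/negP => x2; apply: xN; rewrite -ler_norml.
rewrite -(@ler_pXn2r _ 2) ?nnegrE // real_normK ?num_real //.
by rewrite -natrX -subr_ge0 ltW.
Qed.

Lemma semicircle_density_ge0 x : 0 <= semicircle_density x.
Proof.
by rewrite semicircle_densityE mulr_ge0 ?sqrtr_ge0 // invr_ge0 mulr_ge0 // pi_ge0.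
Qed.

Lemma measurable_semicircle_density : measurable_fun setT semicircle_density.
Proof.
rewrite semicircle_densityE; apply: measurable_funM => //.
apply: (measurableT_comp (f := @Num.sqrt R) (g := fun x : R => 4 - x ^+ 2)).
  apply: continuous_measurable_fun => x; exact: sqrt_continuous.
by apply: measurable_funB => //; exact: measurable_funX.
Qed.

Lemma continuous_real_complex : continuous (real_complex R : R -> R[i]).
Proof.
move=> x; apply/cvgrPdist_lt => /= e e0.
have := e0; case: e e0 => er ei e0; rewrite ltcE /= => /andP[/eqP ei0 er0].
near=> y.
rewrite -rmorphB /= normc_def /= expr0n addr0 sqrtr_sqr ltcE /= ei0 eqxx /=.
near: y; apply: (@cvgr_dist_lt _ _ _ (nbhs x) _ id x) => //; exact: cvg_id.
Unshelve. all: by end_near. Qed.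

Lemma measurable_real_complex :
  measurable_fun setT (real_complex R : R -> borelC R).
Proof.
apply: (@measurability _ _ _ (borelC R) setT _ (@open R[i])) => //.
move=> _ [B oB <-]; rewrite setTI; apply: open_measurable.
by apply: open_comp oB => x _; exact: continuous_real_complex.
Qed.

Let measurable_preimage (A : set (borelC R)) :
  measurable A -> measurable [set x : R | A x%:C].
Proof.
by move=> mA; rewrite -[X in measurable X]setTI; exact: measurable_real_complex.
Qed.

Let semicircle_law0 : semicircle_law set0 = 0%E.
Proof. by rewrite /semicircle_law integral_set0. Qed.

Let semicircle_law_ge0 A : (0 <= semicircle_law A)%E.
Proof.
by apply: integral_ge0 => x _; rewrite lee_fin semicircle_density_ge0.
Qed.

Let semicircle_law_sigma_additive : semi_sigma_additive semicircle_law.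
Proof.
move=> F mF tF mUF; rewrite /semicircle_law; apply: cvg_toP.
  apply: ereal_nondecreasing_is_cvgn => m n mn.
  apply: lee_sum_nneg_natr => // k _ _; exact: semicircle_law_ge0.
have -> : [set x : R | (\bigcup_k F k) x%:C] =
    \bigcup_k [set x : R | F k x%:C] by [].
rewrite ge0_integral_bigcup //=.
- by move=> k; exact: measurable_preimage.
- by apply/measurable_funTS/measurableT_comp => //;
    exact: measurable_semicircle_density.
- by move=> x _; rewrite lee_fin semicircle_density_ge0.
- move/trivIsetP : tF => tF; apply/trivIsetP => i j _ _ ij.
  by have := tF i j I I ij; rewrite -!subset0 => h x [/= Fi Fj]; exact: (h x%:C).
Qed.

HB.instance Definition _ := isMeasure.Build _ _ _ semicircle_law
  semicircle_law0 semicircle_law_ge0 semicircle_law_sigma_additive.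

End Semicircle.
Arguments semicircle_law R A : clear implicits.

Definition weak_cvg_as (R : realType) d (T : measurableType d)
    (P : probability T R)
    (mu_ : nat -> T -> {measure set (borelC R) -> \bar R})
    (mu : {measure set (borelC R) -> \bar R}) : Prop :=
  forall f : R[i] -> R, continuous f -> bounded_fun f ->
    {ae P, forall t,
      \int[mu_ n t]_z (f z)%:E @[n --> \oo] --> \int[mu]_z (f z)%:E}%E.

(* Main.v *)
(** Stieltjes transforms s_H(z) = tr (H - z)^-1 / n reduce everything to Im z > 0.

    Real part: for H = W / sqrt n, truncating and centering the entries changes E s_H(z) little:
    the constant mean and the large diagonal entries are a perturbation of small rank, the rest is
    small in Frobenius norm.  For bounded centered entries, expanding the resolvent in a single
    entry shows that s = E s_H(z) nearly solves 1 + z s + s^2 = 0, an equation that is stable in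
    the upper half plane and is solved by the transform of the semicircle law.  Revealing the
    matrix row by row gives a martingale with increments O(1/n), so that the fourth central moment
    of s_H(z) is O(1/n^2), which is summable: s_H(z) converges almost surely, for all z of a
    countable set at once.

    Complex part: let U (H + M) U^* be upper triangular.  The imaginary parts of its diagonal
    entries, the eigenvalues of H + M, come from M only, and U H U^* differs from the diagonal
    matrix of their real parts by O(|M|) in Frobenius norm.  So the mean square of the imaginary
    parts vanishes in the limit, and the real parts have asymptotically the Stieltjes transform of
    H.  Since Im ((x - z)^-1) is an approximate identity, this determines the weak limit. *)
From HB Require Import structures.
From mathcomp Require Import all_boot all_order all_algebra.
From mathcomp Require Import complex.
From mathcomp Require Import all_classical all_reals all_analysis.
From mathcomp Require Import measurable_realfun.
From mathcomp Require Import ring lra.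
Require Import Defs.

Set Implicit Arguments.
Unset Strict Implicit.
Unset Printing Implicit Defensive.

Import Order.TTheory GRing.Theory Num.Theory.
Import numFieldNormedType.Exports.

Local Open Scope classical_set_scope.
Local Open Scope ring_scope.
Local Open Scope sesquilinear_scope.

(** * The modulus on [R[i]] as an element of [R]; the norm of [R[i]] is itself complex-valued *)

Section ComplexModulus.
Context {R : rcfType}.
Implicit Types (x y z : R[i]).

(** Only a second moment of [xi] is available, no moment of [zeta], and matrices of different sizes
    may depend on each other arbitrarily. The almost sure step therefore works on the untruncated
    matrix: changing row and column k is a perturbation of rank two, which moves s_H(z) by O(1/n)
    whatever the size of the entries, and a summable moment requires no joint law. Truncation enters
    the expectation alone, at a level that stays fixed while n grows and is sent to infinity
    afterwards.

    Cauchy-Schwarz is used in the form 2xy <= a x^2 + y^2 / a with a free weight a, so that squared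
    Frobenius norms suffice and no square root of a random quantity has to be integrated; the weight
    is chosen when the limit is taken.

    Single eigenvalues of a nonnormal H + M need not be close to those of H. After triangularisation
    only Stieltjes transforms of hermitian matrices are compared, and these are stable in Frobenius
    norm.

    Conditional expectations appear as integrals over an independent copy of the coordinates. *)

Definition cabs (x : R[i]) : R := complex.Re `|x|.

Lemma cabsE x : (cabs x)%:C%C = `|x|.
Proof. by rewrite /cabs normc_def. Qed.

Lemma cabs_ge0 x : 0 <= cabs x.
Proof. by rewrite -ler0c cabsE. Qed.

Lemma cabs_sqr x : cabs x ^+ 2 = complex.Re x ^+ 2 + complex.Im x ^+ 2.
Proof. by apply: complexI; rewrite rmorphXn /= cabsE add_Re2_Im2. Qed.

Lemma cabs_conj x : ((cabs x) ^+ 2)%:C%C = x * Num.conj x.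
Proof. by rewrite rmorphXn /= cabsE normCK. Qed.

Lemma cabsM x y : cabs (x * y) = cabs x * cabs y.
Proof. by apply: complexI; rewrite rmorphM /= !cabsE normrM. Qed.

Lemma cabsX x n : cabs (x ^+ n) = cabs x ^+ n.
Proof. by apply: complexI; rewrite rmorphXn /= !cabsE normrX. Qed.

Lemma cabsV x : cabs x^-1 = (cabs x)^-1.
Proof. by apply: complexI; rewrite fmorphV /= !cabsE normfV. Qed.

Lemma cabsN x : cabs (- x) = cabs x.
Proof. by rewrite /cabs normrN. Qed.

Lemma cabsJ x : cabs (Num.conj x) = cabs x.
Proof. by rewrite /cabs norm_conjC. Qed.

Lemma cabsB x y : cabs (x - y) = cabs (y - x).
Proof. by rewrite -cabsN opprB. Qed.

Lemma cabs0 : cabs (0 : R[i]) = 0.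
Proof. by rewrite /cabs normr0. Qed.

Lemma cabs1 : cabs (1 : R[i]) = 1.
Proof. by rewrite /cabs normr1. Qed.

Lemma cabs_real (a : R) : cabs a%:C%C = `|a|.
Proof. by rewrite /cabs normc_def /= expr0n addr0 sqrtr_sqr. Qed.

Lemma cabs_eq0 x : (cabs x == 0) = (x == 0).
Proof. by rewrite -(inj_eq (@complexI R)) cabsE normr_eq0. Qed.

Lemma ler_cabsD x y : cabs (x + y) <= cabs x + cabs y.
Proof. by rewrite -lecR rmorphD /= !cabsE ler_normD. Qed.

Lemma ler_cabsB x y : cabs (x - y) <= cabs x + cabs y.
Proof. by rewrite -(cabsN y); apply: ler_cabsD. Qed.

Lemma ler_cabs_sum (I : Type) (r : seq I) (P : pred I) (F : I -> R[i]) :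
  cabs (\sum_(i <- r | P i) F i) <= \sum_(i <- r | P i) cabs (F i).
Proof.
elim/big_rec2: _ => [|i y1 y2 _ le12]; first by rewrite cabs0.
by rewrite (le_trans (ler_cabsD _ _)) // lerD2l.
Qed.

Lemma cabs_nat n : cabs (n%:R : R[i]) = n%:R.
Proof. by rewrite -[n%:R](rmorph_nat (real_complex R)) cabs_real normr_nat. Qed.

Lemma ler_Re_cabs x : `|complex.Re x| <= cabs x.
Proof. by rewrite -lecR cabsE normc_ge_Re. Qed.

Lemma ler_Im_cabs x : `|complex.Im x| <= cabs x.
Proof.
rewrite -(@ler_pXn2r _ 2) ?nnegrE ?cabs_ge0 // real_normK ?num_real // cabs_sqr.
by rewrite lerDr sqr_ge0.
Qed.

Lemma ler_cabs_ReIm x : cabs x <= `|complex.Re x| + `|complex.Im x|.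
Proof.
rewrite -(@ler_pXn2r _ 2) ?nnegrE ?cabs_ge0 ?addr_ge0 // cabs_sqr sqrrD.
by rewrite !real_normK ?num_real // lerD2r lerDl mulrn_wge0 // mulr_ge0.
Qed.

Lemma cReD x y : complex.Re (x + y) = complex.Re x + complex.Re y.
Proof. by case: x y => [a b] [c d]. Qed.

Lemma cImD x y : complex.Im (x + y) = complex.Im x + complex.Im y.
Proof. by case: x y => [a b] [c d]. Qed.

Lemma cReB x y : complex.Re (x - y) = complex.Re x - complex.Re y.
Proof. by case: x y => [a b] [c d]. Qed.

Lemma cImB x y : complex.Im (x - y) = complex.Im x - complex.Im y.
Proof. by case: x y => [a b] [c d]. Qed.

Lemma cReM x y : complex.Re (x * y) =
  complex.Re x * complex.Re y - complex.Im x * complex.Im y.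
Proof. by case: x y => [a b] [c d]. Qed.

Lemma cImM x y : complex.Im (x * y) =
  complex.Re x * complex.Im y + complex.Im x * complex.Re y.
Proof. by case: x y => [a b] [c d]. Qed.

Lemma cReMr x (a : R) : complex.Re (x * a%:C%C) = complex.Re x * a.
Proof. by rewrite cReM /= mulr0 subr0. Qed.

Lemma cImMr x (a : R) : complex.Im (x * a%:C%C) = complex.Im x * a.
Proof. by rewrite cImM /= mulr0 add0r. Qed.

Lemma cImJ x : complex.Im (Num.conj x) = - complex.Im x.
Proof. by case: x. Qed.

Lemma conj_real_complex (a : R) : Num.conj a%:C%C = a%:C%C.
Proof. exact: conjc_real. Qed.

Lemma cRe_sum (I : Type) (r : seq I) (P : pred I) (F : I -> R[i]) :
  complex.Re (\sum_(i <- r | P i) F i) = \sum_(i <- r | P i) complex.Re (F i).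
Proof. by elim/big_rec2: _ => [|i y1 y2 _ <-] //; rewrite cReD. Qed.

Lemma cIm_sum (I : Type) (r : seq I) (P : pred I) (F : I -> R[i]) :
  complex.Im (\sum_(i <- r | P i) F i) = \sum_(i <- r | P i) complex.Im (F i).
Proof. by elim/big_rec2: _ => [|i y1 y2 _ <-] //; rewrite cImD. Qed.

End ComplexModulus.

(** * Squared Frobenius norm, trace and rank *)

Section Frobenius.
Context {R : rcfType}.
Local Notation C := R[i].

(** Squared, so that no square roots occur in expectations, and rectangular, so that one column
    gives the Euclidean norm and the action of a matrix on vectors is covered too. *)
Definition fro2 m n (A : 'M[C]_(m, n)) : R := \sum_i \sum_j cabs (A i j) ^+ 2.

Lemma adjmxM m n p (A : 'M[C]_(m, n)) (B : 'M[C]_(n, p)) :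
  (A *m B) ^t* = B ^t* *m A ^t*.
Proof. by rewrite trmx_mul map_mxM. Qed.

Lemma adjmxB m n (A B : 'M[C]_(m, n)) : (A - B) ^t* = A ^t* - B ^t*.
Proof. by apply/matrixP => i j; rewrite !mxE rmorphB. Qed.

Lemma adjmxZ m n (a : C) (A : 'M[C]_(m, n)) : (a *: A) ^t* = Num.conj a *: A ^t*.
Proof. by apply/matrixP => i j; rewrite !mxE rmorphM. Qed.

Lemma mxtraceB n (A B : 'M[C]_n) : \tr (A - B) = \tr A - \tr B.
Proof. by rewrite /mxtrace -sumrB; apply: eq_bigr => i _; rewrite !mxE. Qed.

Lemma fro2_ge0 m n (A : 'M[C]_(m, n)) : 0 <= fro2 A.
Proof. by apply: sumr_ge0 => i _; apply: sumr_ge0 => j _; apply: sqr_ge0. Qed.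

Lemma fro2_trace m n (A : 'M[C]_(m, n)) : (fro2 A)%:C%C = \tr (A *m A ^t*).
Proof.
rewrite /fro2 /mxtrace rmorph_sum; apply: eq_bigr => i _.
rewrite rmorph_sum mxE; apply: eq_bigr => j _.
by rewrite /= !mxE; exact: cabs_conj.
Qed.

Lemma fro2_eq0 m n (A : 'M[C]_(m, n)) : fro2 A = 0 -> A = 0.
Proof.
move=> /eqP; rewrite psumr_eq0 => [/allP A0|i _]; last first.
  by apply: sumr_ge0 => j _; apply: sqr_ge0.
apply/matrixP => i j; rewrite mxE; apply/eqP.
have := A0 i (mem_index_enum _); rewrite /= psumr_eq0 => [/allP/(_ j)|? _].
  by rewrite mem_index_enum sqrf_eq0 cabs_eq0; apply.
exact: sqr_ge0.
Qed.

Lemma fro2_adj m n (A : 'M[C]_(m, n)) : fro2 (A ^t*) = fro2 A.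
Proof.
rewrite /fro2 exchange_big; apply: eq_bigr => i _; apply: eq_bigr => j _.
by rewrite !mxE cabsJ.
Qed.

Lemma fro2_1 n : fro2 (1%:M : 'M[C]_n) = n%:R.
Proof.
rewrite /fro2 (eq_bigr (fun=> 1)) ?sumr_const ?card_ord // => i _.
rewrite (bigD1 i) //= mxE eqxx cabs1 expr1n big1 ?addr0 // => j ji.
by rewrite mxE eq_sym (negbTE ji) cabs0 expr0n.
Qed.

Lemma fro2_col n (A : 'M[C]_n) j : fro2 (col j A) = \sum_i cabs (A i j) ^+ 2.
Proof. by apply: eq_bigr => i _; rewrite big_ord1 mxE. Qed.

Lemma fro2_unitary m n (Q : 'M[C]_(m, n)) : Q \is unitarymx -> fro2 Q = m%:R.
Proof.
move=> /unitarymxP QQ; apply: complexI.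
by rewrite fro2_trace QQ mxtrace1 rmorph_nat.
Qed.

Lemma fro2_mul_unitary m n p (A : 'M[C]_(m, n)) (U : 'M[C]_(n, p)) :
  U \is unitarymx -> fro2 (A *m U) = fro2 A.
Proof.
move=> Uu; apply: complexI; rewrite !fro2_trace trmx_mul map_mxM /=.
by rewrite mulmxA mulmxtVK.
Qed.

Lemma fro2_unitary_mul m n (U : 'M[C]_m) (A : 'M[C]_(m, n)) :
  U \is unitarymx -> fro2 (U *m A) = fro2 A.
Proof.
move=> Uu; rewrite -[LHS]fro2_adj adjmxM fro2_mul_unitary; first exact: fro2_adj.
by rewrite trmxC_unitary.
Qed.

(* Cauchy-Schwarz for the trace pairing, in a form linear in both squared norms. *)
Lemma cabs_trace_mul m n (A : 'M[C]_(m, n)) (B : 'M[C]_(n, m)) (a : R) :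
  0 < a -> cabs (\tr (A *m B)) <= (a * fro2 A + a^-1 * fro2 B) / 2.
Proof.
move=> a0; rewrite /mxtrace.
have -> : fro2 B = \sum_i \sum_j cabs (B j i) ^+ 2 by rewrite /fro2 exchange_big.
apply: le_trans (ler_cabs_sum _ _ _) _.
rewrite /fro2 !mulr_sumr -big_split /= mulr_suml; apply: ler_sum => i _.
rewrite mxE; apply: le_trans (ler_cabs_sum _ _ _) _.
rewrite !mulr_sumr -big_split /= mulr_suml; apply: ler_sum => j _.
rewrite cabsM; set x := cabs _; set y := cabs _.
have /(ler_wpM2l (ltW a0)) := sqr_ge0 (x - a^-1 * y); rewrite mulr0.
have -> : a * (x - a^-1 * y) ^+ 2 = a * x ^+ 2 + a^-1 * y ^+ 2 - 2 * (x * y).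
  by field; rewrite gt_eqF.
lra.
Qed.

Lemma mulmx_unitary_sub m r n (X : 'M[C]_(m, n)) (Q : 'M[C]_(r, n)) :
  Q \is unitarymx -> (X <= Q)%MS -> X *m Q ^t* *m Q = X.
Proof. by move=> Qu /submxP [Y ->]; rewrite mulmxtVK. Qed.

(** The hypothesis says that the operator norm of [X] is at most [c]. With [Q] an orthonormal basis
    of the row space, [X = X Q^* Q]; the trace of [Q] times [X Q^*] is bounded by Cauchy-Schwarz
    with weight [c], since the squared norm of [Q] is the rank. *)
Lemma cabs_trace_rank n (X : 'M[C]_n) (c : R) : 0 < c ->
  (forall m (Y : 'M[C]_(n, m)), fro2 (X *m Y) <= c ^+ 2 * fro2 Y) ->
  cabs (\tr X) <= c * (\rank X)%:R.
Proof.
move=> c0 Xc; set Q := schmidt (row_base X).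
have rn : (\rank X <= n)%N by apply: rank_leq_row.
have Qu : Q \is unitarymx by apply: schmidt_unitarymx.
have XQ : X *m Q ^t* *m Q = X.
  by apply: mulmx_unitary_sub => //; rewrite (submx_trans _ (schmidt_sub _)) // eq_row_base.
rewrite -(congr1 mxtrace XQ) mxtrace_mulC.
apply: le_trans (cabs_trace_mul _ _ c0) _.
have ci : 0 <= c^-1 by rewrite invr_ge0 ltW.
have := ler_wpM2l ci (Xc _ (Q ^t*)); rewrite fro2_adj (fro2_unitary Qu).
rewrite mulrA expr2 mulrA mulVf ?mul1r ?gt_eqF // => h.
rewrite ler_pdivrMr // mulrDr mulr1.
by apply: lerD.
Qed.

End Frobenius.

(** * Resolvents and Stieltjes transforms of hermitian matrices *)

Section Resolvent.
Context {R : rcfType}.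
Local Notation C := R[i].

Definition hermitian n (H : 'M[C]_n) := H ^t* = H.

Definition resolvent n (H : 'M[C]_n) (z : C) : 'M[C]_n := invmx (H - z%:M).

Definition stieltjes n (H : 'M[C]_n) (z : C) : C := n%:R^-1 * \tr (resolvent H z).

(** With [K = H - Re z] hermitian, [H - z] is [K] minus a purely imaginary multiple of the identity,
    and the cross terms cancel. The lower bound that results replaces the spectral theorem in all
    estimates of the resolvent. *)
Lemma fro2_shift n m (H : 'M[C]_n) (z : C) (X : 'M[C]_(n, m)) : hermitian H ->
  fro2 ((H - z%:M) *m X) =
  fro2 ((H - (complex.Re z)%:C%C%:M) *m X) + complex.Im z ^+ 2 * fro2 X.
Proof.
move=> Hh; set K := H - (complex.Re z)%:C%C%:M.
have Kh : K ^t* = K.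
  apply/matrixP => i j; have /matrixP/(_ i j) := Hh.
  rewrite !mxE rmorphB /= => ->; congr (_ - _).
  by rewrite eq_sym; case: eqP => _; rewrite ?mulr1n ?mulr0n ?rmorph0 // conj_real_complex.
set e := (complex.Im z)%:C%C.
have -> : (H - z%:M) *m X = K *m X - ('i * e) *: X.
  rewrite {1}[z]complexE /K raddfD /= opprD addrA mulmxBl mul_scalar_mx.
  by [].
apply: complexI; rewrite fro2_trace rmorphD rmorphM rmorphXn /= !fro2_trace -/e.
have ec : Num.conj e = e by apply: conj_real_complex.
have ic : Num.conj ('i * e) = - ('i * e) :> C.
  by rewrite rmorphM /= ec -mulNr; congr (_ * _); apply/eqP; rewrite eq_complex /= !oppr0 !eqxx.
rewrite adjmxB adjmxZ ic scaleNr opprK mulmxBl !mulmxDr.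
rewrite -!scalemxAl -!scalemxAr mxtraceB !mxtraceD !mxtraceZ.
have -> : \tr (X *m (K *m X) ^t*) = \tr (K *m X *m X ^t*).
  by rewrite adjmxM Kh mulmxA mxtrace_mulC mulmxA.
have : ('i : C) ^+ 2 = -1 by apply: sqr_i.
rewrite expr2 => ii.
set a := \tr _; set b := \tr _; set c := \tr _.
transitivity (a - ('i * 'i) * e ^+ 2 * c); last by rewrite ii mulN1r mulNr opprK.
by ring.
Qed.

Section Bounds.
Context (n : nat) (H : 'M[C]_n) (z : C) (Hh : hermitian H) (z0 : 0 < complex.Im z).
Local Notation eta := (complex.Im z).

Lemma fro2_shift_ge m (X : 'M[C]_(n, m)) :
  eta ^+ 2 * fro2 X <= fro2 ((H - z%:M) *m X).
Proof. by rewrite fro2_shift // lerDr fro2_ge0. Qed.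

Lemma shift_unit : H - z%:M \in unitmx.
Proof.
(* [H - z] annihilates its cokernel matrix, whose norm must then vanish by the lower bound. *)
rewrite -row_full_unit -cokermx_eq0; apply/eqP/fro2_eq0/eqP.
have := fro2_shift_ge (cokermx (H - z%:M)); rewrite mulmx_coker.
have -> : fro2 (0 : 'M[C]_n) = 0.
  by rewrite /fro2 big1 // => i _; rewrite big1 // => j _; rewrite mxE cabs0 expr0n.
by rewrite pmulr_rle0 ?exprn_gt0 // => h; rewrite eq_le h fro2_ge0.
Qed.

Lemma fro2_resolvent_mul m (X : 'M[C]_(n, m)) :
  fro2 (resolvent H z *m X) <= eta^-1 ^+ 2 * fro2 X.
Proof.
rewrite exprVn -ler_pdivrMl ?invr_gt0 ?exprn_gt0 // invrK.
apply: le_trans (fro2_shift_ge _) _.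
by rewrite /resolvent mulKVmx ?shift_unit.
Qed.

Lemma resolvent_mulr : (H - z%:M) *m resolvent H z = 1%:M.
Proof. by rewrite mulmxV ?shift_unit. Qed.

Lemma resolvent_mull : resolvent H z *m (H - z%:M) = 1%:M.
Proof. by rewrite mulVmx ?shift_unit. Qed.

(** A sum of [n] squares bounded independently of [n]: the squares of all entries add up to O(n),
    one order below the trivial bound. *)
Lemma resolvent_col j : \sum_i cabs (resolvent H z i j) ^+ 2 <= eta^-1 ^+ 2.
Proof.
rewrite -fro2_col; have := fro2_resolvent_mul (delta_mx j 0 : 'cV_n).
rewrite -colE; have -> : fro2 (delta_mx j 0 : 'cV[C]_n) = 1; last by rewrite mulr1.
rewrite /fro2 (bigD1 j) //= big_ord1 big1 => [|i ij].
  by rewrite mxE !eqxx cabs1 expr1n addr0.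
by rewrite big_ord1 mxE (negbTE ij) cabs0 expr0n.
Qed.

Lemma resolvent_entry i j : cabs (resolvent H z i j) <= eta^-1.
Proof.
rewrite -(@ler_pXn2r _ 2) ?nnegrE ?cabs_ge0 ?invr_ge0 ?(ltW z0) //.
apply: le_trans (resolvent_col j); rewrite (bigD1 i) //= lerDl.
by apply: sumr_ge0 => k _; apply: sqr_ge0.
Qed.

Lemma stieltjes_le : cabs (stieltjes H z) <= eta^-1.
Proof.
have B0 : 0 <= eta^-1 by rewrite invr_ge0 ltW.
rewrite /stieltjes cabsM cabsV cabs_nat.
have [n0|n0] := posnP n; first by rewrite [n in n%:R^-1]n0 invr0 mul0r.
rewrite ler_pdivrMl ?ltr0n //; apply: le_trans (ler_cabs_sum _ _ _) _.
apply: le_trans (ler_sum _ (fun i _ => resolvent_entry i i)) _.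
by rewrite sumr_const card_ord mulr_natl.
Qed.

End Bounds.

Section Comparison.
Context (n : nat) (H K : 'M[C]_n) (z : C) (Hh : hermitian H) (Kh : hermitian K)
  (z0 : 0 < complex.Im z).
Local Notation eta := (complex.Im z).

Lemma resolvent_sub :
  resolvent H z - resolvent K z = resolvent H z *m (K - H) *m resolvent K z.
Proof.
have -> : K - H = (K - z%:M) - (H - z%:M) by rewrite opprB addrA subrK.
by rewrite mulmxBr mulmxBl resolvent_mull // mul1mx -mulmxA resolvent_mulr // mulmx1.
Qed.

(** By the resolvent identity and cyclicity, the difference of the traces is the trace of
    [(K - z)^-1 (H - z)^-1 (K - H)], and the product of the two resolvents has squared norm at most
    [n] times [eta^-4]. *)
Lemma stieltjes_sub_fro2 (a : R) : (0 < n)%N -> 0 < a ->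
  cabs (stieltjes H z - stieltjes K z) <=
  (a * eta^-1 ^+ 4 + a^-1 * (n%:R^-1 * fro2 (K - H))) / 2.
Proof.
move=> n0 a0; have nr : (0 : R) < n%:R by rewrite ltr0n.
rewrite /stieltjes -mulrBr -mxtraceB resolvent_sub mxtrace_mulC mulmxA.
rewrite cabsM cabsV cabs_nat ler_pdivrMl //.
apply: le_trans (cabs_trace_mul _ _ a0) _.
rewrite [leRHS]mulrA ler_pM2r ?invr_gt0 // mulrDr.
have -> : n%:R * (a^-1 * (n%:R^-1 * fro2 (K - H))) = a^-1 * fro2 (K - H).
  by field; rewrite !gt_eqF.
rewrite lerD2r mulrCA ler_pM2l //.
apply: le_trans (fro2_resolvent_mul Kh z0 _) _.
rewrite [_ ^+ 4](exprD _ 2 2) mulrCA ler_pM2l ?exprn_gt0 ?invr_gt0 //.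
rewrite -[resolvent H z]mulmx1; apply: le_trans (fro2_resolvent_mul Hh z0 _) _.
by rewrite fro2_1 mulrC.
Qed.

(** The difference of the resolvents has operator norm at most [2 / eta] and, by the resolvent
    identity, rank at most that of [K - H]. The size of [K - H] does not enter. *)
Lemma stieltjes_sub_rank : (0 < n)%N ->
  cabs (stieltjes H z - stieltjes K z) <=
  2 * eta^-1 * (n%:R^-1 * (\rank (K - H))%:R).
Proof.
move=> n0; have nr : (0 : R) < n%:R by rewrite ltr0n.
rewrite /stieltjes -mulrBr -mxtraceB cabsM cabsV cabs_nat mulrCA.
rewrite ler_pM2l ?invr_gt0 //.
set X := (X in mxtrace X); have B0 : 0 < eta^-1 by rewrite invr_gt0.
apply: (@le_trans _ _ (2 * eta^-1 * (\rank X)%:R)); last first.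
  rewrite ler_pM2l ?mulr_gt0 // ler_nat /X resolvent_sub.
  by rewrite (leq_trans (mxrankM_maxl _ _)) // mxrankM_maxr.
apply: cabs_trace_rank; first by rewrite mulr_gt0.
move=> m Y; rewrite /X mulmxBl.
have h (A B : 'M[C]_(n, m)) : fro2 (A - B) <= 2 * (fro2 A + fro2 B).
  rewrite /fro2 -big_split /= mulr_sumr; apply: ler_sum => i _.
  rewrite -big_split /= mulr_sumr; apply: ler_sum => j _; rewrite !mxE.
  have := ler_cabsB (A i j) (B i j); have := cabs_ge0 (A i j - B i j).
  have := sqr_ge0 (cabs (A i j) - cabs (B i j)); nra.
apply: le_trans (h _ _) _.
have := fro2_resolvent_mul Hh z0 Y; have := fro2_resolvent_mul Kh z0 Y.
by rewrite exprMn; lra.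
Qed.

End Comparison.

End Resolvent.

(** * Unitary conjugation and triangularisation *)

Section Schur.
Context {R : rcfType}.
Local Notation C := R[i].

Lemma hermitian_conj n (U H : 'M[C]_n) : hermitian H -> hermitian (U *m H *m U ^t*).
Proof. by move=> Hh; rewrite /hermitian !adjmxM trmxCK Hh mulmxA. Qed.

Lemma stieltjes_conj n (U H : 'M[C]_n) z : U \is unitarymx -> hermitian H ->
  0 < complex.Im z -> stieltjes (U *m H *m U ^t*) z = stieltjes H z.
Proof.
move=> Uu Hh z0; rewrite /stieltjes /resolvent; congr (_ * _).
have Ui := unitarymx_unit Uu; rewrite -invmx_unitary //.
have -> : U *m H *m invmx U - z%:M = U *m (H - z%:M) *m invmx U.
  by rewrite mulmxBr mulmxBl mul_mx_scalar -scalemxAl mulmxV // scalemx1.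
have Hu := shift_unit Hh z0; set S := H - z%:M in Hu *.
have e : (U *m S *m invmx U) *m (U *m invmx S *m invmx U) = 1%:M.
  by rewrite !mulmxA mulmxKV // mulmxK // mulmxV.
have [u _] := mulmx1_unit e.
rewrite -[invmx (_ *m _)]mulmx1 -e mulKmx //.
by rewrite mxtrace_mulC mulKmx.
Qed.

Lemma stieltjes_diag n (x : 'I_n -> R) z : 0 < complex.Im z ->
  stieltjes (diag_mx (\row_i (x i)%:C%C)) z =
  n%:R^-1 * \sum_i ((x i)%:C%C - z)^-1.
Proof.
move=> z0; rewrite /stieltjes; congr (_ * _); rewrite /resolvent.
have xz i : (x i)%:C%C - z != 0.
  rewrite subr_eq0; apply: contraTneq z0 => <- /=; by rewrite ltxx.
have h : (diag_mx (\row_i (x i)%:C%C) - z%:M) *m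
         diag_mx (\row_i ((x i)%:C%C - z)^-1) = 1%:M.
  rewrite -diag_const_mx -raddfB /= mulmx_diag; apply/matrixP => i j.
  by rewrite !mxE mulfV.
have [u _] := mulmx1_unit h.
rewrite -[invmx _]mulmx1 -h mulKmx // mxtrace_diag.
by apply: eq_bigr => i _; rewrite mxE.
Qed.

Lemma diag_hermitian n (x : 'I_n -> R) : hermitian (diag_mx (\row_i (x i)%:C%C)).
Proof.
apply/matrixP => i j; rewrite !mxE eq_sym; case: eqP => [->|_].
  by rewrite !mulr1n conj_real_complex.
by rewrite !mulr0n rmorph0.
Qed.

Lemma char_poly_conj n (U A V : 'M[C]_n) : U *m V = 1%:M ->
  char_poly (U *m A *m V) = char_poly A.
Proof.
move=> UV; have UVp : map_mx (@polyC C) U *m map_mx (@polyC C) V = 1%:M.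
  by rewrite -map_mxM UV map_mx1.
rewrite /char_poly; have -> : char_poly_mx (U *m A *m V) =
    map_mx (@polyC C) U *m char_poly_mx A *m map_mx (@polyC C) V.
  rewrite /char_poly_mx mulmxBr mulmxBl mul_mx_scalar -scalemxAl UVp scalemx1.
  by rewrite !map_mxM.
by rewrite !det_mulmx mulrAC -det_mulmx UVp det1 mul1r.
Qed.

(* For a Schur triangularisation T = U (H + M) U^* with U H U^* hermitian, the
   zeros of T below the diagonal force every off-diagonal entry of U H U^* to be
   an entry of U M U^* up to sign and conjugation, and the diagonal of U H U^* is real. *)
Lemma schur_perturbation n (H M : 'M[C]_n) : hermitian H -> (0 < n)%N ->
  exists l : 'I_n -> C,
  [/\ char_poly (H + M) = \prod_i ('X - (l i)%:P),
     \sum_i complex.Im (l i) ^+ 2 <= fro2 M &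
     forall (z : C) (a : R), 0 < complex.Im z -> 0 < a ->
       cabs (stieltjes H z - n%:R^-1 * \sum_i ((complex.Re (l i))%:C%C - z)^-1)
         <= (a * (complex.Im z)^-1 ^+ 4 + a^-1 * (2 * (n%:R^-1 * fro2 M))) / 2].
Proof.
move=> Hh n0; have [U Uu] := Schur (H + M) n0.
rewrite (_ : similar_to _ _ _ = is_trig_mx (conjmx U (H + M))) // conjymx //.
(* [is_trig_mx] means lower triangular: the entries with [i < j] vanish. *)
move=> /is_trig_mxP Ttrig; set T := U *m (H + M) *m U ^t* in Ttrig.
have TE : T = U *m H *m U ^t* + U *m M *m U ^t* by rewrite /T mulmxDr mulmxDl.
set H' := U *m H *m U ^t* in TE; set M' := U *m M *m U ^t* in TE.
have H'h : hermitian H' by apply: hermitian_conj.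
have M'f : fro2 M' = fro2 M.
  by rewrite /M' fro2_mul_unitary ?trmxC_unitary // fro2_unitary_mul.
have TC : char_poly T = char_poly (H + M).
  by rewrite /T char_poly_conj //; apply/unitarymxP.
have sH z : 0 < complex.Im z -> stieltjes H' z = stieltjes H z.
  exact: stieltjes_conj.
clearbody H' M' T.
have H'J i j : Num.conj (H' i j) = H' j i.
  by have /matrixP/(_ j i) := H'h; rewrite !mxE.
have H'd i : complex.Im (H' i i) = 0.
  by have := congr1 (@complex.Im R) (H'J i i); rewrite cImJ; lra.
exists (fun i => T i i); split.
- by rewrite -TC; apply: char_poly_trig; apply/is_trig_mxP.
- clear Hh TC sH H'h H'J; rewrite -M'f /fro2; apply: ler_sum => i _; rewrite (bigD1 i) //=.
  rewrite -[X in X <= _]addr0; apply: lerD; last first.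
    by apply: sumr_ge0 => j _; apply: sqr_ge0.
  rewrite TE mxE cImD H'd add0r cabs_sqr lerDr; exact: sqr_ge0.
- move=> z a z0 a0; rewrite -(stieltjes_diag (fun i => complex.Re (T i i)) z0) -(sH z z0).
  apply: le_trans (stieltjes_sub_fro2 H'h (diag_hermitian _) z0 n0 a0) _.
  clear Hh TC sH H'h.
  rewrite ler_pM2r ?invr_gt0 // lerD2l ler_pM2l ?invr_gt0 //.
  rewrite mulrCA ler_pM2l ?invr_gt0 ?ltr0n // -M'f.
  (* Which of the two mirror entries of [M'] controls an entry depends on the side of the diagonal;
     the factor 2 pays for both [M'] and its transpose. *)
  have -> : 2 * fro2 M' = fro2 M' + fro2 (M'^T).
    rewrite mulr_natl mulr2n; congr (_ + _); rewrite /fro2 exchange_big /=.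
    by apply: eq_bigr => i _; apply: eq_bigr => j _; rewrite [M'^T _ _]mxE.
  rewrite /fro2 -big_split /=; apply: ler_sum => i _ /=.
  rewrite -big_split /=; apply: ler_sum => j _ /=; rewrite !mxE.
  have [->|ij] := eqVneq i j.
    rewrite mulr1n TE mxE.
    have -> : (complex.Re (H' j j + M' j j))%:C%C - H' j j =
              (complex.Re (M' j j))%:C%C.
      apply/eqP; rewrite eq_complex cReB cImB /= cReD H'd subrr eqxx andbT.
      by apply/eqP; ring.
    rewrite cabs_real real_normK ?num_real // cabs_sqr -addrA lerDl.
    by rewrite !addr_ge0 ?sqr_ge0.
  rewrite mulr0n sub0r cabsN.
  have [lt_ij|lt_ji|/val_inj/eqP] := ltngtP i j; last by rewrite (negbTE ij).
    have := Ttrig _ _ lt_ij; rewrite TE mxE => /eqP; rewrite addr_eq0 => /eqP ->.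
    by rewrite cabsN lerDl sqr_ge0.
  have := Ttrig _ _ lt_ji; rewrite TE mxE => /eqP; rewrite addr_eq0 => /eqP e.
  by rewrite -H'J cabsJ e cabsN lerDr sqr_ge0.
Qed.

End Schur.

(** * Integration against the semicircle law: density and angle *)

Section SemicircleIntegral.
Context {R : realType}.
Local Notation mu := (@lebesgue_measure R).
Local Notation sc := (semicircle_law R).
Local Notation rho := (@semicircle_density R).

Let mrho : measurable_fun setT (EFin \o rho).
Proof. by apply/measurable_EFinP; exact: measurable_semicircle_density. Qed.

Let integral_semicircle_indic (E : set (borelC R)) : measurable E ->
  (\int[sc]_z (\1_E z)%:E = \int[mu]_x ((rho x)%:E * (\1_E x%:C%C)%:E))%E.
Proof.
move=> mE; rewrite integral_indic //= setIT /semicircle_law integral_mkcond.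
apply: eq_integral => x _; rewrite patchE indicE /=.
have -> : (x \in [set x0 : R | E x0%:C%C]) = (x%:C%C \in E).
  by apply/idP/idP; rewrite !inE.
by case: ifPn => _; rewrite ?mule1 ?mule0.
Qed.

Import HBNNSimple.

Let mreal : measurable_fun setT (real_complex R : R -> borelC R).
Proof. exact: measurable_real_complex. Qed.

Let integral_semicircle_nnsfun (f : {nnsfun (borelC R) >-> R}) :
  (\int[sc]_z (f z)%:E = \int[mu]_x ((rho x)%:E * (f x%:C%C)%:E))%E.
Proof.
under [LHS]eq_integral do rewrite fimfunE -fsumEFin//.
rewrite [LHS]ge0_integral_fsum//; last 2 first.
  - by move=> r; exact/measurable_EFinP/measurableT_comp.
  - by move=> n x _; rewrite EFinM nnfun_muleindic_ge0.
under [RHS]eq_integral.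
  move=> x xD; rewrite fimfunE -fsumEFin// ge0_mule_fsumr; last first.
    by move=> r; rewrite EFinM nnfun_muleindic_ge0.
  over.
have mind r : measurable_fun setT (fun x : R => (\1_(f @^-1` [set r]) x%:C%C)%:E : \bar R).
  apply/measurable_EFinP; apply: (measurableT_comp (f := \1_(f @^-1` [set r]) : borelC R -> R)) => //.
rewrite [RHS]ge0_integral_fsum//; last 2 first.
  - move=> r; apply: emeasurable_funM => //.
    under eq_fun do rewrite EFinM.
    by apply: emeasurable_funM; [exact: measurable_cst|exact: mind].
  - move=> n x _; rewrite mule_ge0 ?lee_fin ?semicircle_density_ge0 //.
    by rewrite -lee_fin EFinM nnfun_muleindic_ge0.
apply: eq_fsbigr => r _.
have [r0|r0] := leP 0 r; last first.
  have fr0 : f @^-1` [set r] = set0.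
    apply/seteqP; split => // x /= fx; have f0x : 0 <= f x by exact: fun_ge0.
    by move: f0x; rewrite fx leNgt r0.
  rewrite fr0; under eq_integral do rewrite indic0 mulr0.
  rewrite integral0; apply/esym/integral0_eq => x _.
  by rewrite indic0 mulr0 mule0.
under eq_integral do rewrite EFinM.
rewrite ge0_integralZl//; last exact/measurable_EFinP/measurable_indic.
rewrite integral_semicircle_indic // -ge0_integralZl//.
- by apply: eq_integral => x _; rewrite EFinM muleCA.
- by apply: emeasurable_funM; [exact: mrho|exact: mind].
- by move=> x _; rewrite mule_ge0 ?lee_fin ?semicircle_density_ge0.
Qed.

(** The law is given by its values on sets, so the density formula passes through indicators, simple
    functions and monotone convergence. *)
Lemma integral_semicircle_ge0 (f : borelC R -> \bar R) :
  measurable_fun setT f -> (forall x, 0 <= f x)%E ->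
  (\int[sc]_z f z = \int[mu]_x ((rho x)%:E * f x%:C%C))%E.
Proof.
move=> mf f0.
pose f_ := nnsfun_approx measurableT mf.
have mf_ n : measurable_fun setT (fun x : R => ((f_ n) x%:C%C)%:E).
  apply/measurable_EFinP; exact: (measurableT_comp (f := f_ n)).
transitivity (lim (\int[sc]_x (f_ n x)%:E @[n --> \oo])%E).
  rewrite -monotone_convergence//=.
  - apply: eq_integral => ? /[!inE] xD; apply/esym/cvg_lim => //=.
    exact: cvg_nnsfun_approx.
  - by move=> n; exact/measurable_EFinP/measurable_funTS.
  - by move=> n ? _; rewrite lee_fin.
  - by move=> ? _ ? ? mn; rewrite lee_fin; exact/lefP/nd_nnsfun_approx.
transitivity (lim (\int[mu]_x ((rho x)%:E * (f_ n x%:C%C)%:E) @[n --> \oo])%E).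
  by apply: congr_lim; apply/funext => n /=; exact: integral_semicircle_nnsfun.
rewrite -monotone_convergence//=.
- apply: eq_integral => x _; apply/cvg_lim => //; apply: cvgeZl => //.
  exact: cvg_nnsfun_approx.
- by move=> n; apply: emeasurable_funM; [exact: mrho|exact: mf_].
- by move=> n x _; rewrite mule_ge0 ?lee_fin ?semicircle_density_ge0.
- move=> x _ m n mn; apply: lee_wpmul2l; first by rewrite lee_fin semicircle_density_ge0.
  by rewrite lee_fin; have /lefP := nd_nnsfun_approx measurableT mf mn; exact.
Qed.

Let pi0 : 0 < pi :> R := pi_gt0 R.

(** Under [x = 2 cos t] the square root and the Jacobian each become [2 sin t] up to sign, and the
    integrand is continuous on a compact interval. The substitution is decreasing, hence the bounds
    [F pi] and [F 0] in this order. *)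
Lemma integral_semicircle_angle (g : R -> R) : continuous g ->
  (\int[mu]_x ((rho x)%:E * (g x)%:E) =
   \int[mu]_(t in `[0%R, pi]) (2 / pi * sin t ^+ 2 * g (2 * cos t))%:E)%E.
Proof.
move=> cg; pose G x := (2 * pi)^-1 * Num.sqrt (4 - x ^+ 2) * g x.
have -> : (\int[mu]_x ((rho x)%:E * (g x)%:E) = \int[mu]_(x in `[(-2)%R, 2%R]) (G x)%:E)%E.
  rewrite [RHS]integral_mkcond; apply: eq_integral => x _; rewrite patchE.
  rewrite /semicircle_density mem_setE; case: ifPn => _; first by rewrite -EFinM.
  by rewrite mul0e.
pose F (t : R) : R := 2 * cos t.
have F0 : F 0 = 2 by rewrite /F cos0 mulr1.
have Fpi : F pi = - 2 by rewrite /F cospi mulrN1.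
have dF (t : R) : is_derive t 1 F (- (2 * sin t)).
  by apply: is_derive_eq; rewrite /GRing.scale /= mulrN.
have F'E : derive1 F = fun t => - (2 * sin t).
  by apply/funext => t; rewrite derive1E; exact: derive_val.
have cF : continuous F.
  by move=> t; apply: cvgM; [exact: cvg_cst | exact: continuous_cos].
have csin : continuous (fun t : R => - (2 * sin t)).
  move=> t; apply: cvgN; apply: cvgM; [exact: cvg_cst | exact: continuous_sin].
have -> : (\int[mu]_(x in `[(-2)%R, 2%R]) (G x)%:E = \int[mu]_(x in `[F pi, F 0%R]) (G x)%:E)%E.
  by rewrite Fpi F0.
rewrite integration_by_substitution_decreasing ?F'E //.
- apply: eq_integral => t; rewrite inE /= in_itv /= => /andP[t0 tpi].
  congr EFin; transitivity
    ((2 * pi)^-1 * Num.sqrt (4 - (2 * cos t) ^+ 2) * g (2 * cos t) * - - (2 * sin t)) => //.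
  have -> : 4 - (2 * cos t) ^+ 2 = (2 * sin t) ^+ 2.
    by rewrite !exprMn sin2cos2; ring.
  rewrite sqrtr_sqr ger0_norm ?mulr_ge0 ?sin_ge0_pi ?t0 //.
  by rewrite opprK; move: (pi) pi0 => p p0; field; rewrite gt_eqF.
- exact: pi_ge0.
- move=> x y xI yI xy; by rewrite /F ltr_pM2l // ltr_cos.
- by apply/cvg_ex; exists (- (2 * sin 0)); apply: cvg_at_right_filter; exact: csin.
- by apply/cvg_ex; exists (- (2 * sin pi)); apply: cvg_at_left_filter; exact: csin.
- split; first by move=> t _; exact: ex_derive.
  + by apply: cvg_at_right_filter; exact: cF.
  + by apply: cvg_at_left_filter; exact: cF.
- apply: continuous_subspaceT => x; apply: cvgM; last exact: cg.
  apply: cvgM; first exact: cvg_cst.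
  apply: (@continuous_comp _ _ _ (fun x : R => 4 - x ^+ 2)); last exact: sqrt_continuous.
  by apply: cvgB; [exact: cvg_cst | exact: exprn_continuous].
Qed.

End SemicircleIntegral.

(** * The kernel 1 / (x - z) and the quadratic equation of the semicircle law *)

Section ResolventKernel.
Context {R : realType}.
Implicit Types (z c : R[i]) (x : R).

Lemma inv_shiftE x z : (x%:C%C - z)^-1 =
  Complex ((x - complex.Re z) / ((x - complex.Re z) ^+ 2 + complex.Im z ^+ 2))
          (complex.Im z / ((x - complex.Re z) ^+ 2 + complex.Im z ^+ 2)).
Proof.
case: z => a b; rewrite -[LHS]/(Complex _ _) /= sub0r sqrrN.
by congr Complex; rewrite mulNr opprK.
Qed.

Lemma shift_neq0 x z : 0 < complex.Im z -> x%:C%C - z != 0.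
Proof. by move=> z0; rewrite subr_eq0; apply: contraTneq z0 => <- /=; rewrite ltxx. Qed.

Lemma cabs_inv_shift x z : 0 < complex.Im z ->
  cabs (x%:C%C - z)^-1 <= (complex.Im z)^-1.
Proof.
move=> z0; have nz := shift_neq0 x z0.
rewrite cabsV lef_pV2 ?posrE //; last by rewrite lt_def cabs_eq0 nz cabs_ge0.
apply: le_trans (ler_Im_cabs _); rewrite cImB /= sub0r normrN.
exact: ler_norm.
Qed.

Lemma continuous_Re_inv_shift c z : 0 < complex.Im z ->
  continuous (fun x : R => complex.Re (c * (x%:C%C - z)^-1)).
Proof.
move=> z0; pose D (x : R) := (x - complex.Re z) ^+ 2 + complex.Im z ^+ 2.
have cB : continuous (fun x : R => x - complex.Re z).
  by move=> x; apply: cvgB; [exact: cvg_id | exact: cvg_cst].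
have cD : continuous (fun x => (D x)^-1).
  move=> x; apply: cvgV; first by rewrite gt_eqF // ltr_wpDl ?sqr_ge0 // exprn_gt0.
  apply: cvgD; last exact: cvg_cst.
  exact: (@continuous_comp _ _ _ (fun x : R => x - complex.Re z) (fun x => x ^+ 2) x
    (cB x) (@exprn_continuous _ 2 _)).
have -> : (fun x : R => complex.Re (c * (x%:C%C - z)^-1)) =
    (fun x => (complex.Re c * (x - complex.Re z) - complex.Im c * complex.Im z) * (D x)^-1).
  by apply/funext => x; rewrite inv_shiftE cReM /= -/(D x); ring.
move=> x; apply: cvgM; last exact: cD.
apply: cvgB; last exact: cvg_cst.
by apply: cvgM; [exact: cvg_cst | exact: cB].
Qed.

(* The root of [m^2 + z m + 1 = 0] in the upper half plane is [- u], where [u] is the root of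
   [u^2 - z u + 1 = 0] in the unit disc. *)
Lemma semicircle_root z : 0 < complex.Im z -> exists u : R[i],
  [/\ u ^+ 2 - z * u + 1 = 0, cabs u < 1 & complex.Im u < 0].
Proof.
move=> z0; pose s := sqrtc (z ^+ 2 - 4).
have sE : s ^+ 2 = z ^+ 2 - 4 by apply: sqr_sqrtc.
pose u1 := (z + s) / 2; pose u2 := (z - s) / 2.
have u1r : u1 ^+ 2 - z * u1 + 1 = 0.
  by rewrite /u1; have -> : ((z + s) / 2) ^+ 2 - z * ((z + s) / 2) + 1 = (s ^+ 2 - z ^+ 2 + 4) / 4;
     [field | rewrite sE; field].
have u2r : u2 ^+ 2 - z * u2 + 1 = 0.
  by rewrite /u2; have -> : ((z - s) / 2) ^+ 2 - z * ((z - s) / 2) + 1 = (s ^+ 2 - z ^+ 2 + 4) / 4;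
     [field | rewrite sE; field].
have u12 : u1 * u2 = 1.
  by rewrite /u1 /u2; have -> : (z + s) / 2 * ((z - s) / 2) = (z ^+ 2 - s ^+ 2) / 4;
     [field | rewrite sE; field].
have [u [ur u1le]] : exists u, u ^+ 2 - z * u + 1 = 0 /\ cabs u <= 1.
  have := congr1 (@cabs R) u12; rewrite cabsM cabs1 => u12n.
  have [le|lt] := leP (cabs u1) 1; first by exists u1.
  exists u2; split => //; rewrite leNgt; apply/negP => lt2.
  by have := ltr_pM ler01 ler01 lt lt2; rewrite u12n mulr1 ltxx.
have u0 : u != 0.
  by apply/eqP => u0; move/eqP: ur; rewrite u0 expr0n mulr0 subr0 add0r oner_eq0.
(* Imaginary parts of [z = u + 1 / u], multiplied by [|u|^2], give [Im z |u|^2 = (|u|^2 - 1) Im u]: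
   this rules out [|u| = 1] and fixes the sign of [Im u]. *)
have zE : z * (cabs u ^+ 2)%:C%C = u * (cabs u ^+ 2)%:C%C + Num.conj u.
  have zu : z = u + u^-1.
    apply: (mulIf u0); rewrite mulrDl mulVf // -expr2.
    by apply/eqP; rewrite -subr_eq0 -oppr_eq0 -ur; apply/eqP; ring.
  by rewrite cabs_conj {1}zu mulrDl; congr (_ + _); rewrite mulrA mulVf // mul1r.
have := congr1 (@complex.Im R) zE.
rewrite cImD !cImM cImJ /= !mulr0 !add0r => zI.
have c0 : 0 < cabs u by rewrite lt_def cabs_eq0 u0 cabs_ge0.
have c1 : cabs u < 1.
  rewrite lt_neqAle u1le andbT; apply/eqP => u1'; move: zI; rewrite u1' expr1n.
  by lra.
exists u; split => //.
have c2 : cabs u ^+ 2 < 1 by rewrite expr_lt1 ?cabs_ge0.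
have : 0 < complex.Im z * cabs u ^+ 2 by rewrite mulr_gt0 // exprn_gt0.
by rewrite zI; nra.
Qed.

End ResolventKernel.

(** * Trigonometric integrals and the Stieltjes transform of the semicircle law *)

Section AngleIntegrals.
Context {R : realType}.
Local Notation mu := (@lebesgue_measure R).
Let pi0 : 0 < pi :> R := pi_gt0 R.

Lemma angle_integrable (phi : R -> R) : continuous phi ->
  mu.-integrable `[0, pi] (EFin \o phi).
Proof.
move=> cphi; apply: continuous_compact_integrable; first exact: segment_compact.
exact: continuous_subspaceT.
Qed.

Lemma continuous_sinM (a : R) : continuous (fun t : R => sin (a * t)).
Proof.
move=> t; apply: (@continuous_comp _ _ _ (fun t : R => a * t) (@sin R)).
  by apply: cvgM; [exact: cvg_cst | exact: cvg_id].
exact: continuous_sin.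
Qed.

Lemma sin_natpi (k : nat) : sin (k%:R * pi) = 0 :> R.
Proof.
elim: k => [|k IH]; first by rewrite mul0r sin0.
by rewrite -natr1 mulrDl mul1r sinDpi IH oppr0.
Qed.

Lemma angle_FTC (phi F : R -> R) : continuous phi ->
  (forall t : R, is_derive t 1 F (phi t)) ->
  \int[mu]_(t in `[0, pi]) phi t = F pi - F 0.
Proof.
move=> cphi dF; rewrite /Rintegral.
have cF : continuous F.
  by move=> t; apply: differentiable_continuous; apply/derivable1_diffP; exact: ex_derive.
rewrite (@continuous_FTC2 _ _ F) //.
- exact: continuous_subspaceT.
- split; first by move=> t _; exact: ex_derive.
  + by apply: cvg_at_right_filter; exact: cF.
  + by apply: cvg_at_left_filter; exact: cF.
- by move=> t _; rewrite derive1E; exact: derive_val.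
Qed.

Lemma sin_mul_sin (k : nat) (t : R) : sin t * sin (k.+2%:R * t) =
  (cos (k.+1%:R * t) - cos (k.+3%:R * t)) / 2.
Proof.
have -> : k.+1%:R * t = k.+2%:R * t - t by rewrite -[k.+2%:R]natr1; ring.
have -> : k.+3%:R * t = k.+2%:R * t + t by rewrite -[k.+3%:R]natr1; ring.
by rewrite cosB cosD; field.
Qed.

(** Turning the product into a sum gives primitives made of sines of integer multiples of [t], which
    vanish at both ends; for [k = 0] one frequency is zero and leaves the term [t / 2]. *)
Lemma angle_orthogonality (k : nat) :
  \int[mu]_(t in `[0, pi]) (sin t * sin (k.+1%:R * t)) = if k == 0%N then pi / 2 else 0.
Proof.
have cphi j : continuous (fun t : R => sin t * sin (j.+1%:R * t)).
  by move=> t; apply: cvgM; [exact: continuous_sin | exact: continuous_sinM].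
case: k => [|k] /=.
  have dF (t : R) : is_derive t 1 (fun t => t / 2 - sin (2 * t) / 4) (sin t * sin (1 * t)).
    apply: is_derive_eq.
    by rewrite mul1r mulr_natl mulr2n cosD -!expr2 sin2cos2 /GRing.scale /=; field.
  rewrite (angle_FTC (cphi 0%N) dF).
  by rewrite sin_natpi mul0r mulr0 sin0 !mul0r !subr0.
have dF (t : R) : is_derive t 1 (fun t => sin (k.+1%:R * t) / (2 * k.+1%:R)
    - sin (k.+3%:R * t) / (2 * k.+3%:R)) (sin t * sin (k.+2%:R * t)).
  apply: is_derive_eq.
  rewrite sin_mul_sin /GRing.scale /=; field.
  by apply/andP; split; rewrite gt_eqF // ltr_wpDr ?ler0n.
rewrite (angle_FTC (cphi k.+1) dF).
by rewrite !sin_natpi !mulr0 !sin0 !mul0r !subr0.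
Qed.

Lemma continuous_angle_sum (c : nat -> R) (M : nat) :
  continuous (fun t : R => \sum_(k < M) c k * (sin t * sin (k.+1%:R * t))).
Proof.
have cphi j : continuous (fun t : R => c j * (sin t * sin (j.+1%:R * t))).
  move=> t; apply: cvgM; first exact: cvg_cst.
  by apply: cvgM; [exact: continuous_sin | exact: continuous_sinM].
elim: M => [|M IH].
  by under eq_fun do rewrite big_ord0; move=> t; exact: cvg_cst.
under eq_fun do rewrite big_ord_recr /=.
by move=> t; apply: cvgD; [exact: IH | exact: cphi].
Qed.

Lemma angle_sum (c : nat -> R) (N : nat) :
  \int[mu]_(t in `[0, pi]) (\sum_(k < N.+1) c k * (sin t * sin (k.+1%:R * t))) =
  c 0%N * (pi / 2).
Proof.
have cphi j : continuous (fun t : R => sin t * sin (j.+1%:R * t)).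
  by move=> t; apply: cvgM; [exact: continuous_sin | exact: continuous_sinM].
have cphi' j : continuous (fun t : R => c j * (sin t * sin (j.+1%:R * t))).
  by move=> t; apply: cvgM; [exact: cvg_cst | exact: cphi].
elim: N => [|N IH].
  under eq_Rintegral do rewrite big_ord1.
  by rewrite RintegralZl ?angle_orthogonality //; exact: (angle_integrable (cphi 0%N)).
under eq_Rintegral do rewrite big_ord_recr /=.
rewrite RintegralD //; [|exact: (angle_integrable (@continuous_angle_sum c _))|exact: (angle_integrable (cphi' _))].
rewrite IH RintegralZl ?angle_orthogonality ?mulr0 ?addr0 //.
exact: (angle_integrable (cphi _)).
Qed.

(** The generating function of the Chebyshev polynomials of the second kind,
    [sin ((k + 1) t) = sin t U_k(cos t)], evaluated at [u] with [u + 1 / u = z]. The partial sum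
    keeps its exact remainder, so that no infinite series has to be integrated. *)
Lemma sin_series (u z : R[i]) (N : nat) (t : R) : 0 < complex.Im z ->
  u ^+ 2 - z * u + 1 = 0 ->
  (sin t)%:C%C * ((2 * cos t)%:C%C - z)^-1 =
  - (\sum_(k < N) u ^+ k.+1 * (sin (k.+1%:R * t))%:C%C) +
  (u ^+ N * (sin (N.+1%:R * t))%:C%C - u ^+ N.+1 * (sin (N%:R * t))%:C%C)
    * ((2 * cos t)%:C%C - z)^-1.
Proof.
move=> z0 ur; have := shift_neq0 (2 * cos t) z0.
set x := (2 * cos t)%:C%C => nz; apply: (mulIf nz); rewrite mulrDl !mulfVK // .
elim: N => [|N IH].
  by rewrite big_ord0 oppr0 mul0r add0r expr0 !mul1r mul0r sin0 mulr0 subr0.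
rewrite IH big_ord_recr /= opprD mulrDl -!addrA; congr (_ + _).
have -> : sin (N.+2%:R * t) = 2 * cos t * sin (N.+1%:R * t) - sin (N%:R * t).
  have -> : N.+2%:R * t = N.+1%:R * t + t by rewrite -[N.+2%:R]natr1; ring.
  have -> : sin (N%:R * t) = sin (N.+1%:R * t - t).
    by congr sin; rewrite -[N.+1%:R]natr1; ring.
  by rewrite sinD sinB; ring.
rewrite rmorphB rmorphM /=.
have zE : z * u = u ^+ 2 + 1.
  by apply/eqP; rewrite -subr_eq0 -oppr_eq0 -ur; apply/eqP; ring.
set s1 := (sin _)%:C%C; set s0 := (sin _)%:C%C; rewrite -/x.
transitivity (u ^+ N * (z * u) * s1 - u ^+ N.+1 * s0 - u ^+ N.+2 * s1); last first.
  by rewrite !exprS; move: (u ^+ N) => p; ring.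
by rewrite zE !exprS; move: (u ^+ N) => p; ring.
Qed.

(** Orthogonality leaves only the first term [- u] of the series, and the remainder is geometric in
    [|u|], uniformly in [t]. The free factor [c] lets a real integral stand for both components of
    the complex one. *)
Lemma angle_stieltjes (c u z : R[i]) : 0 < complex.Im z ->
  u ^+ 2 - z * u + 1 = 0 -> cabs u < 1 ->
  \int[mu]_(t in `[0, pi]) (2 / pi * sin t ^+ 2 *
     complex.Re (c * ((2 * cos t)%:C%C - z)^-1)) = complex.Re (c * - u).
Proof.
move=> z0 ur u1.
have cg : continuous (fun t : R => complex.Re (c * ((2 * cos t)%:C%C - z)^-1)).
  move=> t; apply: (@continuous_comp _ _ _ (fun t : R => 2 * cos t)
     (fun x : R => complex.Re (c * (x%:C%C - z)^-1))).
    by apply: cvgM; [exact: cvg_cst | exact: continuous_cos].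
  exact: continuous_Re_inv_shift.
have csin2 : continuous (fun t : R => sin t ^+ 2).
  move=> t; apply: (@continuous_comp _ _ _ (@sin R) (fun x => x ^+ 2)).
    exact: continuous_sin.
  exact: exprn_continuous.
pose phi t := sin t ^+ 2 * complex.Re (c * ((2 * cos t)%:C%C - z)^-1).
have cphi : continuous phi by move=> t; apply: cvgM; [exact: csin2|exact: cg].
under eq_Rintegral do rewrite -mulrA.
rewrite RintegralZl //; last exact: (angle_integrable cphi).
suff -> : \int[mu]_(t in `[0, pi]) phi t = complex.Re (c * - u) * (pi / 2).
  by move: (complex.Re _) (pi) pi0 => r p p0; field; rewrite gt_eqF.
pose a k := complex.Re (c * - u ^+ k.+1).
pose psi N t := \sum_(k < N.+1) a k * (sin t * sin (k.+1%:R * t)).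
have bound N t : `|phi t - psi N t| <= 2 * cabs c * (complex.Im z)^-1 * cabs u ^+ N.+1.
  rewrite /phi expr2 -mulrA.
  have -> : sin t * complex.Re (c * ((2 * cos t)%:C%C - z)^-1) =
      complex.Re (c * ((sin t)%:C%C * ((2 * cos t)%:C%C - z)^-1)).
    by rewrite [(sin t)%:C%C * _]mulrC mulrA cReMr mulrC.
  rewrite (sin_series N.+1 t z0 ur) mulrDr cReD mulrDr.
  have -> : psi N t = sin t * complex.Re (c * - \sum_(k < N.+1) u ^+ k.+1 * (sin (k.+1%:R * t))%:C%C).
    rewrite /psi -sumrN mulr_sumr cRe_sum mulr_sumr; apply: eq_bigr => k _.
    by rewrite /a -mulNr [c * (_ * _)]mulrA cReMr; ring.
  rewrite addrAC subrr add0r normrM.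
  apply: (@le_trans _ _ (1 * `|complex.Re (c * ((u ^+ N.+1 * (sin (N.+2%:R * t))%:C%C -
     u ^+ N.+2 * (sin (N.+1%:R * t))%:C%C) / ((2 * cos t)%:C%C - z)))|)).
    by rewrite ler_wpM2r // ler_norml sin_geN1 sin_le1.
  rewrite mul1r; apply: le_trans (ler_Re_cabs _) _.
  rewrite (_ : 2 * cabs c / complex.Im z * _ =
    cabs c * (2 * cabs u ^+ N.+1 * (complex.Im z)^-1)); last by ring.
  rewrite cabsM ler_wpM2l ?cabs_ge0 // cabsM.
  apply: ler_pM; [exact: cabs_ge0|exact: cabs_ge0| |exact: cabs_inv_shift].
  have sb (s : R) : cabs (sin s)%:C%C <= 1 by rewrite cabs_real ler_norml sin_geN1 sin_le1.
  have c0 := cabs_ge0 u.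
  apply: le_trans (ler_cabsB _ _) _; rewrite !cabsM !cabsX.
  have -> : 2 * cabs u ^+ N.+1 = cabs u ^+ N.+1 + cabs u ^+ N.+1 by ring.
  apply: lerD; first by rewrite ler_piMr ?exprn_ge0.
  apply: (@le_trans _ _ (cabs u * cabs u ^+ N.+1)).
    by rewrite ler_piMr ?mulr_ge0 ?exprn_ge0.
  by rewrite ler_piMl ?exprn_ge0 // ltW.
have cpsi N : continuous (psi N) by exact: continuous_angle_sum.
have err N : `|\int[mu]_(t in `[0, pi]) phi t - complex.Re (c * - u) * (pi / 2)| <=
    2 * cabs c * (complex.Im z)^-1 * cabs u ^+ N.+1 * pi.
  have -> : complex.Re (c * - u) * (pi / 2) = \int[mu]_(t in `[0, pi]) psi N t.
    by rewrite angle_sum /a expr1.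
  rewrite -RintegralB //; [|exact: (angle_integrable cphi)|exact: (angle_integrable (cpsi N))].
  have cd : continuous (fun t => phi t - psi N t).
    by move=> t; apply: cvgB; [exact: cphi|exact: cpsi].
  apply: le_trans (le_normr_Rintegral _ (angle_integrable cd)) _ => //.
  have cn : continuous (fun t => `|phi t - psi N t|).
    by move=> t; apply: cvg_norm; exact: cd.
  set K := 2 * cabs c * _ * _.
  have cK : continuous (fun _ : R => K) by move=> t; exact: cvg_cst.
  have -> : K * pi = \int[mu]_(t in `[0, pi]) K.
    rewrite Rintegral_cst //= lebesgue_measure_itv /= lte_fin pi0.
    by rewrite -EFinB subr0.
  apply: le_Rintegral => //; first exact: (angle_integrable cn).
  exact: (angle_integrable cK).
have K0 : (2 * cabs c * (complex.Im z)^-1 * pi * cabs u) * cabs u ^+ N @[N --> \oo] --> (0 : R).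
  by apply: cvg_geometric; rewrite ger0_norm ?cabs_ge0.
apply/eqP; rewrite -subr_eq0 -normr_le0; apply/ler_addgt0Pr => e e0.
have [N _ /(_ N (leqnn N))] := (cvgrPdist_le _ _).1 K0 e e0.
rewrite sub0r normrN add0r => h; apply: le_trans h; apply: le_trans (ler_norm _).
by apply: le_trans (err N) _; rewrite le_eqVlt exprS; apply/orP; left; apply/eqP; ring.
Qed.

End AngleIntegrals.

(** * The semicircle mean as a functional on continuous functions *)

Section SemicircleStieltjes.
Context {R : realType}.
Local Notation mu := (@lebesgue_measure R).
Local Notation sc := (semicircle_law R).

Lemma continuous_measurable_borelC (f : R[i] -> R) : continuous f ->
  measurable_fun setT (f : borelC R -> R).
Proof.
move=> cf; apply: (measurability _ (RGenOpens.measurableE R)).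
move=> _ [_ [a [b ->] <-]]; rewrite setTI; apply: sub_sigma_algebra.
by apply: open_comp => // x _; exact: cf.
Qed.

(* The semicircle law after the substitution [x = 2 cos t]. *)
Definition sc_mean (g : R -> R) : R :=
  \int[mu]_(t in `[0, pi]) (2 / pi * sin t ^+ 2 * g (2 * cos t)).

Let pi0 : 0 < pi :> R := pi_gt0 R.

Lemma continuous_sc_integrand (g : R -> R) : continuous g ->
  continuous (fun t : R => 2 / pi * sin t ^+ 2 * g (2 * cos t)).
Proof.
move=> cg t; apply: cvgM.
  apply: cvgM; first exact: cvg_cst.
  apply: (@continuous_comp _ _ _ (@sin R) (fun x => x ^+ 2)).
    exact: continuous_sin.
  exact: exprn_continuous.
apply: (@continuous_comp _ _ _ (fun t : R => 2 * cos t) g); last exact: cg.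
by apply: cvgM; [exact: cvg_cst | exact: continuous_cos].
Qed.

Lemma sc_mean1 : sc_mean (fun=> 1) = 1.
Proof.
have c1 : continuous (fun _ : R => (1 : R)) by move=> t; exact: cvg_cst.
rewrite /sc_mean; under eq_Rintegral do rewrite mulr1 expr2.
have cs : continuous (fun t : R => sin t * sin t).
  by move=> t; apply: cvgM; exact: continuous_sin.
rewrite RintegralZl //; last exact: (angle_integrable cs).
have := @angle_orthogonality R 0; under eq_Rintegral do rewrite mul1r.
rewrite /=.
by move=> ->; move: (pi) pi0 => p p0; field; rewrite gt_eqF.
Qed.

Lemma sc_meanD (g h : R -> R) : continuous g -> continuous h ->
  sc_mean (fun x => g x + h x) = sc_mean g + sc_mean h.
Proof.
move=> cg ch; rewrite /sc_mean; under eq_Rintegral do rewrite mulrDr.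
rewrite RintegralD //; [exact: (angle_integrable (continuous_sc_integrand cg))|].
exact: (angle_integrable (continuous_sc_integrand ch)).
Qed.

Lemma sc_meanZ (a : R) (g : R -> R) : continuous g ->
  sc_mean (fun x => a * g x) = a * sc_mean g.
Proof.
move=> cg; rewrite /sc_mean; under eq_Rintegral do rewrite mulrCA.
by rewrite RintegralZl //; exact: (angle_integrable (continuous_sc_integrand cg)).
Qed.

Lemma sc_mean_le (g h : R -> R) : continuous g -> continuous h ->
  (forall x, -2 <= x <= 2 -> g x <= h x) -> sc_mean g <= sc_mean h.
Proof.
move=> cg ch gh; apply: le_Rintegral => //.
- exact: (angle_integrable (continuous_sc_integrand cg)).
- exact: (angle_integrable (continuous_sc_integrand ch)).
- move=> t _; apply: ler_wpM2l.
    by rewrite mulr_ge0 ?sqr_ge0 // divr_ge0 // ltW.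
  by apply: gh; have := cos_geN1 t; have := cos_le1 t; lra.
Qed.

(** Here [m] is [- u] for the root [u] in the unit disc; [c = 1] reads off its real part and
    [c = - 'i] its imaginary part. *)
Lemma sc_mean_stieltjes (z : R[i]) : 0 < complex.Im z ->
  exists m : R[i], [/\ 0 < complex.Im m, m ^+ 2 + z * m + 1 = 0 &
   forall c, sc_mean (fun x => complex.Re (c * (x%:C%C - z)^-1)) = complex.Re (c * m)].
Proof.
move=> z0; have [u [ur u1 uI]] := semicircle_root z0.
exists (- u); split.
- by move: uI; case: (u) => a b /=; rewrite oppr_gt0.
- by rewrite sqrrN mulrN.
- by move=> c; exact: angle_stieltjes.
Qed.

(** The density formula is for nonnegative functions: it is applied to [f + K] and, for the total
    mass, to the constant 1. *)
Lemma integral_sc_mean (f : R[i] -> R) (K : R) : continuous f ->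
  (forall z, `|f z| <= K) ->
  (\int[sc]_z (f z)%:E)%E = (sc_mean (fun x => f x%:C%C))%:E.
Proof.
move=> cf fK; have mf := continuous_measurable_borelC cf.
have K0 : 0 <= K by apply: le_trans (fK 0).
have cfx : continuous (fun x : R => f x%:C%C).
  by move=> x; apply: continuous_comp; [exact: continuous_real_complex | exact: cf].
have ge0 (g : R[i] -> R) : continuous g -> (forall z, 0 <= g z) ->
    (\int[sc]_z (g z)%:E)%E = (sc_mean (fun x => g x%:C%C))%:E.
  move=> cg g0; have cgx : continuous (fun x : R => g x%:C%C).
    by move=> x; apply: continuous_comp; [exact: continuous_real_complex | exact: cg].
  rewrite integral_semicircle_ge0; last 2 first.
    by apply/measurable_EFinP; exact: continuous_measurable_borelC.
    by move=> z; rewrite lee_fin.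
  rewrite (integral_semicircle_angle cgx) /sc_mean /Rintegral fineK //.
  apply: integrable_fin_num => //.
  exact: (angle_integrable (continuous_sc_integrand cgx)).
have c1 : continuous (fun _ : R[i] => (1 : R)) by move=> t; exact: cst_continuous.
have sc1 : sc setT = 1%E.
  have := ge0 _ c1 (fun=> ler01); rewrite sc_mean1.
  by rewrite integral_cst // mul1e.
have cfK : continuous (fun z => f z + K).
  by move=> z; apply: continuousD; [exact: cf|exact: cst_continuous].
have scT : (sc setT < +oo)%E by rewrite sc1 ltry.
have fin : fin_num_fun sc.
  move=> A mA; rewrite ge0_fin_numE //; apply: (@le_lt_trans _ _ (sc setT)).
    by apply: le_measure; rewrite ?inE.
  by rewrite sc1 ltry.
have fK0 z : 0 <= f z + K by have := fK z; rewrite ler_norml; lra.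
have := ge0 _ cfK fK0; rewrite sc_meanD //; last first.
  by move=> x; exact: cvg_cst.
have -> : sc_mean (fun=> K) = K.
  have c1' : continuous (fun _ : R => (1 : R)) by move=> t; exact: cvg_cst.
  transitivity (sc_mean (fun=> K * 1)); last by rewrite sc_meanZ // sc_mean1 mulr1.
  by congr sc_mean; apply/funext => x; rewrite mulr1.
under eq_integral do rewrite EFinD.
rewrite integralD //; first last.
- apply: measurable_bounded_integrable => //.
  by exists `|K|; split; [exact: num_real|move=> M KM x _ /=; apply: ltW].
- apply: measurable_bounded_integrable => //.
  exists K; split; first exact: num_real.
  by move=> M KM x _ /=; apply: le_trans (fK x) (ltW KM).
rewrite integral_cst //= sc1 mule1 EFinD => h.
by case: (integral _ _ _) h => [r| |] //= -[] /addIr ->.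
Qed.

End SemicircleStieltjes.

(** * Uniform continuity on segments and in strips *)

Section UniformContinuity.
Context {R : realType}.

(** Compactness in its near-covering form turns radii that depend on the point into a single one;
    [phi] is left abstract to serve functions of a real and of a complex variable. *)
Lemma uniform_on_segment (phi : R -> R -> Prop) (L : R) :
  (forall x, `|x| <= L -> exists2 r : R, 0 < r &
     forall x' h, `|x' - x| < r -> `|h| < r -> phi x' h) ->
  exists2 d : R, 0 < d & forall x h, `|x| <= L -> `|h| <= d -> phi x h.
Proof.
move=> loc; have cK : compact `[-L, L]%classic by exact: segment_compact.
move/compact_near_coveringP : cK.
move=> /(_ R (nbhs (0 : R)) (fun h x => phi x h) _) []; last first.
  move=> d /= d0 dK; exists (d / 2); first by rewrite divr_gt0.
  move=> x h xL hd; apply: (dK h); last by rewrite /= in_itv /= -ler_norml.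
  by rewrite /ball_ /= sub0r normrN; apply: le_lt_trans hd _; rewrite ltr_pdivrMr // ltr_pMr // ltr1n.
move=> x; rewrite /= in_itv /= -ler_norml => /loc [r r0 H].
exists (ball x r, ball (0 : R) r) => /=.
  by split; exact: nbhsx_ballx.
case=> x' h /= [bx bh]; apply: H; first by rewrite distrC.
by move: bh; rewrite /ball /= sub0r normrN.
Qed.

Lemma continuous_epsdelta (g : R -> R) (x e : R) : {for x, continuous g} -> 0 < e ->
  exists2 r : R, 0 < r & forall x', `|x' - x| < r -> `|g x' - g x| <= e.
Proof.
move=> cg e0; have /cvgrPdist_le/(_ e e0) : g y @[y --> x] --> g x by exact: cg.
move=> /nbhs_ballP [r /= r0 H]; exists r => // x' x'r; rewrite distrC.
by apply: H; rewrite /ball /= distrC.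
Qed.

Lemma continuousC_epsdelta (f : R[i] -> R) (w : R[i]) (e : R) : continuous f -> 0 < e ->
  exists2 r : R, 0 < r & forall w', cabs (w' - w) < r -> `|f w' - f w| <= e.
Proof.
move=> cf e0; have /cvgrPdist_le/(_ e e0) : f y @[y --> w] --> f w by exact: cf.
move=> /nbhs_ballP [r /= r0 H].
have rE : r = (complex.Re r)%:C%C by rewrite RRe_real // ger0_real // ltW.
exists (complex.Re r); first by rewrite -ltcR -rE.
move=> w' x'r; rewrite distrC.
by apply: H; rewrite /ball /= distrC -cabsE rE ltcR.
Qed.

Lemma uniform_segment (g : R -> R) (L e : R) : continuous g -> 0 < e ->
  exists2 d : R, 0 < d & forall x h, `|x| <= L -> `|h| <= d -> `|g (x + h) - g x| <= e.
Proof.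
move=> cg e0; apply: uniform_on_segment => x _.
have [|r r0 H] := @continuous_epsdelta g x (e / 2) (cg x); first by rewrite divr_gt0.
exists (r / 2); first by rewrite divr_gt0.
move=> x' h x'x hr; have h1 : `|g (x' + h) - g x| <= e / 2.
  apply: H; rewrite addrAC; apply: le_lt_trans (ler_normD _ _) _; lra.
have h2 : `|g x' - g x| <= e / 2 by apply: H; lra.
rewrite -(subrKA (g x)) [e]splitr; apply: le_trans (ler_normD _ _) (lerD h1 _).
by rewrite distrC.
Qed.

(** Allows a point with small imaginary part to be replaced by its real part, as long as the latter
    stays bounded. *)
Lemma uniform_strip (f : R[i] -> R) (L e : R) : continuous f -> 0 < e ->
  exists2 d : R, 0 < d & forall w : R[i], `|complex.Re w| <= L -> `|complex.Im w| <= d ->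
    `|f w - f (complex.Re w)%:C%C| <= e.
Proof.
move=> cf e0.
suff [d d0 H] : exists2 d : R, 0 < d & forall x h, `|x| <= L -> `|h| <= d ->
    `|f (Complex x h) - f x%:C%C| <= e.
  by exists d => // -[x h] /= xL hd; apply: H.
apply: uniform_on_segment => x _.
have [|r r0 H] := @continuousC_epsdelta f x%:C%C (e / 2) cf; first by rewrite divr_gt0.
exists (r / 2); first by rewrite divr_gt0.
move=> x' h x'x hr; have h1 : `|f (Complex x' h) - f x%:C%C| <= e / 2.
  apply: H; apply: le_lt_trans (ler_cabs_ReIm _) _; rewrite /= subr0; lra.
have h2 : `|f x'%:C%C - f x%:C%C| <= e / 2.
  apply: H; apply: le_lt_trans (ler_cabs_ReIm _) _; rewrite /= subr0 normr0; lra.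
rewrite -(subrKA (f x%:C%C)) [e]splitr; apply: le_trans (ler_normD _ _) (lerD h1 _).
by rewrite distrC.
Qed.

End UniformContinuity.

(** * Poisson kernels and their primitives *)

Section Poisson.
Context {R : realType}.

(** For [K > 0], the Poisson kernel at height [1 / K] in an unnormalised form: its integral over [x]
    is [pi]. *)
Definition poisson (K a x : R) : R := K / (1 + (K * (x - a)) ^+ 2).

Lemma poisson_den (K a x : R) : 0 < 1 + (K * (x - a)) ^+ 2.
Proof. by rewrite ltr_wpDr ?sqr_ge0. Qed.

Lemma poissonE (K a x : R) : 0 < K ->
  poisson K a x = complex.Im ((x%:C%C - Complex a K^-1)^-1).
Proof.
move=> K0; rewrite inv_shiftE /= /poisson; field.
by rewrite (gt_eqF K0) /= gt_eqF // ltr_wpDl ?sqr_ge0.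
Qed.

Lemma continuous_poisson (K a : R) : continuous (poisson K a).
Proof.
move=> x; apply: cvgM; first exact: cvg_cst.
apply: cvgV; first by rewrite gt_eqF // poisson_den.
apply: cvgD; first exact: cvg_cst.
apply: (@continuous_comp _ _ _ (fun x : R => K * (x - a)) (fun x => x ^+ 2)); last first.
  exact: exprn_continuous.
by apply: cvgM; [exact: cvg_cst | apply: cvgB; [exact: cvg_id | exact: cvg_cst]].
Qed.

Lemma inv_sqr_lip (u v : R) : `|(1 + u ^+ 2)^-1 - (1 + v ^+ 2)^-1| <= `|u - v|.
Proof.
have u0 : 0 < 1 + u ^+ 2 by rewrite ltr_wpDr ?sqr_ge0.
have v0 : 0 < 1 + v ^+ 2 by rewrite ltr_wpDr ?sqr_ge0.
have -> : (1 + u ^+ 2)^-1 - (1 + v ^+ 2)^-1 =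
    (u - v) * (- (u + v) / ((1 + u ^+ 2) * (1 + v ^+ 2))).
  by field; rewrite !gt_eqF.
rewrite normrM -[leRHS]mulr1 ler_wpM2l // normrM normrN normfV.
have uv0 : 0 < (1 + u ^+ 2) * (1 + v ^+ 2) by rewrite mulr_gt0.
rewrite (gtr0_norm uv0) ler_pdivrMr // mul1r.
rewrite ler_norml; have := sqr_ge0 (u - 1); have := sqr_ge0 (v - 1).
have := sqr_ge0 (u + 1); have := sqr_ge0 (v + 1); have := sqr_ge0 (u * v).
by move=> *; apply/andP; split; nra.
Qed.

Lemma poisson_lip (K a b x : R) : 0 < K ->
  `|poisson K a x - poisson K b x| <= K ^+ 2 * `|a - b|.
Proof.
move=> K0; rewrite /poisson -mulrBr normrM (gtr0_norm K0) expr2 -[leRHS]mulrA ler_pM2l //.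
apply: le_trans (inv_sqr_lip _ _) _; rewrite -mulrBr normrM (gtr0_norm K0) ler_pM2l //.
by rewrite [leRHS]distrC le_eqVlt; apply/orP; left; apply/eqP; congr `|_|; ring.
Qed.

(** The integral of [poisson K c x] over the centre [c] from [a] to [b]. For [a < b] and large [K]
    it is close to [pi] between [a] and [b] and to 0 outside. *)
Definition bump (K a b x : R) : R := atan (K * (x - a)) - atan (K * (x - b)).

Lemma continuous_bump (K a b : R) : continuous (bump K a b).
Proof.
have c c' : continuous (fun x : R => atan (K * (x - c'))).
  move=> x; apply: (@continuous_comp _ _ _ (fun x : R => K * (x - c')) (@atan R)).
    by apply: cvgM; [exact: cvg_cst | apply: cvgB; [exact: cvg_id | exact: cvg_cst]].
  exact: continuous_atan.
by move=> x; apply: cvgB; exact: c.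
Qed.

Lemma bump_ge0 (K a b x : R) : 0 < K -> a <= b -> 0 <= bump K a b x.
Proof.
by move=> K0 ab; rewrite subr_ge0 le_atan // ler_pM2l // lerD2l lerN2.
Qed.

Lemma bump_MVT (K a b x : R) : a <= b ->
  exists2 c, a <= c <= b & bump K a b x = poisson K c x * (b - a).
Proof.
move=> ab; pose G (a : R) := - atan (K * (x - a)).
have dG (c : R) : is_derive c 1 G (poisson K c x).
  apply: is_derive_eq; rewrite /poisson /GRing.scale /=; field.
  by rewrite gt_eqF // poisson_den.
have cG : {within `[a, b], continuous G}.
  by apply: derivable_within_continuous => c _; exact: ex_derive.
have [c cab E] := MVT_segment ab (fun c _ => dG c) cG.
by exists c; [move: cab; rewrite in_itv|rewrite /bump -E /G opprK addrC].
Qed.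

(** A Riemann sum over equidistant centres, each cell being handled by the mean value theorem. The
    error is uniform in [x], and the centres are rational when [a] and [b] are, so that countably
    many kernels suffice. *)
Lemma bump_riemann (K a b x : R) (M : nat) : 0 < K -> a <= b -> (0 < M)%N ->
  `|bump K a b x - \sum_(i < M) (b - a) / M%:R * poisson K (a + (b - a) * i%:R / M%:R) x|
  <= K ^+ 2 * (b - a) ^+ 2 / M%:R.
Proof.
move=> K0 ab M0; pose e i : R := a + (b - a) * i%:R / M%:R.
have M0r : (0 : R) < M%:R by rewrite ltr0n.
have eS i : e i.+1 - e i = (b - a) / M%:R.
  by rewrite /e -natr1; field; rewrite gt_eqF.
have ab0 : 0 <= (b - a) / M%:R by rewrite divr_ge0 ?subr_ge0 // ltW.
have -> : bump K a b x = \sum_(i < M) bump K (e i) (e i.+1) x.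
  have -> : b = e M by rewrite /e mulfK ?gt_eqF // addrC subrK.
  have {1}-> : a = e 0%N by rewrite /e mulr0 mul0r addr0.
  rewrite -[RHS](big_mkord xpredT (fun i => bump K (e i) (e i.+1) x)).
  rewrite /bump -opprB -(telescope_sumr (fun i => atan (K * (x - e i)))) // -sumrN.
  by apply: eq_bigr => i _; rewrite opprB.
rewrite -sumrB; apply: le_trans (ler_norm_sum _ _ _) _.
have -> : K ^+ 2 * (b - a) ^+ 2 / M%:R = \sum_(i < M) K ^+ 2 * ((b - a) / M%:R) ^+ 2.
  by rewrite sumr_const card_ord -mulr_natl; field; rewrite gt_eqF.
apply: ler_sum => i _.
have [|c /andP[c1 c2] ->] := @bump_MVT K (e i) (e i.+1) x.
  by rewrite -subr_ge0 eS.
rewrite eS mulrC -mulrBr normrM (ger0_norm ab0) expr2 mulrCA ler_wpM2l //.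
apply: le_trans (poisson_lip _ _ _ K0) _; rewrite ler_wpM2l ?sqr_ge0 //.
by rewrite -/(e i) ger0_norm ?subr_ge0 // -(eS i) lerD2r.
Qed.

End Poisson.

(** * Convergence of means, from Poisson kernels to compactly supported functions *)

Section MeanFunctionals.
Context {R : realType}.
Implicit Types (g h : R -> R).

(** Positive normalised linear functionals: averages over points and the semicircle mean are handled
    alike, without measures. Positivity and normalisation make them contractions for the sup
    norm. *)
Record is_mean (L : (R -> R) -> R) : Prop := {
  meanD : forall g h, continuous g -> continuous h -> L (fun x => g x + h x) = L g + L h;
  meanZ : forall a g, continuous g -> L (fun x => a * g x) = a * L g;
  mean_le : forall g h, continuous g -> continuous h -> (forall x, g x <= h x) -> L g <= L h;
  mean1 : L (fun=> 1) = 1 }.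

Lemma continuous_cst (a : R) : continuous (fun _ : R => a).
Proof. by move=> x; exact: cvg_cst. Qed.

Lemma mean_cst L a : is_mean L -> L (fun=> a) = a.
Proof.
move=> mL; have := meanZ mL a (@continuous_cst 1); rewrite (mean1 mL).
by under eq_fun do rewrite mulr1; rewrite mulr1.
Qed.

Lemma continuous_diff g h : continuous g -> continuous h -> continuous (fun x => g x - h x).
Proof. by move=> cg ch x; apply: cvgB; [exact: cg|exact: ch]. Qed.

Lemma meanB L g h : is_mean L -> continuous g -> continuous h ->
  L (fun x => g x - h x) = L g - L h.
Proof.
move=> mL cg ch; have := meanD mL (continuous_diff cg ch) ch.
by under eq_fun do rewrite subrK; move=> ->; rewrite addrK.
Qed.

Lemma mean_bound L g h (e : R) : is_mean L -> continuous g -> continuous h ->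
  (forall x, `|g x - h x| <= e) -> `|L g - L h| <= e.
Proof.
move=> mL cg ch gh; rewrite -meanB // ler_norml; have cgh := continuous_diff cg ch.
rewrite -{2}(mean_cst e mL) -(mean_cst (- e) mL); apply/andP; split; apply: mean_le => //.
- exact: continuous_cst.
- by move=> x; have := gh x; rewrite ler_norml => /andP[].
- exact: continuous_cst.
- by move=> x; have := gh x; rewrite ler_norml => /andP[].
Qed.

Context (Ln : nat -> (R -> R) -> R) (L : (R -> R) -> R)
  (mLn : forall n, is_mean (Ln n)) (mL : is_mean L).

(** The test functions for which convergence is known; the class is closed under linear combinations
    and, within continuous functions, under uniform limits. *)
Definition tested g := continuous g /\ Ln n g @[n --> \oo] --> L g.

Lemma testedD g h : tested g -> tested h -> tested (fun x => g x + h x).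
Proof.
move=> [cg Lg] [ch Lh]; split; first by move=> x; apply: cvgD; [exact: cg|exact: ch].
rewrite (meanD mL) //; under eq_fun do rewrite (meanD (mLn _)) //.
exact: cvgD.
Qed.

Lemma testedZ a g : tested g -> tested (fun x => a * g x).
Proof.
move=> [cg Lg]; split; first by move=> x; apply: cvgM; [exact: cvg_cst|exact: cg].
rewrite (meanZ mL) //; under eq_fun do rewrite (meanZ (mLn _)) //.
by apply: cvgM => //; exact: cvg_cst.
Qed.

Lemma tested0 : tested (fun=> 0).
Proof.
split; first exact: continuous_cst.
by rewrite (mean_cst 0 mL); under eq_fun do rewrite (mean_cst 0 (mLn _)); exact: cvg_cst.
Qed.

Lemma tested_sum (F : nat -> R -> R) (n : nat) : (forall i, tested (F i)) ->
  tested (fun x => \sum_(i < n) F i x).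
Proof.
move=> tF; elim: n => [|n IH].
  by under eq_fun do rewrite big_ord0; exact: tested0.
by under eq_fun do rewrite big_ord_recr /=; exact: testedD.
Qed.

Lemma tested_lim g : continuous g ->
  (forall e, 0 < e -> exists2 h, tested h & forall x, `|g x - h x| <= e) -> tested g.
Proof.
move=> cg gh; split => //; apply/cvgrPdist_le => e e0.
have e3 : 0 < e / 3 by rewrite divr_gt0.
have [h [ch Lh] gh3] := gh _ e3.
move/cvgrPdist_le: Lh => /(_ _ e3) [N _ HN]; exists N => // n Nn.
have h1 := HN n Nn; have h2 := mean_bound mL cg ch gh3.
have h3 := mean_bound (mLn n) cg ch gh3.
move: h1 h2 h3; rewrite !ler_norml; lra.
Qed.

Hypothesis tested_poisson : forall (k : nat) (p : rat), tested (poisson k.+1%:R (ratr p)).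

Lemma tested_bump (k : nat) (p q : rat) : p <= q ->
  tested (bump k.+1%:R (ratr p) (ratr q)).
Proof.
move=> pq; apply: tested_lim => [|e e0]; first exact: continuous_bump.
set K : R := k.+1%:R; have K0 : 0 < K by rewrite ltr0n.
set a : R := ratr p; set b : R := ratr q; have ab : a <= b by rewrite ler_rat.
pose C := K ^+ 2 * (b - a) ^+ 2.
have C0 : 0 <= C by rewrite mulr_ge0 ?sqr_ge0.
pose M := (Num.bound (C / e)).+1; have M0 : (0 : R) < M%:R by rewrite ltr0n.
pose F i x := (b - a) / M%:R * poisson K (a + (b - a) * i%:R / M%:R) x.
exists (fun x => \sum_(i < M) F i x).
  apply: tested_sum => i; apply: testedZ.
  have -> : a + (b - a) * i%:R / M%:R = ratr (p + (q - p) * i%:R / M%:R).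
    by rewrite rmorphD fmorph_div rmorphM rmorphB !rmorph_nat.
  exact: tested_poisson.
move=> x; apply: le_trans (bump_riemann x K0 ab _) _ => //.
rewrite -/C ler_pdivrMr // -ler_pdivrMl // mulrC.
have /ltW/le_trans -> // := archi_boundP (divr_ge0 C0 (ltW e0)).
by rewrite ler_nat /M.
Qed.

Lemma pi_ge1 : 1 <= pi :> R.
Proof. by have := pi_ge2 R; lra. Qed.

(* [g] is approximated by the step function of its values on the grid of mesh [1/N], smoothed by
   the kernel [poisson K]: the weights [w j] are nonnegative with sum at most [pi]. *)
Lemma tested_compact g (L0 : nat) (G : R) : continuous g ->
  (forall x, L0%:R <= `|x| -> g x = 0) -> (forall x, `|g x| <= G) -> tested g.
Proof.
move=> cg g0 GP; apply: tested_lim => // e e0.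
have G0 : 0 <= G by apply: le_trans (GP 0).
have e4 : 0 < e / 4 by rewrite divr_gt0.
have [d d0 Hd] := uniform_segment (L0%:R + 1) cg e4.
(* The cap at 1 ensures that a point within [r] of one beyond [L0 + 1] still lies where [g]
   vanishes. *)
pose r := Num.min d 1; have r0 : 0 < r by rewrite lt_min d0 ltr01.
have rd : r <= d by rewrite ge_min lexx.
have r1 : r <= 1 by rewrite ge_min lexx orbT.
have unif x y : `|x - y| <= r -> `|g x - g y| <= e / 4.
  move=> xy; have [xL|xL] := leP `|x| (L0%:R + 1).
    rewrite distrC; have -> : y = x + (y - x) by rewrite addrC subrK.
    by apply: Hd => //; rewrite distrC; apply: le_trans rd.
  have yL : L0%:R <= `|y|.
    by have := ler_normD (x - y) y; rewrite subrK; lra.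
  have xL' : L0%:R <= `|x| by lra.
  by rewrite (g0 _ xL') (g0 _ yL) subrr normr0 ltW.
pose Lm : R := L0.+1%:R; have Lm0 : 0 < Lm by rewrite ltr0n.
(* Two quantities must be small. A cell of width [1 / N] farther than [r / 2] has weight at most
   [4 / (K r^2 N)]; times [2 G] and the [2 Lm N] cells this gives 16 and no [N]. On the support,
   which stays at distance at least 1 from the ends of the grid, the weights miss at most the mass
   [pi - 2 atan K]. *)
have [k kC katan] : exists2 k : nat, 16 * G * Lm / (k.+1%:R * r ^+ 2) <= e / 4 &
   G * (2 * (pi / 2 - atan k.+1%:R)) <= e / 4.
  have de0 : 0 < e / 4 / (2 * G + 1) by rewrite divr_gt0 // ltr_wpDl // mulr_ge0.
  have /cvgrPdist_le/(_ _ de0) [B [Breal HB]] := @cvgy_atan R.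
  pose D := 16 * G * Lm / (r ^+ 2 * (e / 4)).
  have D0 : 0 <= D.
    exact: divr_ge0 (mulr_ge0 (mulr_ge0 (ler0n _ 16) G0) (ltW Lm0)) (mulr_ge0 (sqr_ge0 _) (ltW e4)).
  exists (Num.bound (D + `|B|)); set k := Num.bound _.
    have kr : D + `|B| < k%:R by apply: archi_boundP; rewrite addr_ge0.
    have kr' : D <= k.+1%:R by rewrite -natr1; have := normr_ge0 B; lra.
    rewrite ler_pdivrMr ?mulr_gt0 ?exprn_gt0 ?ltr0n //.
    move: kr'; rewrite /D ler_pdivrMr ?mulr_gt0 ?exprn_gt0 //.
    by move/le_trans; apply; rewrite le_eqVlt; apply/orP; left; apply/eqP; ring.
  have kr : D + `|B| < k%:R by apply: archi_boundP; rewrite addr_ge0.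
  have /HB : B < k.+1%:R by rewrite -natr1; have := ler_norm B; lra.
  rewrite ger0_norm ?subr_ge0 ?(ltW (atan_ltpi2 _)) // => h.
  have h0 : 0 <= pi / 2 - atan k.+1%:R :> R by have := atan_ltpi2 (k.+1%:R : R); lra.
  move: h; rewrite ler_pdivlMr; last by rewrite ltr_wpDl // mulr_ge0.
  by apply: le_trans; rewrite mulrCA [leRHS]mulrC mulrA ler_wpM2r //; lra.
(* With mesh at most [r / 2], a point farther than [r] from a node is still [r / 2] away from the
   whole cell that starts there. *)
have [N0 N0P] : exists N : nat, (N.+1%:R)^-1 <= r / 2.
  exists (Num.bound (r / 2)^-1).
  have r2 : 0 < r / 2 by rewrite divr_gt0.
  rewrite invf_ple ?posrE ?ltr0n //; have : 0 <= (r / 2)^-1 by rewrite invr_ge0 ltW.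
  by move=> /archi_boundP/ltW/le_trans; apply; rewrite ler_nat.
pose N := N0.+1; pose K : R := k.+1%:R.
have K0 : 0 < K by rewrite ltr0n.
have Nr0 : (0 : R) < N%:R by rewrite ltr0n.
pose a (j : nat) : R := - Lm + j%:R / N%:R.
pose J := (2 * L0.+1 * N)%N.
have aS j : a j.+1 - a j = N%:R^-1.
  by rewrite /a -natr1; field; rewrite gt_eqF.
have aleS j : a j <= a j.+1 by rewrite -subr_ge0 aS invr_ge0 ltW.
pose w j x := bump K (a j) (a j.+1) x.
have w0 j x : 0 <= w j x by apply: bump_ge0.
have wsum x : \sum_(j < J) w j x = atan (K * (x + Lm)) - atan (K * (x - Lm)).
  have aJ : a J = Lm.
    by rewrite /a /J natrM mulfK ?gt_eqF // natrM /Lm; ring.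
  have a0 : a 0%N = - Lm by rewrite /a mul0r addr0.
  rewrite -[LHS](big_mkord xpredT (fun i => w i x)) /w /bump.
  transitivity (- \sum_(0 <= i < J) (atan (K * (x - a i.+1)) - atan (K * (x - a i)))).
    by rewrite -sumrN; apply: eq_bigr => i _; rewrite opprB.
  by rewrite (telescope_sumr (fun i => atan (K * (x - a i)))) // opprB aJ a0 opprK.
have piW x : \sum_(j < J) w j x <= pi.
  rewrite wsum; have := atan_ltpi2 (K * (x + Lm)); have := atan_gtNpi2 (K * (x - Lm)); lra.
have pi0 : 0 < pi :> R := pi_gt0 R.
pose p i : rat := - L0.+1%:R + i%:R / N%:R.
have pE i : a i = ratr (p i).
  by rewrite /p rmorphD rmorphN fmorph_div !rmorph_nat.
exists (fun x => \sum_(j < J) pi^-1 * g (a j) * w j x).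
  apply: (@tested_sum (fun j x => pi^-1 * g (a j) * w j x)) => j; apply: testedZ.
  by rewrite /w !pE; apply: tested_bump; rewrite -(ler_rat R) -!pE.
move=> x; set S := \sum_(j < J) w j x.
(* [E1] is the error due to the mass missing from the weights, [E2] the oscillation of [g] over the
   grid. *)
pose E1 := g x * (pi - S); pose E2 := \sum_(j < J) (g x - g (a j)) * w j x.
have -> : g x - \sum_(j < J) pi^-1 * g (a j) * w j x = pi^-1 * (E1 + E2).
  have -> : E2 = g x * S - \sum_(j < J) g (a j) * w j x.
    by rewrite /E2 /S mulr_sumr -sumrB; apply: eq_bigr => j _; rewrite mulrBl.
  have -> : \sum_(j < J) pi^-1 * g (a j) * w j x = pi^-1 * \sum_(j < J) g (a j) * w j x.
    by rewrite mulr_sumr; apply: eq_bigr => j _; rewrite mulrA.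
  by rewrite /E1; move: (pi) pi0 => q q0; field; rewrite gt_eqF.
have E1b : `|E1| <= e / 4.
  have piS : 0 <= pi - S by rewrite subr_ge0 piW.
  rewrite /E1 normrM (ger0_norm piS).
  have [xL|xL] := leP L0%:R `|x|; first by rewrite g0 // normr0 mul0r ltW.
  apply: le_trans katan; apply: ler_pM => //.
  have LmE : Lm = L0%:R + 1 by rewrite /Lm natr1.
  have [xl xr] : -L0%:R < x /\ x < L0%:R by move: xL; rewrite ltr_norml => /andP[].
  have h1 : atan K <= atan (K * (x + Lm)).
    by apply: le_atan; rewrite ler_peMr ?ltW //; lra.
  have h2 : atan (K * (x - Lm)) <= - atan K.
    rewrite -atanN; apply: le_atan; have -> : - K = K * -1 by rewrite mulrN1.
    by rewrite ler_wpM2l ?(ltW K0) //; lra.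
  by rewrite /S wsum; move: h1 h2; lra.
have E2b : `|E2| <= e / 4 * pi + e / 4.
  pose B := 8 * G / (K * r ^+ 2 * N%:R).
  have B0 : 0 <= B.
    exact: divr_ge0 (mulr_ge0 (ler0n _ 8) G0) (mulr_ge0 (mulr_ge0 (ltW K0) (sqr_ge0 _)) (ltW Nr0)).
  have JB : \sum_(j < J) B <= e / 4.
    rewrite sumr_const card_ord -[B *+ _]mulr_natl; apply: le_trans kC.
    rewrite le_eqVlt; apply/orP; left; apply/eqP.
    rewrite /B /J -/K natrM natrM -/Lm; field.
    by rewrite !gt_eqF.
  have term j : `|(g x - g (a j)) * w j x| <= e / 4 * w j x + B.
    rewrite normrM (ger0_norm (w0 _ _)).
    have [xa|xa] := leP `|x - a j| r.
      apply: (@le_trans _ _ (e / 4 * w j x)); last by rewrite lerDl.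
      by rewrite ler_wpM2r // unif.
    apply: (@le_trans _ _ B); last by rewrite lerDr mulr_ge0 // ltW.
    have [c /andP[c1 c2] wE] := bump_MVT K x (aleS j).
    have xc : r / 2 <= `|x - c|.
      have := ler_normD (x - c) (c - a j); rewrite subrKA.
      have -> : `|c - a j| = c - a j by rewrite ger0_norm // subr_ge0.
      have : c - a j <= N%:R^-1 by rewrite -(aS j) lerD2r.
      by move: xa N0P; rewrite -/N; lra.
    have wb : w j x <= 4 / (K * r ^+ 2) * N%:R^-1.
      rewrite /w wE aS ler_wpM2r ?invr_ge0 ?(ltW Nr0) // /poisson.
      rewrite ler_pdivrMr ?poisson_den //.
      have h : (r / 2) ^+ 2 <= (x - c) ^+ 2.
        by rewrite -[leRHS]real_normK ?num_real // lerXn2r ?nnegrE // ltW // divr_gt0.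
      rewrite mulrAC ler_pdivlMr ?mulr_gt0 ?exprn_gt0 //.
      rewrite exprMn; apply: (@le_trans _ _ (4 * (K ^+ 2 * (r / 2) ^+ 2))).
        by rewrite le_eqVlt; apply/orP; left; apply/eqP; field.
      rewrite ler_pM2l // -[leLHS]add0r lerD //.
      by rewrite ler_pM2l ?exprn_gt0.
    have gb : `|g x - g (a j)| <= 2 * G.
      by apply: le_trans (ler_normB _ _) _; have := GP x; have := GP (a j); lra.
    apply: le_trans (ler_pM _ _ gb wb) _ => //.
    by rewrite le_eqVlt; apply/orP; left; apply/eqP; rewrite /B; field; rewrite !gt_eqF.
  rewrite /E2; apply: le_trans (ler_norm_sum _ _ _) _.
  apply: le_trans (ler_sum _ (fun (j : 'I_J) _ => term j)) _.
  rewrite big_split /= lerD // -mulr_sumr ler_wpM2l ?(ltW e4) //.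
rewrite normrM gtr0_norm ?invr_gt0 // ler_pdivrMl //.
apply: le_trans (ler_normD _ _) _.
have pe : e / 4 <= e / 4 * pi by rewrite ler_peMr ?(ltW e4) // pi_ge1.
apply: (@le_trans _ _ (4 * (e / 4 * pi))); last first.
  by rewrite le_eqVlt; apply/orP; left; apply/eqP; field.
by move: E1b E2b pe; set q := e / 4 * pi; lra.
Qed.

End MeanFunctionals.

(** * Weak convergence of averages over complex points *)

Section WeakConvergence.
Context {R : realType}.

Definition point_mean (n : nat) (x : 'I_n.+1 -> R) (g : R -> R) : R :=
  n.+1%:R^-1 * \sum_i g (x i).

Lemma point_mean_is_mean n (x : 'I_n.+1 -> R) : is_mean (point_mean x).
Proof.
have n0 : (0 : R) <= n.+1%:R^-1 by rewrite invr_ge0.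
split=> [g h _ _|a g _|g h _ _ gh|]; rewrite /point_mean.
- by rewrite big_split mulrDr.
- by rewrite -mulr_sumr mulrCA.
- by rewrite ler_wpM2l //; apply: ler_sum => i _.
- by rewrite sumr_const card_ord mulVf // pnatr_eq0.
Qed.

Lemma sc_mean_is_mean : is_mean (@sc_mean R).
Proof.
split=> [g h|a g|g h cg ch gh|].
- exact: sc_meanD.
- exact: sc_meanZ.
- by apply: sc_mean_le.
- exact: sc_mean1.
Qed.

Lemma sc_mean_eq (g h : R -> R) : continuous g -> continuous h ->
  (forall x, -2 <= x <= 2 -> g x = h x) -> sc_mean g = sc_mean h.
Proof.
by move=> cg ch gh; apply/eqP; rewrite eq_le !sc_mean_le // => x /gh ->.
Qed.

(* Equals [1] on [-3, 3], [0] outside [-4, 4], and is affine in between. *)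
Definition cutoff (x : R) : R := (1 + `|4 - `|x| | - `|3 - `|x| |) / 2.

Lemma continuous_cutoff : continuous cutoff.
Proof.
have c (b : R) : continuous (fun x : R => `|b - `|x| |).
  move=> x; apply: cvg_norm; apply: cvgB; first exact: cvg_cst.
  exact: norm_continuous.
move=> x; apply: cvgM; last exact: cvg_cst.
by apply: cvgB; [apply: cvgD; [exact: cvg_cst | exact: c] | exact: c].
Qed.

Lemma cutoff_itv x : 0 <= cutoff x <= 1.
Proof.
rewrite /cutoff; have := ler_normD (3 - `|x|) 1; have := ler_normB (4 - `|x|) 1.
have -> : 4 - `|x| - 1 = 3 - `|x| by ring.
have -> : 3 - `|x| + 1 = 4 - `|x| by ring.
by rewrite normr1; move=> *; apply/andP; split; lra.
Qed.

Lemma cutoff_ge0 x : 0 <= cutoff x.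
Proof. by have /andP[] := cutoff_itv x. Qed.

Lemma cutoff_le1 x : cutoff x <= 1.
Proof. by have /andP[] := cutoff_itv x. Qed.

Lemma cutoff_eq1 x : `|x| <= 3 -> cutoff x = 1.
Proof.
move=> x3; rewrite /cutoff (@ger0_norm _ (4 - _)); last by lra.
by rewrite (@ger0_norm _ (3 - _)); [field | lra].
Qed.

Lemma cutoff_eq0 x : 4 <= `|x| -> cutoff x = 0.
Proof.
move=> x4; rewrite /cutoff (@ler0_norm _ (4 - _)); last by lra.
by rewrite (@ler0_norm _ (3 - _)); [field | lra].
Qed.

(** Each point contributes three errors: oscillation of [f] across a thin strip, an imaginary part
    larger than [d], and a real part outside the plateau of the cutoff. The last one replaces
    tightness: the cutoff is itself a test function, with semicircle mean 1. *)
Lemma weak_cvg_points (l : forall n, 'I_n.+1 -> R[i]) (f : R[i] -> R) (F : R) :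
  continuous f -> (forall z, `|f z| <= F) ->
  n.+1%:R^-1 * (\sum_i complex.Im (l n i) ^+ 2) @[n --> \oo] --> (0 : R) ->
  (forall (k : nat) (p : rat),
    point_mean (fun i => complex.Re (l n i)) (poisson k.+1%:R (ratr p)) @[n --> \oo] -->
    sc_mean (poisson k.+1%:R (ratr p) : R -> R)) ->
  n.+1%:R^-1 * (\sum_i f (l n i)) @[n --> \oo] --> sc_mean (fun x => f x%:C%C).
Proof.
move=> cf fF Im0 Hp; pose Ln n := point_mean (fun i => complex.Re (l n i)).
have F0 : 0 <= F by apply: le_trans (fF 0).
have mLn n : is_mean (Ln n) by apply: point_mean_is_mean.
have mL := sc_mean_is_mean.
have tp k p : tested Ln sc_mean (poisson k.+1%:R (ratr p)).
  by split; [exact: continuous_poisson | exact: Hp].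
have cfx : continuous (fun x : R => f x%:C%C).
  by move=> x; apply: continuous_comp; [exact: continuous_real_complex | exact: cf].
have cchi := continuous_cutoff.
have cg : continuous (fun x : R => f x%:C%C * cutoff x).
  by move=> x; apply: cvgM; [exact: cfx|exact: cchi].
have [_ Hchi] : tested Ln sc_mean cutoff.
  apply: (tested_compact mLn mL tp (L0 := 4) (G := 1)) => //.
    by move=> x; exact: cutoff_eq0.
  by move=> x; rewrite ger0_norm ?cutoff_ge0 // cutoff_le1.
have [_ Hg] : tested Ln sc_mean (fun x => f x%:C%C * cutoff x).
  apply: (tested_compact mLn mL tp (L0 := 4) (G := F)) => //.
    by move=> x /cutoff_eq0 ->; rewrite mulr0.
  move=> x; rewrite normrM -[F]mulr1; apply: ler_pM => //.
  by rewrite ger0_norm ?cutoff_ge0 // cutoff_le1.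
have scchi : sc_mean cutoff = 1.
  rewrite -[RHS](mean1 mL); apply: sc_mean_eq => //; first exact: continuous_cst.
  by move=> x x2; apply: cutoff_eq1; rewrite ler_norml; lra.
have scg : sc_mean (fun x => f x%:C%C * cutoff x) = sc_mean (fun x => f x%:C%C).
  apply: sc_mean_eq => // x x2; rewrite cutoff_eq1 ?mulr1 //.
  by rewrite ler_norml; lra.
rewrite scchi in Hchi; rewrite -scg.
apply/cvgrPdist_le => e e0.
have e4 : 0 < e / 4 by rewrite divr_gt0.
have [d d0 Hd] := uniform_strip 4 cf e4.
(* Chebyshev: the error is at most [2 F], hence at most [C] times the squared imaginary part once
   the latter exceeds [d] in absolute value. *)
pose C := 2 * F / d ^+ 2; have C0 : 0 <= C := divr_ge0 (mulr_ge0 (ler0n _ 2) F0) (sqr_ge0 d).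
have ineq n i : `|f (l n i) - f (complex.Re (l n i))%:C%C * cutoff (complex.Re (l n i))| <=
    e / 4 + C * complex.Im (l n i) ^+ 2 + F * (1 - cutoff (complex.Re (l n i))).
  set w := l n i; set x := complex.Re w; set chi := cutoff x.
  have chi0 : 0 <= chi := cutoff_ge0 x; have chi1 : chi <= 1 := cutoff_le1 x.
  have -> : f w - f x%:C%C * chi = (f w - f x%:C%C) * chi + f w * (1 - chi) by ring.
  apply: le_trans (ler_normD _ _) _; apply: lerD; last first.
    by rewrite normrM (@ger0_norm _ (1 - chi)) ?subr_ge0 // ler_wpM2r ?subr_ge0.
  rewrite normrM (ger0_norm chi0).
  have Cy0 : 0 <= C * complex.Im w ^+ 2 by rewrite mulr_ge0 ?sqr_ge0.
  have [x4|x4] := leP 4 `|x|.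
    by rewrite /chi (cutoff_eq0 x4) mulr0 addr_ge0 // ltW.
  apply: (@le_trans _ _ `|f w - f x%:C%C|); first by rewrite ler_piMr.
  have [yd|yd] := leP `|complex.Im w| d.
    by apply: le_trans (Hd w (ltW x4) yd) _; rewrite lerDl.
  apply: (@le_trans _ _ (C * complex.Im w ^+ 2)); last by rewrite lerDr ltW.
  apply: (@le_trans _ _ (2 * F)).
    by apply: le_trans (ler_normB _ _) _; have := fF w; have := fF x%:C%C; lra.
  rewrite /C mulrAC ler_pdivlMr ?exprn_gt0 // ler_wpM2l ?mulr_ge0 //.
  by rewrite -[leRHS]real_normK ?num_real // lerXn2r ?nnegrE // ltW.
have Hchi0 : 1 - Ln n cutoff @[n --> \oo] --> (0 : R).
  by rewrite -(subrr (1 : R)); apply: cvgB => //; exact: cvg_cst.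
have e4F : 0 < e / 4 / (F + 1) by rewrite divr_gt0 // ltr_wpDl.
have e4C : 0 < e / 4 / (C + 1) by rewrite divr_gt0 // ltr_wpDl.
near=> n.
have h1 : `|sc_mean (fun x => f x%:C%C * cutoff x) - Ln n (fun x => f x%:C%C * cutoff x)| <= e / 4.
  near: n; exact: (cvgrPdist_le _ _).1 Hg _ e4.
have h2 : 1 - Ln n cutoff <= e / 4 / (F + 1).
  have : `|0 - (1 - Ln n cutoff)| <= e / 4 / (F + 1).
    near: n; exact: (cvgrPdist_le _ _).1 Hchi0 _ e4F.
  by rewrite sub0r normrN => h; apply: le_trans (ler_norm _) h.
have h3 : n.+1%:R^-1 * (\sum_i complex.Im (l n i) ^+ 2) <= e / 4 / (C + 1).
  have : `|0 - n.+1%:R^-1 * (\sum_i complex.Im (l n i) ^+ 2)| <= e / 4 / (C + 1).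
    near: n; exact: (cvgrPdist_le _ _).1 Im0 _ e4C.
  by rewrite sub0r normrN => h; apply: le_trans (ler_norm _) h.
have n0 : (0 : R) < n.+1%:R^-1 by rewrite invr_gt0 ltr0n.
have h4 : `|n.+1%:R^-1 * (\sum_i f (l n i)) - Ln n (fun x => f x%:C%C * cutoff x)| <=
    e / 4 + C * (n.+1%:R^-1 * (\sum_i complex.Im (l n i) ^+ 2)) + F * (1 - Ln n cutoff).
  have -> : e / 4 + C * (n.+1%:R^-1 * (\sum_i complex.Im (l n i) ^+ 2)) + F * (1 - Ln n cutoff)
    = n.+1%:R^-1 * \sum_i (e / 4 + C * complex.Im (l n i) ^+ 2 + F * (1 - cutoff (complex.Re (l n i)))).
    rewrite !big_split /= -!mulr_sumr sumrB !sumr_const card_ord /Ln /point_mean.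
    rewrite -[4^-1 *+ _]mulr_natl.
    have : (n.+1%:R : R) != 0 by rewrite pnatr_eq0.
    by move: (n.+1%:R : R) (\sum_(i < _) _) (\sum_(i < _) _) => N S1 S2 N0; field.
  rewrite /Ln /point_mean -mulrBr -sumrB normrM (gtr0_norm n0) ler_pM2l //.
  by apply: le_trans (ler_norm_sum _ _ _) _; apply: ler_sum => i _.
have h5 : F * (1 - Ln n cutoff) <= e / 4.
  apply: le_trans (ler_wpM2l F0 h2) _; rewrite mulrCA ler_piMr ?(ltW e4) //.
  by rewrite ler_pdivrMr ?mul1r ?lerDl // ltr_wpDl.
have h6 : C * (n.+1%:R^-1 * (\sum_i complex.Im (l n i) ^+ 2)) <= e / 4.
  apply: le_trans (ler_wpM2l C0 h3) _; rewrite mulrCA ler_piMr ?(ltW e4) //.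
  by rewrite ler_pdivrMr ?mul1r ?lerDl // ltr_wpDl.
move: h1 h4 h5 h6.
move: (F * _) (C * (_ * _)) (Ln n _) (sc_mean _) (_ * \sum_i f _) => a b y z x h1 h4 h5 h6.
rewrite -(subrKA y); apply: le_trans (ler_normD _ _) _; rewrite (distrC y).
by move: h1 h4 h5 h6; move: (`|z - y|) (`|x - y|) => p q; lra.
Unshelve. all: by end_near. Qed.

End WeakConvergence.

(** * Bounded measurable functions and their expectations *)

Section BoundedMeasurable.
Context {R : realType}.

Definition bmf d (T : measurableType d) (f : T -> R) : Prop :=
  measurable_fun setT f /\ exists K, forall t, `|f t| <= K.

Section Closure.
Context d (T : measurableType d).
Implicit Types f g : T -> R.

Lemma bmf_cst (a : R) : bmf (fun _ : T => a).
Proof. by split; [exact: measurable_cst | exists `|a|]. Qed.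

Lemma bmfD f g : bmf f -> bmf g -> bmf (fun t => f t + g t).
Proof.
move=> [mf [K fK]] [mg [L gL]]; split; first exact: measurable_funD.
by exists (K + L) => t; apply: le_trans (ler_normD _ _) (lerD _ _).
Qed.

Lemma bmfN f : bmf f -> bmf (fun t => - f t).
Proof.
move=> [mf [K fK]]; split; first exact: measurableT_comp.
by exists K => t; rewrite normrN.
Qed.

Lemma bmfB f g : bmf f -> bmf g -> bmf (fun t => f t - g t).
Proof. by move=> bf bg; apply: bmfD => //; exact: bmfN. Qed.

Lemma bmfM f g : bmf f -> bmf g -> bmf (fun t => f t * g t).
Proof.
move=> [mf [K fK]] [mg [L gL]]; split; first exact: measurable_funM.
by exists (K * L) => t; rewrite normrM; apply: ler_pM.
Qed.

Lemma bmfX f n : bmf f -> bmf (fun t => f t ^+ n).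
Proof.
move=> bf; elim: n => [|n IH]; first exact: bmf_cst.
by under eq_fun do rewrite exprS; exact: bmfM.
Qed.

Lemma bmf_norm f : bmf f -> bmf (fun t => `|f t|).
Proof.
move=> [mf [K fK]]; split; first exact: measurableT_comp.
by exists K => t; rewrite normr_id.
Qed.

Lemma bmf_sum (J : Type) (r : seq J) (Q : pred J) (F : J -> T -> R) :
  (forall j, bmf (F j)) -> bmf (fun t => \sum_(j <- r | Q j) F j t).
Proof.
move=> bF; elim: r => [|j r IH]; first by under eq_fun do rewrite big_nil; exact: bmf_cst.
under eq_fun do rewrite big_cons.
by case: (Q j) => //; apply: bmfD.
Qed.

Lemma bmf_comp d' (T' : measurableType d') (h : T' -> T) f :
  measurable_fun setT h -> bmf f -> bmf (fun t => f (h t)).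
Proof.
by move=> mh [mf [K fK]]; split; [exact: measurableT_comp | exists K].
Qed.

End Closure.

Section Expectation.
Context d (T : measurableType d) (P : probability T R).
Implicit Types f g : T -> R.

Definition Ex (f : T -> R) : R := \int[P]_t f t.

Lemma bmf_integrable f : bmf f -> P.-integrable setT (EFin \o f).
Proof.
move=> [mf [K fK]]; apply: measurable_bounded_integrable => //.
  by rewrite [X in (X < _)%E](_ : _ = 1%E) ?ltry //; exact: probability_setT.
by exists K; split; [exact: num_real | move=> M KM t _; exact: le_trans (fK t) (ltW KM)].
Qed.

Lemma ExE f : bmf f -> (\int[P]_t (f t)%:E)%E = (Ex f)%:E.
Proof.
move=> bf; rewrite /Ex /Rintegral fineK //.
by apply: integrable_fin_num => //; exact: bmf_integrable.
Qed.

Lemma Ex_cst a : Ex (fun=> a) = a.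
Proof.
rewrite /Ex Rintegral_cst // [X in fine X](_ : _ = 1%E) ?mulr1 //.
exact: probability_setT.
Qed.

Lemma ExD f g : bmf f -> bmf g -> Ex (fun t => f t + g t) = Ex f + Ex g.
Proof. by move=> bf bg; rewrite /Ex RintegralD //; exact: bmf_integrable. Qed.

Lemma ExB f g : bmf f -> bmf g -> Ex (fun t => f t - g t) = Ex f - Ex g.
Proof. by move=> bf bg; rewrite /Ex RintegralB //; exact: bmf_integrable. Qed.

Lemma ExZ a f : bmf f -> Ex (fun t => a * f t) = a * Ex f.
Proof. by move=> bf; rewrite /Ex RintegralZl //; exact: bmf_integrable. Qed.

Lemma Ex_le f g : bmf f -> bmf g -> (forall t, f t <= g t) -> Ex f <= Ex g.
Proof. by move=> bf bg fg; apply: le_Rintegral => //; exact: bmf_integrable. Qed.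

Lemma Ex_ge0 f : (forall t, 0 <= f t) -> 0 <= Ex f.
Proof. by move=> f0; apply: Rintegral_ge0. Qed.

Lemma Ex_bound f a : bmf f -> (forall t, `|f t| <= a) -> `|Ex f| <= a.
Proof.
move=> bf fa; have h t : - a <= f t <= a by rewrite -ler_norml.
have h1 := Ex_le (bmf_cst T (- a)) bf (fun t => proj1 (andP (h t))).
have h2 := Ex_le bf (bmf_cst T a) (fun t => proj2 (andP (h t))).
by move: h1 h2; rewrite !Ex_cst ler_norml => -> ->.
Qed.

Lemma Ex_norm f : bmf f -> `|Ex f| <= Ex (fun t => `|f t|).
Proof. by move=> bf; apply: le_normr_Rintegral => //; exact: bmf_integrable. Qed.

Lemma Ex_sum (J : Type) (r : seq J) (Q : pred J) (F : J -> T -> R) :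
  (forall j, bmf (F j)) ->
  Ex (fun t => \sum_(j <- r | Q j) F j t) = \sum_(j <- r | Q j) Ex (F j).
Proof.
move=> bF; elim: r => [|j r IH].
  by under [in LHS]eq_fun do rewrite big_nil; rewrite big_nil Ex_cst.
under [in LHS]eq_fun do rewrite big_cons.
by rewrite big_cons; case: (Q j) => //; rewrite ExD ?IH //; exact: bmf_sum.
Qed.

Lemma eq_Ex f g : f =1 g -> Ex f = Ex g.
Proof. by move=> /funext ->. Qed.

(** Measurability of the partial integral comes from Tonelli, hence the shift by the bound [K] to a
    nonnegative function. *)
Lemma bmf_Ex d' (T' : measurableType d') (Phi : T' * T -> R) :
  bmf Phi -> bmf (fun x => Ex (fun t => Phi (x, t))).
Proof.
move=> bPhi; have [mPhi [K PhiK]] := bPhi.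
have bsec x : bmf (fun t => Phi (x, t)).
  split; last by exists K.
  exact: (measurableT_comp mPhi (measurable_pair1 x)).
split; last by exists K => x; apply: Ex_bound.
pose F (z : T' * T) := (Phi z + K)%:E.
have F0 z : (0 <= F z)%E.
  by rewrite lee_fin; have := PhiK z; rewrite ler_norml; lra.
have mF : measurable_fun setT F by apply/measurable_EFinP; exact: measurable_funD.
have := measurable_fun_fubini_tonelli_F (m2 := P) F mF F0.
have -> : fubini_F P F = fun x => (Ex (fun t => Phi (x, t)) + K)%:E.
  apply/funext => x; rewrite /fubini_F /F ExE; last by apply: bmfD => //; exact: bmf_cst.
  by rewrite ExD ?Ex_cst //; exact: bmf_cst.
move/measurable_EFinP => m; have := measurable_funB m (measurable_cst K).
rewrite (_ : _ \- _ = (fun x => Ex (fun t => Phi (x, t)))) //.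
by apply/funext => x /=; rewrite addrK.
Qed.

Lemma Ex_sqr f : bmf f -> Ex f ^+ 2 <= Ex (fun t => f t ^+ 2).
Proof.
move=> bf; have b2 := bmfX 2 bf.
have : 0 <= Ex (fun t => (f t - Ex f) ^+ 2) by apply: Ex_ge0 => t; exact: sqr_ge0.
have -> : Ex (fun t => (f t - Ex f) ^+ 2) = Ex (fun t => f t ^+ 2 - (2 * Ex f * f t - Ex f ^+ 2)).
  by apply: eq_Ex => t; ring.
have b1 : bmf (fun t => 2 * Ex f * f t) by apply: bmfM => //; exact: bmf_cst.
have bc := bmf_cst T (Ex f ^+ 2).
rewrite ExB //; last exact: bmfB.
rewrite ExB // Ex_cst ExZ //.
by rewrite -[_ * Ex f]mulrA -expr2; move: (Ex f ^+ 2) => q; lra.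
Qed.

End Expectation.
End BoundedMeasurable.

(** * Families of reals with the product sigma-algebra *)

Section FamilySpace.
Context {R : realType} (I : finType).

(** Generators of the product sigma-algebra. They are stable under intersection and contain the
    whole space, so that a finite measure is determined by its values on them. *)
Definition boxes : set (set (I -> R)) :=
  [set A | exists2 B : I -> set R, (forall i, measurable (B i)) &
     A = [set x | forall i, B i (x i)]].

Definition family := g_sigma_algebraType boxes.

Lemma measurable_coord i : measurable_fun setT (fun x : family => x i).
Proof.
move=> _ B mB; rewrite setTI; apply: sub_sigma_algebra.
exists (fun j => if j == i then B else setT) => [j|]; first by case: ifP.
apply/seteqP; split=> [x /= Bx j|x /(_ i)]; last by rewrite eqxx.
by case: eqP => [->|].
Qed.

Lemma measurable_family d (T : measurableType d) (X : T -> I -> R) :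
  (forall i, measurable_fun setT (fun t => X t i)) -> measurable_fun setT (X : T -> family).
Proof.
move=> mX; apply: (@measurability _ _ _ family setT _ boxes) => //.
move=> _ [_ [B mB ->] <-]; rewrite setTI.
have -> : X @^-1` [set x | forall i, B i (x i)] =
    \bigcap_(i in [set: I]) ((fun t => X t i) @^-1` B i).
  by apply/seteqP; split=> t /= h i => [_|]; exact: h.
apply: fin_bigcap_measurable; first exact: finite_finset.
by move=> i _; rewrite -[X in measurable X]setTI; exact: mX.
Qed.

Definition mix (A : pred I) (x y : I -> R) : I -> R := fun i => if A i then x i else y i.

Lemma measurable_mix d (T : measurableType d) (A : pred I) (X Y : T -> I -> R) :
  measurable_fun setT (X : T -> family) -> measurable_fun setT (Y : T -> family) ->
  measurable_fun setT ((fun t => mix A (X t) (Y t)) : T -> family).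
Proof.
move=> mX mY; apply: measurable_family => i; rewrite /mix.
by case: (A i); [apply: (measurableT_comp (measurable_coord i) mX)
                | apply: (measurableT_comp (measurable_coord i) mY)].
Qed.

End FamilySpace.
Arguments family R I : clear implicits.

(** * Independent coordinates, resampling and bounded differences *)

Section Independence.
Context {R : realType} d (T : measurableType d) (P : probability T R) (I : finType).
Context (X : T -> I -> R).
Hypothesis mX : forall i, measurable_fun setT (fun t => X t i).
Hypothesis indepX : forall B : I -> set R, (forall i, measurable (B i)) ->
  P [set t | forall i, B i (X t i)] = (\prod_i P ((fun t => X t i) @^-1` B i))%E.

Let mXf : measurable_fun setT (X : T -> family R I) := measurable_family mX.

Lemma indep_box (A : pred I) (B : I -> set R) : (forall i, measurable (B i)) ->
  P [set t | forall i, A i -> B i (X t i)] =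
  (\prod_(i | A i) P ((fun t => X t i) @^-1` B i))%E.
Proof.
move=> mB; pose B' i := if A i then B i else setT.
have mB' i : measurable (B' i) by rewrite /B'; case: (A i).
have -> : [set t | forall i, A i -> B i (X t i)] = [set t | forall i, B' i (X t i)].
  apply/seteqP; split=> t /= h i; have := h i; rewrite /B'; first by case: (A i) => //; apply.
  by move=> + Ai; rewrite Ai.
rewrite indepX // [RHS]big_mkcond; apply: eq_bigr => i _; rewrite /B'.
by case: (A i) => //; rewrite preimage_setT probability_setT.
Qed.

(** Replacing the coordinates outside [A] by those of an independent copy preserves the law, since
    the two laws agree on boxes. The inner integral then plays the role of the conditional
    expectation given the coordinates in [A]. *)
Lemma law_mix (A : pred I) (F : family R I -> \bar R) : measurable_fun setT F ->
  (forall x, 0 <= F x)%E ->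
  (\int[P]_t F (X t) = \int[P]_t \int[P]_t' F (mix A (X t) (X t')))%E.
Proof.
move=> mF F0; pose Y (tt : T * T) : family R I := mix A (X tt.1) (X tt.2).
have mY : measurable_fun setT Y.
  by apply: measurable_mix; [exact: measurableT_comp mXf measurable_fst
    | exact: measurableT_comp mXf measurable_snd].
have mFY : measurable_fun setT (F \o Y) by exact: measurableT_comp.
have FE1 := ge0_integral_pushforward mXf P measurableT mF (fun x _ => F0 x).
have FE2 := ge0_integral_pushforward mY (P \x P)%E measurableT mF (fun x _ => F0 x).
rewrite -[LHS]/(\int[P]_(x in X @^-1` setT) (F \o X) x)%E -FE1.
transitivity (\int[(P \x P)%E]_(x in Y @^-1` setT) (F \o Y) x)%E; last first.
  by rewrite preimage_setT (fubini_tonelli1 _ mFY) //= => x; exact: F0.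
rewrite -FE2; apply: eq_measure_integral => C mC _.
refine (@measure_unique _ R (family R I) (@boxes R I) (fun=> setT) erefl _ _ _ _ _ _ _ C mC) => //.
- move=> _ _ [B1 mB1 ->] [B2 mB2 ->]; exists (fun i => B1 i `&` B2 i).
    by move=> i; exact: measurableI.
  by apply/seteqP; split=> [x [h1 h2] i|x h]; [split; [exact: h1|exact: h2]
    | split=> i; have [] := h i].
- by move=> _; exists (fun=> setT) => //; apply/seteqP; split.
- by rewrite bigcup_const //; exists 0%N.
- move=> _ [B mB ->].
  pose S1 := [set t | forall i, A i -> B i (X t i)].
  pose S2 := [set t | forall i, ~~ A i -> B i (X t i)].
  have mS (Q : pred I) : measurable [set t | forall i, Q i -> B i (X t i)].
    have -> : [set t | forall i, Q i -> B i (X t i)] =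
      \bigcap_(i in [set i | Q i]) ((fun t => X t i) @^-1` B i) by [].
    apply: fin_bigcap_measurable; first exact: finite_finset.
    by move=> i _; rewrite -[X in measurable X]setTI; exact: mX.
  rewrite -[LHS]/(P (X @^-1` [set x | forall i, B i (x i)])).
  rewrite -[RHS]/((P \x P)%E (Y @^-1` [set x | forall i, B i (x i)])).
  have -> : Y @^-1` [set x | forall i, B i (x i)] = S1 `*` S2.
    apply/seteqP; split=> [[t t'] /= h|[t t'] /= [h1 h2] i].
      by split=> i Ai; have := h i; rewrite /Y /mix /= ?Ai // (negbTE Ai).
    by rewrite /Y /mix /=; case: ifPn => Ai; [exact: h1|exact: h2].
  rewrite [RHS](product_measure1E _ _ (mS _) (mS _)) /S1 /S2.
  rewrite [LHS]indepX // (bigID A) /=.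
  congr (_ * _)%E; apply/esym; first exact: indep_box.
  exact: (indep_box (fun i => ~~ A i) mB).
- move=> _; rewrite -[X in (X < _)%E]/(P (X @^-1` setT)) preimage_setT.
  by rewrite probability_setT ltry.
Qed.

Lemma Ex_mix (A : pred I) (f : family R I -> R) : bmf f ->
  Ex P (fun t => f (X t)) = Ex P (fun t => Ex P (fun t' => f (mix A (X t) (X t')))).
Proof.
move=> bf; have [mf [K fK]] := bf.
have bX : bmf (fun t => f (X t)) := bmf_comp mXf bf.
have mM : measurable_fun setT ((fun tt => mix A (X tt.1) (X tt.2)) : T * T -> family R I).
  by apply: measurable_mix; [exact: measurableT_comp mXf measurable_fst
    | exact: measurableT_comp mXf measurable_snd].
have bM : bmf (fun tt : T * T => f (mix A (X tt.1) (X tt.2))).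
  exact: (bmf_comp mM bf).
have bsec t : bmf (fun t' => f (mix A (X t) (X t'))).
  have mc : measurable_fun setT ((fun _ : T => X t) : T -> family R I) by exact: measurable_cst.
  exact: (bmf_comp (measurable_mix A mc mXf) bf).
have bE := bmf_Ex P bM; rewrite /= in bE.
have bK d' (T' : measurableType d') := @bmf_cst R d' T' K.
have mF : measurable_fun setT (fun x : family R I => (f x + K)%:E).
  by apply/measurable_EFinP; exact: measurable_funD.
have F0 (x : family R I) : (0 <= (f x + K)%:E)%E.
  by rewrite lee_fin; have := fK x; rewrite ler_norml; lra.
have h := law_mix A mF F0; apply: (addIr K); apply: EFin_inj.
have <- : (\int[P]_t (f (X t) + K)%:E)%E = (Ex P (fun t => f (X t)) + K)%:E.
  by rewrite ExE ?ExD ?Ex_cst //; exact: bmfD.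
rewrite h.
have <- : (\int[P]_t (Ex P (fun t' => f (mix A (X t) (X t'))) + K)%:E)%E =
    (Ex P (fun t => Ex P (fun t' => f (mix A (X t) (X t')))) + K)%:E.
  by rewrite ExE ?ExD ?Ex_cst //; exact: bmfD.
apply: eq_integral => t _; rewrite ExE ?ExD ?Ex_cst //.
by apply: bmfD.
Qed.

(* Bounded differences: revealing the coordinates block by block gives a martingale whose
   increments are at most [c]; its fourth moment is then of order [n^2 c^4]. *)
Section BoundedDifferences.
Context (n : nat) (block : I -> nat) (f : family R I -> R) (c : R).
Hypothesis bf : bmf f.
Hypothesis block_lt : forall i, (block i < n)%N.
Hypothesis f_diff : forall k (x y : family R I),
  (forall i, block i != k -> x i = y i) -> `|f x - f y| <= c.

Let A (k : nat) : pred I := fun i => (block i < k)%N.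
(** Doob's martingale, the expectation of [f] given the blocks below [k], as a function of the
    coordinates instead of the sample point. *)
Let rev (k : nat) (x : family R I) : R := Ex P (fun t' => f (mix (A k) x (X t'))).
Let m : R := Ex P (fun t => f (X t)).

Let b_mix k (x : family R I) : bmf (fun t' => f (mix (A k) x (X t'))).
Proof.
have mc : measurable_fun setT ((fun _ : T => x) : T -> family R I) by exact: measurable_cst.
exact: (bmf_comp (measurable_mix (A k) mc mXf) bf).
Qed.

Let b_rev k : bmf (rev k).
Proof.
have mM : measurable_fun setT ((fun z => mix (A k) z.1 (X z.2)) : family R I * T -> family R I).
  apply: measurable_mix; first exact: measurable_fst.
  exact: measurableT_comp mXf measurable_snd.
exact: (bmf_Ex P (bmf_comp mM bf)).
Qed.

Let rev_mix k (x y : family R I) : rev k (mix (A k) x y) = rev k x.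
Proof.
apply: eq_Ex => t; congr f; apply/funext => i; rewrite /mix.
by case: (A k i).
Qed.

Let rev0 x : rev 0 x = m.
Proof. by []. Qed.

Let revn x : rev n x = f x.
Proof.
rewrite /rev -[RHS](Ex_cst P); apply: eq_Ex => t; congr f; apply/funext => i.
by rewrite /mix /A block_lt.
Qed.

Let rev_diff k x : `|rev k.+1 x - rev k x| <= c.
Proof.
rewrite /rev -ExB //; apply: Ex_bound => [|t]; first exact: bmfB.
apply: (f_diff (k := k)) => i ik; rewrite /mix /A ltnS leq_eqVlt.
by rewrite (negbTE ik).
Qed.

(** The martingale property: block [k] from one copy and the later blocks from a second copy are
    together distributed as a single copy. *)
Let rev_tower k (x : family R I) : Ex P (fun t' => rev k.+1 (mix (A k) x (X t'))) = rev k x.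
Proof.
have mc : measurable_fun setT ((fun _ : family R I => x) : family R I -> family R I).
  exact: measurable_cst.
have mid : measurable_fun setT (id : family R I -> family R I) by exact: measurable_id.
have bg : bmf (fun y : family R I => f (mix (A k) x y)).
  exact: (bmf_comp (measurable_mix (A k) mc mid) bf).
rewrite /rev [RHS](Ex_mix (A k.+1) bg); apply: eq_Ex => t; apply: eq_Ex => t'.
congr f; apply/funext => i; rewrite /mix /A ltnS leq_eqVlt.
by case: ltngtP.
Qed.

Let orthogonal k (g : R -> R) : bmf (fun x => g (rev k x)) ->
  Ex P (fun t => g (rev k (X t)) * (rev k.+1 (X t) - rev k (X t))) = 0.
Proof.
move=> bg; have bF : bmf (fun x => g (rev k x) * (rev k.+1 x - rev k x)).
  by apply: bmfM => //; apply: bmfB.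
rewrite (Ex_mix (A k) bF) -[RHS](Ex_cst P 0); apply: eq_Ex => t.
have mc : measurable_fun setT ((fun _ : T => X t) : T -> family R I) by exact: measurable_cst.
have bR : bmf (fun t' => rev k.+1 (mix (A k) (X t) (X t'))).
  exact: (bmf_comp (measurable_mix (A k) mc mXf) (b_rev k.+1)).
under eq_Ex do rewrite rev_mix.
rewrite ExZ; last by apply: bmfB => //; exact: bmf_cst.
by rewrite ExB ?Ex_cst ?rev_tower ?subrr ?mulr0 //; exact: bmf_cst.
Qed.

Let c0 : 0 <= c.
Proof. by apply: le_trans (f_diff (k := 0%N) (x := fun=> 0) (y := fun=> 0) _). Qed.

Let S k (t : T) : R := rev k (X t) - m.

Let bS k : bmf (S k).
Proof. by apply: bmfB; [exact: (bmf_comp mXf (b_rev k)) | exact: bmf_cst]. Qed.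

Let D k (t : T) : R := rev k.+1 (X t) - rev k (X t).

Let bD k : bmf (D k).
Proof. by apply: bmfB; exact: (bmf_comp mXf (b_rev _)). Qed.

Let D_le k t : `|D k t| <= c. Proof. exact: rev_diff. Qed.

Let SS k t : S k.+1 t = S k t + D k t.
Proof. by rewrite /S /D; ring. Qed.

Let S_orth k j : Ex P (fun t => S k t ^+ j * D k t) = 0.
Proof.
apply: (@orthogonal k (fun y => (y - m) ^+ j)).
by apply: bmfX; apply: bmfB => //; exact: bmf_cst.
Qed.

Let second_moment k : Ex P (fun t => S k t ^+ 2) <= k%:R * c ^+ 2.
Proof.
elim: k => [|k IH].
  rewrite mul0r; rewrite -[leRHS](Ex_cst P); apply: Ex_le => [||t].
  - exact: bmfX.
  - exact: bmf_cst.
  - by rewrite /S rev0 subrr expr0n.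
have b1 := bmfX 2 (bS k); have b2 : bmf (fun t => S k t ^+ 1 * D k t) by apply: bmfM => //; exact: bmfX.
have b3 := bmfX 2 (bD k).
have -> : Ex P (fun t => S k.+1 t ^+ 2) =
    Ex P (fun t => (S k t ^+ 2 + 2 * (S k t ^+ 1 * D k t)) + D k t ^+ 2).
  by apply: eq_Ex => t; rewrite SS; ring.
have b2' : bmf (fun t => 2 * (S k t ^+ 1 * D k t)) by apply: bmfM => //; exact: bmf_cst.
rewrite ExD //; last exact: bmfD.
rewrite ExD // ExZ // S_orth mulr0 addr0 -natr1 mulrDl mul1r lerD //.
rewrite -[leRHS](Ex_cst P); apply: Ex_le => // [|t]; first exact: bmf_cst.
by rewrite -[leLHS]real_normK ?num_real // lerXn2r ?nnegrE.
Qed.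

Let fourth_moment k : Ex P (fun t => S k t ^+ 4) <= 4 * k%:R ^+ 2 * c ^+ 4.
Proof.
elim: k => [|k IH].
  rewrite expr0n mulr0 mul0r -[leRHS](Ex_cst P); apply: Ex_le => [||t].
  - exact: bmfX.
  - exact: bmf_cst.
  - by rewrite /S rev0 subrr expr0n.
have b1 := bmfX 4 (bS k); have b2 : bmf (fun t => S k t ^+ 3 * D k t) by apply: bmfM => //; exact: bmfX.
have b3 := bmfX 2 (bS k).
have b2' : bmf (fun t => 4 * (S k t ^+ 3 * D k t)) by apply: bmfM => //; exact: bmf_cst.
have b3' : bmf (fun t => 8 * c ^+ 2 * S k t ^+ 2) by apply: bmfM => //; exact: bmf_cst.
have b4 := bmf_cst T (3 * c ^+ 4).
(* In the expansion of the fourth power of [s + d'] the term [4 s^3 d'] has mean 0, and [4 s d'^3]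
   is at most [2 d'^2 (s^2 + d'^2)]: hence 8 = 6 + 2 and 3 = 1 + 2. *)
apply: (@le_trans _ _ (Ex P (fun t => (S k t ^+ 4 + 4 * (S k t ^+ 3 * D k t)) +
   (8 * c ^+ 2 * S k t ^+ 2 + 3 * c ^+ 4)))).
  apply: Ex_le => [||t]; first exact: bmfX.
    by apply: bmfD; exact: bmfD.
  rewrite SS; set s := S k t; set d' := D k t.
  have dc : d' ^+ 2 <= c ^+ 2.
    by rewrite -[leLHS]real_normK ?num_real // lerXn2r ?nnegrE //; exact: D_le.
  have -> : (s + d') ^+ 4 = (s ^+ 4 + 4 * (s ^+ 3 * d')) + (6 * (d' ^+ 2 * s ^+ 2) + 4 * (d' ^+ 2 * (s * d')) + (d' ^+ 2) ^+ 2).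
    by ring.
  rewrite lerD2l (_ : c ^+ 4 = (c ^+ 2) ^+ 2); last by rewrite -exprM.
  have sd : 2 * (s * d') <= s ^+ 2 + d' ^+ 2 by have := sqr_ge0 (s - d'); nra.
  have s2 := sqr_ge0 s; have d2 := sqr_ge0 d'.
  have h1 : d' ^+ 2 * s ^+ 2 <= c ^+ 2 * s ^+ 2 by rewrite ler_wpM2r.
  have h2 : (d' ^+ 2) ^+ 2 <= (c ^+ 2) ^+ 2 by rewrite lerXn2r ?nnegrE // sqr_ge0.
  have h3 : d' ^+ 2 * (2 * (s * d')) <= d' ^+ 2 * s ^+ 2 + (d' ^+ 2) ^+ 2.
    by rewrite [(d' ^+ 2) ^+ 2]expr2 -mulrDr ler_wpM2l.
  rewrite mulrCA in h3; rewrite -[8 * _ * _]mulrA.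
  move: h1 h2 h3; move: (d' ^+ 2 * s ^+ 2) (c ^+ 2 * s ^+ 2) ((d' ^+ 2) ^+ 2) ((c ^+ 2) ^+ 2)
    (d' ^+ 2 * (s * d')) => p q r v w; lra.
rewrite ExD; [|exact: bmfD|exact: bmfD].
rewrite ExD // ExZ // S_orth mulr0 addr0 ExD // Ex_cst ExZ //.
have h := ler_wpM2l (mulr_ge0 (ler0n _ 8) (sqr_ge0 c)) (second_moment k).
apply: le_trans (lerD IH (lerD h (lexx _))) _.
(* The recursion adds [(8 k + 3) c^4], just below the increment [(8 k + 4) c^4] of the claimed
   bound. *)
have -> : 4 * k%:R ^+ 2 * c ^+ 4 + (8 * c ^+ 2 * (k%:R * c ^+ 2) + 3 * c ^+ 4) =
    (4 * k.+1%:R ^+ 2 - 1) * c ^+ 4.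
  by rewrite -natr1; ring.
rewrite ler_wpM2r ?exprn_ge0 //; lra.
Qed.

Lemma bounded_difference_fourth_moment :
  Ex P (fun t => (f (X t) - Ex P (fun t => f (X t))) ^+ 4) <= 4 * n%:R ^+ 2 * c ^+ 4.
Proof.
apply: le_trans (fourth_moment n); rewrite le_eqVlt; apply/orP; left; apply/eqP.
by apply: eq_Ex => t; rewrite /S revn.
Qed.

End BoundedDifferences.
End Independence.

(** * Measurability of complex functions by components, up to inverse matrices *)

Section ComplexMeasurable.
Context {R : realType} d (T : measurableType d).
Implicit Types f g : T -> R[i].

Definition cmf f : Prop := measurable_fun setT (fun t => complex.Re (f t)) /\
  measurable_fun setT (fun t => complex.Im (f t)).

Lemma cmf_cst (a : R[i]) : cmf (fun=> a).
Proof. by split; exact: measurable_cst. Qed.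

Lemma cmf_real (h : T -> R) : measurable_fun setT h -> cmf (fun t => (h t)%:C%C).
Proof. by move=> mh; split => //=; exact: measurable_cst. Qed.

Lemma cmfD f g : cmf f -> cmf g -> cmf (fun t => f t + g t).
Proof.
move=> [rf If] [rg Ig]; split; under eq_fun do rewrite ?cReD ?cImD;
  exact: measurable_funD.
Qed.

Lemma cmfM f g : cmf f -> cmf g -> cmf (fun t => f t * g t).
Proof.
move=> [rf If] [rg Ig]; split.
  by under eq_fun do rewrite cReM; apply: measurable_funB; exact: measurable_funM.
by under eq_fun do rewrite cImM; apply: measurable_funD; exact: measurable_funM.
Qed.

Lemma cmf_sum (J : Type) (r : seq J) (Q : pred J) (F : J -> T -> R[i]) :
  (forall j, cmf (F j)) -> cmf (fun t => \sum_(j <- r | Q j) F j t).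
Proof.
move=> bF; elim: r => [|j r IH]; first by under eq_fun do rewrite big_nil; exact: cmf_cst.
under eq_fun do rewrite big_cons.
by case: (Q j) => //; apply: cmfD.
Qed.

Lemma cmf_prod (J : Type) (r : seq J) (Q : pred J) (F : J -> T -> R[i]) :
  (forall j, cmf (F j)) -> cmf (fun t => \prod_(j <- r | Q j) F j t).
Proof.
move=> bF; elim: r => [|j r IH]; first by under eq_fun do rewrite big_nil; exact: cmf_cst.
under eq_fun do rewrite big_cons.
by case: (Q j) => //; apply: cmfM.
Qed.

Lemma cmfV f : (forall t, f t != 0) -> cmf f -> cmf (fun t => (f t)^-1).
Proof.
move=> f0 [rf If]; pose D t := complex.Re (f t) ^+ 2 + complex.Im (f t) ^+ 2.
have D0 t : D t != 0.
  by rewrite /D -cabs_sqr expf_neq0 // cabs_eq0.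
have mD : measurable_fun setT (fun t => (D t)^-1).
  apply: (measurable_comp (F := [set x : R | x != 0]) (f := fun x : R => x^-1) (g := D)).
  - by apply: open_measurable; exact: open_neq.
  - by move=> _ [t _ <-]; exact: D0.
  - apply: open_continuous_measurable_fun; first exact: open_neq.
    by move=> x; rewrite inE /= => x0; exact: inv_continuous.
  - by apply: measurable_funD; exact: measurable_funX.
split.
  have -> : (fun t => complex.Re (f t)^-1) = fun t => complex.Re (f t) * (D t)^-1.
    by apply/funext => t; rewrite /D; case: (f t).
  exact: measurable_funM.
have -> : (fun t => complex.Im (f t)^-1) = fun t => - complex.Im (f t) * (D t)^-1.
  by apply/funext => t; rewrite /D; case: (f t) => a b /=; rewrite mulNr.
by apply: measurable_funM => //; exact: measurableT_comp.
Qed.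

Lemma cmf_det n (A : T -> 'M[R[i]]_n) : (forall i j, cmf (fun t => A t i j)) ->
  cmf (fun t => \det (A t)).
Proof.
move=> mA; apply: cmf_sum => s; apply: cmfM; first exact: cmf_cst.
by apply: cmf_prod => i.
Qed.

(** Cramer's rule: an entry of the inverse is a cofactor divided by a determinant that never
    vanishes. *)
Lemma cmf_invmx n (A : T -> 'M[R[i]]_n) (i j : 'I_n) :
  (forall t, A t \in unitmx) -> (forall i j, cmf (fun t => A t i j)) ->
  cmf (fun t => invmx (A t) i j).
Proof.
move=> uA mA; have -> : (fun t => invmx (A t) i j) =
    fun t => (\det (A t))^-1 * ((-1) ^+ (j + i) * \det (row' j (col' i (A t)))).
  by apply/funext => t; rewrite /invmx uA !mxE.
apply: cmfM; first by apply: cmfV; [move=> t; rewrite -unitfE -unitmxE uA | exact: cmf_det].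
apply: cmfM; first exact: cmf_cst.
case: n => [|n] in A i j uA mA *; first by case: i.
by apply: cmf_det => k l; under eq_fun do rewrite !mxE.
Qed.

End ComplexMeasurable.

(** * Expectation of bounded complex random variables *)

Section ComplexExpectation.
Context {R : realType} d (T : measurableType d) (P : probability T R).
Implicit Types f g : T -> R[i].

Definition cbf f : Prop := bmf (fun t => complex.Re (f t)) /\ bmf (fun t => complex.Im (f t)).

Lemma cbfP f (K : R) : cmf f -> (forall t, cabs (f t) <= K) -> cbf f.
Proof.
move=> [rf If] fK; split; split=> //; exists K => t; apply: le_trans (fK t).
  exact: ler_Re_cabs.
exact: ler_Im_cabs.
Qed.

Lemma cbf_cst (a : R[i]) : cbf (fun=> a).
Proof. by split; exact: bmf_cst. Qed.

Lemma cbf_real (h : T -> R) : bmf h -> cbf (fun t => (h t)%:C%C).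
Proof. by move=> bh; split => //=; exact: bmf_cst. Qed.

Lemma cbfD f g : cbf f -> cbf g -> cbf (fun t => f t + g t).
Proof. by move=> [rf If] [rg Ig]; split; under eq_fun do rewrite ?cReD ?cImD; exact: bmfD. Qed.

Lemma cbfB f g : cbf f -> cbf g -> cbf (fun t => f t - g t).
Proof. by move=> [rf If] [rg Ig]; split; under eq_fun do rewrite ?cReB ?cImB; exact: bmfB. Qed.

Lemma cbfM f g : cbf f -> cbf g -> cbf (fun t => f t * g t).
Proof.
move=> [rf If] [rg Ig]; split.
  by under eq_fun do rewrite cReM; apply: bmfB; exact: bmfM.
by under eq_fun do rewrite cImM; apply: bmfD; exact: bmfM.
Qed.

Lemma cbf_sum (J : Type) (r : seq J) (Q : pred J) (F : J -> T -> R[i]) :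
  (forall j, cbf (F j)) -> cbf (fun t => \sum_(j <- r | Q j) F j t).
Proof.
move=> bF; elim: r => [|j r IH]; first by under eq_fun do rewrite big_nil; exact: cbf_cst.
under eq_fun do rewrite big_cons.
by case: (Q j) => //; apply: cbfD.
Qed.

Definition Ec f : R[i] :=
  Complex (Ex P (fun t => complex.Re (f t))) (Ex P (fun t => complex.Im (f t))).

Lemma Ec_cst a : Ec (fun=> a) = a.
Proof. by rewrite /Ec !Ex_cst; case: a. Qed.

Lemma eq_Ec f g : f =1 g -> Ec f = Ec g.
Proof. by move=> /funext ->. Qed.

Lemma EcD f g : cbf f -> cbf g -> Ec (fun t => f t + g t) = Ec f + Ec g.
Proof.
move=> [rf If] [rg Ig]; rewrite /Ec; under eq_Ex do rewrite cReD.
under [X in Complex _ X]eq_Ex do rewrite cImD.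
by rewrite !ExD.
Qed.

Lemma EcZ a f : cbf f -> Ec (fun t => a * f t) = a * Ec f.
Proof.
move=> [rf If]; rewrite /Ec; under eq_Ex do rewrite cReM.
under [X in Complex _ X]eq_Ex do rewrite cImM.
have bZ (b : R) (h : T -> R) : bmf h -> bmf (fun t => b * h t).
  by move=> bh; apply: bmfM => //; exact: bmf_cst.
rewrite ExB ?ExD ?ExZ //; try exact: bZ.
by case: a => a b; apply/eqP; rewrite eq_complex /= !eqxx.
Qed.

Lemma EcB f g : cbf f -> cbf g -> Ec (fun t => f t - g t) = Ec f - Ec g.
Proof.
move=> bf bg; under eq_Ec do rewrite -mulN1r.
by rewrite EcD ?EcZ ?mulN1r //; apply: cbfM => //; exact: cbf_cst.
Qed.

Lemma Ec_sum (J : Type) (r : seq J) (Q : pred J) (F : J -> T -> R[i]) :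
  (forall j, cbf (F j)) ->
  Ec (fun t => \sum_(j <- r | Q j) F j t) = \sum_(j <- r | Q j) Ec (F j).
Proof.
move=> bF; elim: r => [|j r IH].
  by under [in LHS]eq_Ec do rewrite big_nil; rewrite big_nil Ec_cst.
under [in LHS]eq_Ec do rewrite big_cons.
by rewrite big_cons; case: (Q j) => //; rewrite EcD ?IH //; exact: cbf_sum.
Qed.

(* Bounding the real and imaginary parts separately costs a factor [2]. *)
Lemma cabs_Ec_le f (h : T -> R) : cbf f ->
  P.-integrable setT (EFin \o h) -> (forall t, cabs (f t) <= h t) ->
  cabs (Ec f) <= 2 * Ex P h.
Proof.
move=> [rf If] Ih fh; apply: le_trans (ler_cabs_ReIm _) _.
rewrite mulr_natl mulr2n; apply: lerD; apply: le_trans (Ex_norm P _) _ => //.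
  apply: le_Rintegral => // [|t _]; first exact: bmf_integrable (bmf_norm rf).
  exact: le_trans (ler_Re_cabs _) (fh t).
apply: le_Rintegral => // [|t _]; first exact: bmf_integrable (bmf_norm If).
exact: le_trans (ler_Im_cabs _) (fh t).
Qed.

Lemma cabs_Ec_bound f (a : R) : cbf f -> (forall t, cabs (f t) <= a) -> cabs (Ec f) <= 2 * a.
Proof. by move=> bf fa; have := cabs_Ec_le bf (bmf_integrable P (bmf_cst T a)) fa; rewrite Ex_cst. Qed.

(** The square carries no modulus, as in the equation for the Stieltjes transform; the deviation
    from the squared mean is still controlled by the variances of the two components. *)
Lemma Ec_variance f : cbf f ->
  cabs (Ec (fun t => f t ^+ 2) - Ec f ^+ 2) <=
  2 * (Ex P (fun t => (complex.Re (f t) - Ex P (fun t => complex.Re (f t))) ^+ 2) +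
       Ex P (fun t => (complex.Im (f t) - Ex P (fun t => complex.Im (f t))) ^+ 2)).
Proof.
move=> bf; have bc := cbf_cst (Ec f); have bs : cbf (fun t => f t - Ec f) by apply: cbfB.
have [rf If] := bf.
have -> : Ec (fun t => f t ^+ 2) - Ec f ^+ 2 = Ec (fun t => (f t - Ec f) ^+ 2).
  have b1 : cbf (fun t => f t ^+ 2) by under eq_fun do rewrite expr2; exact: cbfM.
  have b2 : cbf (fun t => 2 * Ec f * f t) by apply: cbfM => //; exact: cbf_cst.
  have -> : Ec (fun t => (f t - Ec f) ^+ 2) =
      Ec (fun t => (f t ^+ 2 - 2 * Ec f * f t) + Ec f ^+ 2).
    by apply: eq_Ec => t; ring.
  rewrite EcD; [|exact: cbfB|exact: cbf_cst].
  by rewrite EcB // EcZ // Ec_cst; ring.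
have bR : bmf (fun t => (complex.Re (f t) - Ex P (fun t => complex.Re (f t))) ^+ 2).
  by apply: bmfX; apply: bmfB => //; exact: bmf_cst.
have bI : bmf (fun t => (complex.Im (f t) - Ex P (fun t => complex.Im (f t))) ^+ 2).
  by apply: bmfX; apply: bmfB => //; exact: bmf_cst.
rewrite -ExD //; apply: cabs_Ec_le.
- by under eq_fun do rewrite expr2; exact: cbfM.
- by apply: bmf_integrable; exact: bmfD.
- by move=> t; rewrite cabsX cabs_sqr cReB cImB.
Qed.

End ComplexExpectation.

(** * Symmetric matrices as functions of a family of coordinates *)

Notation entries R n := (family R ('I_n * 'I_n)%type).

Section MatrixModel.
Context {R : realType} (n : nat).
Implicit Types (x y : entries R n) (psi : 'I_n * 'I_n -> R -> R).

(** Both positions of a symmetric entry read the same coordinate; coordinates below the diagonal are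
    never read. *)
Definition upper (i j : 'I_n) : 'I_n * 'I_n := if (i <= j)%N then (i, j) else (j, i).

Lemma upperC i j : upper i j = upper j i.
Proof.
rewrite /upper; case: (ltngtP i j) => // ij.
by congr (_, _); apply: val_inj; rewrite /= ij.
Qed.

Lemma upper_fst i j : (upper i j).1 = i \/ (upper i j).1 = j.
Proof. by rewrite /upper; case: ifP => _; [left | right]. Qed.

Lemma upper_eq i j k l : upper i j = upper k l -> (i = k /\ j = l) \/ (i = l /\ j = k).
Proof.
rewrite /upper; case: ifP => _; case: ifP => _ [-> ->];
  by [left | right].
Qed.

(** Since [psi] acts on each coordinate as it is read, the rescaled matrix, its truncation and a
    matrix with one entry suppressed are all functions of the same family. *)
Definition emx psi x : 'M[R[i]]_n :=
  \matrix_(i, j) (psi (upper i j) (x (upper i j)))%:C%C.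

Lemma emx_hermitian psi x : hermitian (emx psi x).
Proof.
by apply/matrixP => i j; rewrite !mxE conj_real_complex upperC.
Qed.

(** Once row [k] is removed, what remains is supported on column [k]: two pieces of rank at most
    one. *)
Lemma rank_cross (k : 'I_n) (D : 'M[R[i]]_n) :
  (forall i j, i != k -> j != k -> D i j = 0) -> (\rank D <= 2)%N.
Proof.
move=> Dk; pose D1 := delta_mx k (0 : 'I_1) *m row k D.
have -> : D = D1 + (D - D1) by rewrite addrCA subrr addr0.
apply: leq_trans (mxrank_add _ _) _; rewrite -[2%N]/(1 + 1)%N; apply: leq_add.
  exact: leq_trans (mxrankM_maxr _ _) (rank_leq_row _).
have -> : D - D1 = col k (D - D1) *m delta_mx (0 : 'I_1) k.
  apply/matrixP => i j; rewrite !mxE big_ord1 !mxE big_ord1 !mxE big_ord1 !mxE !eqxx /=.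
  have [->|ik] := eqVneq i k; have [->|jk] := eqVneq j k; rewrite /= ?mulr1 ?mul1r ?mul0r ?mulr0 ?subr0 ?subrr //.
  exact: Dk.
exact: leq_trans (mxrankM_maxl _ _) (rank_leq_col _).
Qed.

Section Resolvent.
Variables (psi : 'I_n * 'I_n -> R -> R) (z : R[i]).
Hypothesis mpsi : forall b, measurable_fun setT (psi b).
Hypothesis z0 : 0 < complex.Im z.

Lemma cbf_resolvent i j : cbf (fun x => resolvent (emx psi x) z i j).
Proof.
apply: (cbfP (K := (complex.Im z)^-1)).
  apply: cmf_invmx => [x|k l]; first exact: (shift_unit (emx_hermitian psi x) z0).
  have -> : (fun x : entries R n => (emx psi x - z%:M) k l) =
      fun x => (psi (upper k l) (x (upper k l)))%:C%C + - z *+ (k == l).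
    by apply/funext => x; rewrite !mxE mulNrn.
  apply: cmfD (cmf_cst _ _); apply: cmf_real.
  exact: measurableT_comp (mpsi _) (measurable_coord _).
move=> x; apply: resolvent_entry => //; exact: emx_hermitian.
Qed.

Lemma cbf_stieltjes : cbf (fun x => stieltjes (emx psi x) z).
Proof.
apply: cbfM; first exact: cbf_cst.
by apply: cbf_sum => i; exact: cbf_resolvent.
Qed.

End Resolvent.
End MatrixModel.

(** The resolvent identity for a change of one symmetric pair of entries. The factor [h] stands
    outside, so that each use of the identity extracts one power of the entry. *)
Lemma resolvent_pair (R : realType) n (H K : 'M[R[i]]_n) (z h : R[i]) (i j : 'I_n) :
  hermitian H -> hermitian K -> 0 < complex.Im z ->
  K - H = h *: (delta_mx i j + delta_mx j i) -> forall a b,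
  resolvent H z a b - resolvent K z a b = h *
    (resolvent H z a i * resolvent K z j b + resolvent H z a j * resolvent K z i b).
Proof.
move=> Hh Kh z0 KH a b; have /matrixP/(_ a b) := resolvent_sub Hh Kh z0.
have E (A B : 'M[R[i]]_n) k l : (A *m delta_mx k l *m B) a b = A a k * B l b.
  by rewrite -(mul_delta_mx (0 : 'I_1)) mulmxA -colE -mulmxA -rowE mxE big_ord1 !mxE.
rewrite KH -scalemxAr -scalemxAl mulmxDr mulmxDl.
move: (resolvent H z) (resolvent K z) => A A'; rewrite mxE [X in _ + X]mxE => ->.
by rewrite mxE mxE !E.
Qed.

(** * Concentration and the approximate quadratic equation for independent entries *)

Section IndependentEntries.
Context {R : realType} d (T : measurableType d) (P : probability T R) (n : nat).
Context (X : T -> 'I_n * 'I_n -> R).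
Hypothesis n0 : (0 < n)%N.
Hypothesis mX : forall i, measurable_fun setT (fun t => X t i).
Hypothesis indepX : forall B : 'I_n * 'I_n -> set R, (forall i, measurable (B i)) ->
  P [set t | forall i, B i (X t i)] = (\prod_i P ((fun t => X t i) @^-1` B i))%E.
Variable z : R[i].
Hypothesis z0 : 0 < complex.Im z.
Local Notation eta := (complex.Im z).

Let mXf : measurable_fun setT (X : T -> entries R n) := measurable_family mX.

Lemma cbf_family (f : entries R n -> R[i]) : cbf f -> cbf (fun t => f (X t)).
Proof. by move=> [rf If]; split; [exact: (bmf_comp mXf rf) | exact: (bmf_comp mXf If)]. Qed.

(** All coordinates except [p] are resampled: [g] then sees only the new copy and [u] only the old
    one, so the double integral factorises. *)
Lemma Ec_indep (p : 'I_n * 'I_n) (u : R -> R) (g : entries R n -> R[i]) :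
  bmf u -> cbf g -> (forall x y : entries R n, (forall q, q != p -> x q = y q) -> g x = g y) ->
  Ec P (fun t => (u (X t p))%:C%C * g (X t)) =
  (Ex P (fun t => u (X t p)))%:C%C * Ec P (fun t => g (X t)).
Proof.
move=> bu bg gp; have bup : bmf (fun x : entries R n => u (x p)).
  exact: (bmf_comp (measurable_coord p) bu).
have buX : bmf (fun t => u (X t p)) := bmf_comp mXf bup.
have [bgr bgi] := bg.
have key (h : entries R n -> R) : bmf h -> (forall x y : entries R n, (forall q, q != p -> x q = y q) -> h x = h y) ->
    Ex P (fun t => u (X t p) * h (X t)) = Ex P (fun t => u (X t p)) * Ex P (fun t => h (X t)).
  move=> bh hp; have bF : bmf (fun x : entries R n => u (x p) * h x) by exact: bmfM.
  rewrite (Ex_mix mX indepX (pred1 p) bF).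
  have bhX : bmf (fun t => h (X t)) := bmf_comp mXf bh.
  rewrite mulrC -ExZ //; apply: eq_Ex => t.
  rewrite mulrC -ExZ //; apply: eq_Ex => t'; rewrite /mix /= eqxx; congr (_ * _).
  by apply: hp => q /negbTE ->.
rewrite {1}/Ec; under eq_Ex do rewrite mulrC cReMr mulrC.
under [X in Complex _ X]eq_Ex do rewrite mulrC cImMr mulrC.
rewrite (key _ bgr); last by move=> x y xy; rewrite (gp x y).
rewrite (key _ bgi); last by move=> x y xy; rewrite (gp x y).
by rewrite /Ec; apply/eqP; rewrite eq_complex /= !mul0r subr0 addr0 !eqxx.
Qed.

Section Concentration.
Variable psi : 'I_n * 'I_n -> R -> R.
Hypothesis mpsi : forall b, measurable_fun setT (psi b).
Let s (x : entries R n) := stieltjes (emx psi x) z.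

(** A block consists of the coordinates with first index [k]. They occupy only row and column [k] of
    the matrix, so the change has rank at most 2 however large the entries are. *)
Lemma stieltjes_block_diff k (x y : entries R n) :
  (forall i : 'I_n * 'I_n, (i.1 : nat) != k -> x i = y i) ->
  cabs (s x - s y) <= 4 * eta^-1 * n%:R^-1.
Proof.
move=> xy; apply: le_trans (stieltjes_sub_rank (emx_hermitian psi x) (emx_hermitian psi y) z0 n0) _.
have -> : 4 * eta^-1 * n%:R^-1 = 2 * eta^-1 * (n%:R^-1 * 2) by ring.
rewrite ler_wpM2l ?mulr_ge0 ?invr_ge0 ?(ltW z0) // ler_wpM2l // ler_nat.
have [kn|nk] := ltnP k n; last first.
  rewrite (_ : emx psi y - _ = 0) ?mxrank0 //; apply/matrixP => i j; rewrite !mxE.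
  rewrite xy ?subrr //; apply/eqP => ik; have := ltn_ord (upper i j).1.
  by rewrite ik ltnNge nk.
apply: (rank_cross (k := Ordinal kn)) => i j ik jk; rewrite !mxE xy ?subrr //.
by have [->|->] := upper_fst i j.
Qed.

(** There are [n] blocks with differences at most [4 / (eta n)], and 1024 is 4 times the fourth
    power of 4. *)
Lemma stieltjes_fourth_moment :
  Ex P (fun t => (complex.Re (s (X t)) - Ex P (fun t => complex.Re (s (X t)))) ^+ 4)
    <= 1024 * eta^-1 ^+ 4 * n%:R^-1 ^+ 2 /\
  Ex P (fun t => (complex.Im (s (X t)) - Ex P (fun t => complex.Im (s (X t)))) ^+ 4)
    <= 1024 * eta^-1 ^+ 4 * n%:R^-1 ^+ 2.
Proof.
have [bR bI] := cbf_stieltjes mpsi z0.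
have bl (i : 'I_n * 'I_n) : (i.1 < n)%N by [].
have nn : n%:R != 0 :> R by rewrite pnatr_eq0 -lt0n.
have -> : 1024 * eta^-1 ^+ 4 * n%:R^-1 ^+ 2 = 4 * n%:R ^+ 2 * (4 * eta^-1 * n%:R^-1) ^+ 4.
  rewrite !exprMn -[RHS]mulrA; have -> : (n%:R^-1 : R) ^+ 4 = n%:R^-1 ^+ 2 * n%:R^-1 ^+ 2 by rewrite -exprD.
  rewrite [n%:R ^+ 2 * _](_ : _ = 4 ^+ 4 * eta^-1 ^+ 4 * (n%:R * n%:R^-1) ^+ 2 * n%:R^-1 ^+ 2).
    by rewrite divff //; ring.
  by rewrite exprMn; ring.
split.
  apply: (bounded_difference_fourth_moment mX indepX (block := fun i => i.1) bR bl).
  move=> k x y xy; rewrite -cReB; apply: le_trans (ler_Re_cabs _) _.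
  exact: stieltjes_block_diff xy.
apply: (bounded_difference_fourth_moment mX indepX (block := fun i => i.1) bI bl).
move=> k x y xy; rewrite -cImB; apply: le_trans (ler_Im_cabs _) _.
exact: stieltjes_block_diff xy.
Qed.

(** By Jensen the fourth moments bound the second ones, with 32 the square root of 1024; two
    components and the factor 2 of [Ec_variance] give 128. *)
Lemma stieltjes_variance :
  cabs (Ec P (fun t => s (X t) ^+ 2) - Ec P (fun t => s (X t)) ^+ 2)
    <= 128 * eta^-1 ^+ 2 * n%:R^-1.
Proof.
have bs := cbf_family (cbf_stieltjes mpsi z0).
apply: le_trans (Ec_variance P bs) _; have [bR bI] := bs.
have [hR hI] := stieltjes_fourth_moment.
have key (f : T -> R) : bmf f -> Ex P (fun t => f t ^+ 4) <= 1024 * eta^-1 ^+ 4 * n%:R^-1 ^+ 2 ->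
    Ex P (fun t => f t ^+ 2) <= 32 * eta^-1 ^+ 2 * n%:R^-1.
  move=> bf h; rewrite -(@ler_pXn2r _ 2) ?nnegrE //; last 2 first.
  - by apply: Ex_ge0 => t; exact: sqr_ge0.
  - by rewrite !mulr_ge0 ?exprn_ge0 ?invr_ge0 // ltW.
  apply: le_trans (Ex_sqr P (bmfX 2 bf)) _.
  under eq_Ex do rewrite -exprM.
  by apply: le_trans h _; rewrite le_eqVlt; apply/orP; left; apply/eqP; ring.
have b1 : bmf (fun t => complex.Re (s (X t)) - Ex P (fun t => complex.Re (s (X t)))).
  by apply: bmfB => //; exact: bmf_cst.
have b2 : bmf (fun t => complex.Im (s (X t)) - Ex P (fun t => complex.Im (s (X t)))).
  by apply: bmfB => //; exact: bmf_cst.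
have := key _ b1 hR; have := key _ b2 hI.
move=> h1 h2; have -> : 128 * eta^-1 ^+ 2 * n%:R^-1 = 2 * (32 * eta^-1 ^+ 2 * n%:R^-1 + 32 * eta^-1 ^+ 2 * n%:R^-1).
  by ring.
exact: (ler_wpM2l (ler0n _ 2) (lerD h2 h1)).
Qed.

End Concentration.

Section SelfConsistent.
Variables (psi : 'I_n * 'I_n -> R -> R) (k v : R).
Hypothesis mpsi : forall b, measurable_fun setT (psi b).
Hypothesis psi_bound : forall p y, `|psi p y| <= k.
Hypothesis psi_diag : forall p y, p.1 = p.2 -> psi p y = 0.
Hypothesis psi_mean : forall p : 'I_n * 'I_n, (p.1 < p.2)%N -> Ex P (fun t => psi p (X t p)) = 0.
Hypothesis psi_var : forall p : 'I_n * 'I_n, (p.1 < p.2)%N -> Ex P (fun t => psi p (X t p) ^+ 2) = v.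
Hypothesis v_bound : 0 <= v <= k ^+ 2.

Let B := eta^-1.
Let k0 : 0 <= k.
Proof. exact: le_trans (normr_ge0 _) (psi_bound (Ordinal n0, Ordinal n0) 0). Qed.
Let B0 : 0 <= B. Proof. by rewrite invr_ge0 ltW. Qed.
Let G (x : entries R n) := resolvent (emx psi x) z.
Let bG i j : cbf (fun t => G (X t) i j).
Proof. exact: (cbf_family (cbf_resolvent mpsi z0 i j)). Qed.
Let GB x i j : cabs (G x i j) <= B.
Proof. by apply: resolvent_entry => //; exact: emx_hermitian. Qed.
Let b_psi p : bmf (psi p).
Proof. by split=> //; exists k. Qed.
Let b_psiX p : bmf (fun t => psi p (X t p)).
Proof. exact: (bmf_comp (mX p) (b_psi p)). Qed.

(* Expand the resolvent in the entries [(i, j)] and [(j, i)], on which it depends weakly. *)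
Lemma pair_expectation (i j : 'I_n) : i != j ->
  cabs (Ec P (fun t => emx psi (X t) i j * G (X t) j i) +
        v%:C%C * Ec P (fun t => G (X t) i i * G (X t) j j + G (X t) j i * G (X t) j i))
    <= 24 * k ^+ 3 * B ^+ 3.
Proof.
move=> ij; pose p := upper i j.
have p12 : (p.1 < p.2)%N.
  rewrite /p /upper; case: (leqP i j) => //= le; rewrite ltn_neqAle le andbT.
  by apply: contraNneq ij => /ord_inj ->.
(* Suppressing the entry [p] makes [G0] independent of the coordinate [p]. *)
pose psi0 q := if q == p then (fun=> 0) else psi q.
have mpsi0 q : measurable_fun setT (psi0 q).
  by rewrite /psi0; case: ifP => _ //; exact: measurable_cst.
pose G0 (x : entries R n) := resolvent (emx psi0 x) z.
pose h t := psi p (X t p).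
have bG0f a b : cbf (fun x => G0 x a b) by exact: cbf_resolvent.
have bG0 a b : cbf (fun t => G0 (X t) a b) := cbf_family (bG0f a b).
have G0B x a b : cabs (G0 x a b) <= B by apply: resolvent_entry => //; exact: emx_hermitian.
have G0p (x y : entries R n) : (forall q, q != p -> x q = y q) -> G0 x = G0 y.
  move=> xy; congr (resolvent _ z); apply/matrixP => a b; rewrite !mxE /psi0.
  by case: eqP => // /eqP q; rewrite xy.
have hk t : cabs (h t)%:C%C <= k by rewrite cabs_real; exact: psi_bound.
have GG t a b : G0 (X t) a b - G (X t) a b =
    (h t)%:C%C * (G0 (X t) a i * G (X t) j b + G0 (X t) a j * G (X t) i b).
  apply: resolvent_pair => //; try exact: emx_hermitian.
  apply/matrixP => c e; rewrite !mxE /psi0 -/p.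
  have [ce|ce] := eqVneq (upper c e) p.
    rewrite ce subr0; have [[-> ->]|[-> ->]] := upper_eq ce.
      by rewrite !eqxx (negbTE ij) /= addr0 mulr1.
    by rewrite !eqxx [j == i]eq_sym (negbTE ij) /= add0r mulr1.
  rewrite subrr; case: eqP => [ci|_] /=.
    case: eqP => [ej|_]; first by move: ce; rewrite ci ej eqxx.
    rewrite add0r; case: eqP => [cj|_]; last by rewrite mulr0.
    by move: ij; rewrite -ci cj eqxx.
  rewrite add0r; case: eqP => [cj|_] /=; last by rewrite mulr0.
  case: eqP => [ei|_]; last by rewrite mulr0.
  by move: ce; rewrite cj ei upperC eqxx.
have M3 a b c : a <= k -> b <= B -> c <= B -> 0 <= a -> 0 <= b -> 0 <= c -> a * (b * c) <= k * B ^+ 2.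
  by move=> ak bB cB a0 b0 c0; rewrite expr2 ler_pM ?mulr_ge0 ?ler_pM.
have GGB t a b : cabs (G (X t) a b - G0 (X t) a b) <= 2 * (k * B ^+ 2).
  rewrite cabsB GG cabsM; apply: le_trans (ler_wpM2l (cabs_ge0 _) (ler_cabsD _ _)) _.
  by rewrite mulrDr !cabsM mulr_natl mulr2n lerD // M3 ?cabs_ge0.
pose g t := G (X t) i i * G (X t) j j + G (X t) j i * G (X t) j i.
pose g0 x := G0 x i i * G0 x j j + G0 x j i * G0 x j i.
have bgf : cbf g0 := cbfD (cbfM (bG0f i i) (bG0f j j)) (cbfM (bG0f j i) (bG0f j i)).
have bg0 : cbf (fun t => g0 (X t)) := cbf_family bgf.
have bg : cbf g := cbfD (cbfM (bG i i) (bG j j)) (cbfM (bG j i) (bG j i)).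
have bh : cbf (fun t => (h t)%:C%C) := cbf_real (b_psiX p).
have bh2 : cbf (fun t => (h t ^+ 2)%:C%C) := cbf_real (bmfX 2 (b_psiX p)).
pose err t := (h t ^+ 2)%:C%C * (G0 (X t) j i * (G0 (X t) j i - G (X t) j i) +
    G0 (X t) j j * (G0 (X t) i i - G (X t) i i)).
have berr : cbf err := cbfM bh2 (cbfD (cbfM (bG0 j i) (cbfB (bG0 j i) (bG j i)))
  (cbfM (bG0 j j) (cbfB (bG0 i i) (bG i i)))).
have bhG0 : cbf (fun t => (h t)%:C%C * G0 (X t) j i) := cbfM bh (bG0 j i).
have bhg0 : cbf (fun t => (h t ^+ 2)%:C%C * g0 (X t)) := cbfM bh2 bg0.
(* Expansion around [G0]: the first term has mean 0, the second yields the variance times the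
   expectation of [g0], and in [err] the factor [h^2] meets a difference of resolvents that is
   itself of order [k]. *)
have E1 t : emx psi (X t) i j * G (X t) j i =
    ((h t)%:C%C * G0 (X t) j i - (h t ^+ 2)%:C%C * g0 (X t)) + err t.
  have : G (X t) j i = G0 (X t) j i - (G0 (X t) j i - G (X t) j i) by ring.
  rewrite GG mxE -/p -/(h t) /err /g0 rmorphXn /= => e.
  rewrite {1}e; ring.
have F1 : Ec P (fun t => (h t)%:C%C * G0 (X t) j i) = 0.
  rewrite (Ec_indep (b_psi p) (bG0f j i)) => [|x y xy]; last by rewrite (G0p x y).
  by rewrite psi_mean // mul0r.
have F2 : Ec P (fun t => (h t ^+ 2)%:C%C * g0 (X t)) = v%:C%C * Ec P (fun t => g0 (X t)).
  rewrite (Ec_indep (bmfX 2 (b_psi p)) bgf) => [|x y xy]; last by rewrite /g0 (G0p x y).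
  by rewrite psi_var.
rewrite (eq_Ec P E1) (EcD P (cbfB bhG0 bhg0) berr) (EcB P bhG0 bhg0) F1 F2 sub0r -/g.
rewrite addrAC [- _ + _]addrC addrC -mulrBr -(EcB P bg bg0).
apply: le_trans (ler_cabsD _ _) _; rewrite cabsM cabs_real.
have [v0 vk] := andP v_bound; rewrite (ger0_norm v0).
have e1 : cabs (Ec P err) <= 2 * (4 * (k ^+ 3 * B ^+ 3)).
  apply: cabs_Ec_bound => // t; rewrite /err cabsM cabs_real.
  have h2 : `|h t ^+ 2| <= k ^+ 2 by rewrite normrX lerXn2r ?nnegrE //; exact: psi_bound.
  have -> : 4 * (k ^+ 3 * B ^+ 3) = k ^+ 2 * (B * (2 * (k * B ^+ 2)) + B * (2 * (k * B ^+ 2))) by ring.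
  rewrite ler_pM ?cabs_ge0 //; apply: le_trans (ler_cabsD _ _) _.
  by rewrite !cabsM lerD // ler_pM ?cabs_ge0 // cabsB.
have e2 : cabs (Ec P (fun t => g t - g0 (X t))) <= 2 * (8 * (k * B ^+ 3)).
  apply: cabs_Ec_bound => [|t]; first exact: cbfB bg bg0.
  have -> : g t - g0 (X t) =
    ((G (X t) i i - G0 (X t) i i) * G (X t) j j + G0 (X t) i i * (G (X t) j j - G0 (X t) j j)) +
    ((G (X t) j i - G0 (X t) j i) * G (X t) j i + G0 (X t) j i * (G (X t) j i - G0 (X t) j i)).
    by rewrite /g /g0; ring.
  have -> : 8 * (k * B ^+ 3) = (2 * (k * B ^+ 2) * B + B * (2 * (k * B ^+ 2))) +
     (2 * (k * B ^+ 2) * B + B * (2 * (k * B ^+ 2))) by ring.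
  have M1 p1 q : cabs p1 <= 2 * (k * B ^+ 2) -> cabs q <= B -> cabs (p1 * q) <= 2 * (k * B ^+ 2) * B.
    by move=> ? ?; rewrite cabsM ler_pM ?cabs_ge0.
  have M2 p1 q : cabs p1 <= B -> cabs q <= 2 * (k * B ^+ 2) -> cabs (p1 * q) <= B * (2 * (k * B ^+ 2)).
    by move=> ? ?; rewrite cabsM ler_pM ?cabs_ge0.
  apply: le_trans (ler_cabsD _ _) _; apply: lerD; apply: le_trans (ler_cabsD _ _) _; apply: lerD.
  - exact: M1 (GGB _ _ _) (GB _ _ _).
  - exact: M2 (G0B _ _ _) (GGB _ _ _).
  - exact: M1 (GGB _ _ _) (GB _ _ _).
  - exact: M2 (G0B _ _ _) (GGB _ _ _).
have e3 : v * cabs (Ec P (fun t => g t - g0 (X t))) <= k ^+ 2 * (2 * (8 * (k * B ^+ 3))).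
  by rewrite ler_pM ?cabs_ge0.
(* 24 = 8 + 16: the error term, and the return from [g0] to [g]. *)
apply: le_trans (lerD e1 e3) _; rewrite le_eqVlt; apply/orP; left; apply/eqP; ring.
Qed.

Let s (x : entries R n) := stieltjes (emx psi x) z.

(** Summed over all pairs, the products of matrix and resolvent entries give the trace [n + z tr G],
    and the products of diagonal resolvent entries give [(tr G)^2]. The sum [V] of the squared
    entries of [G] costs 2, and the diagonal pairs, where the matrix vanishes, cost 4 times
    [v B^2]. *)
Lemma self_consistent_square :
  cabs (Ec P (fun t => 1 + z * s (X t) + (n%:R * v)%:C%C * s (X t) ^+ 2))
    <= 24 * n%:R * k ^+ 3 * B ^+ 3 + 6 * v * B ^+ 2.
Proof.
have nn : (n%:R : R[i]) != 0 by rewrite pnatr_eq0 -lt0n.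
have nr : (0 : R) < n%:R by rewrite ltr0n.
have [v0 vk] := andP v_bound.
pose U i j t := emx psi (X t) i j * G (X t) j i +
  v%:C%C * (G (X t) i i * G (X t) j j + G (X t) j i * G (X t) j i).
pose V t := \sum_i \sum_j G (X t) j i * G (X t) j i.
have b_emx i j : cbf (fun t => emx psi (X t) i j).
  by under eq_fun do rewrite mxE; apply: cbf_real.
have bGG i j : cbf (fun t => G (X t) i i * G (X t) j j + G (X t) j i * G (X t) j i).
  by apply: cbfD; exact: cbfM.
have bvGG i j : cbf (fun t => v%:C%C * (G (X t) i i * G (X t) j j + G (X t) j i * G (X t) j i)).
  by apply: cbfM => //; exact: cbf_cst.
have bU i j : cbf (U i j) by apply: cbfD => //; exact: cbfM.
have bV : cbf V by apply: cbf_sum => i; apply: cbf_sum => j; exact: cbfM.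
have E t : 1 + z * s (X t) + (n%:R * v)%:C%C * s (X t) ^+ 2 =
    n%:R^-1 * (\sum_i \sum_j U i j t) - (n%:R^-1 * v%:C%C) * V t.
  have -> : \sum_i \sum_j U i j t =
      \tr (emx psi (X t) *m G (X t)) + v%:C%C * (\tr (G (X t)) ^+ 2) + v%:C%C * V t.
    rewrite /V expr2 /mxtrace mulr_suml !mulr_sumr -!big_split; apply: eq_bigr => i _ /=.
    rewrite mxE mulr_sumr mulr_sumr mulr_sumr -!big_split; apply: eq_bigr => j _ /=.
    by rewrite /U mulrDr addrA.
  have -> : \tr (emx psi (X t) *m G (X t)) = n%:R + z * \tr (G (X t)).
    have := congr1 mxtrace (resolvent_mulr (emx_hermitian psi (X t)) z0).
    rewrite mulmxBl mxtraceB mul_scalar_mx mxtraceZ mxtrace1 => /eqP.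
    by rewrite subr_eq => /eqP.
  rewrite /s /stieltjes -/(G _) rmorphM /= rmorph_nat; field.
  exact: nn.
rewrite (eq_Ec P E) EcB; last 2 first.
- apply: cbfM; first exact: cbf_cst.
  by apply: cbf_sum => i; exact: cbf_sum.
- by apply: cbfM => //; exact: cbf_cst.
rewrite !EcZ //; last by apply: cbf_sum => i; exact: cbf_sum.
rewrite Ec_sum; last by move=> i; exact: cbf_sum.
under eq_bigr do rewrite Ec_sum //.
apply: le_trans (ler_cabsB _ _) _; rewrite !cabsM cabsV cabs_nat cabs_real (ger0_norm v0).
have hV : cabs (Ec P V) <= 2 * (n%:R * B ^+ 2).
  apply: cabs_Ec_bound => // t; apply: le_trans (ler_cabs_sum _ _ _) _.
  rewrite -[n in leRHS]card_ord mulr_natl -sumr_const; apply: ler_sum => i _.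
  apply: le_trans (ler_cabs_sum _ _ _) _.
  under eq_bigr do rewrite cabsM -expr2.
  by apply: resolvent_col => //; exact: emx_hermitian.
have hU : cabs (\sum_i \sum_j Ec P (U i j)) <=
    n%:R * (n%:R * (24 * k ^+ 3 * B ^+ 3) + 4 * v * B ^+ 2).
  apply: le_trans (ler_cabs_sum _ _ _) _.
  rewrite -[X in X%:R * (_ + _)]card_ord mulr_natl -sumr_const; apply: ler_sum => i _.
  apply: le_trans (ler_cabs_sum _ _ _) _; rewrite (bigD1 i) //= addrC; apply: lerD.
    rewrite -[X in X%:R * _]card_ord mulr_natl -sumr_const [leRHS](bigD1 i) //=.
    apply: ler_wpDl; first by rewrite !mulr_ge0 ?exprn_ge0.
    apply: ler_sum => j ji; rewrite /U EcD ?EcZ //; last exact: cbfM.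
    by apply: pair_expectation; rewrite eq_sym.
  have -> : 4 * v * B ^+ 2 = 2 * (v * (B * B + B * B)) by ring.
  apply: cabs_Ec_bound => // t; rewrite /U mxE psi_diag; last by rewrite /upper; case: ifP.
  rewrite mul0r add0r cabsM cabs_real (ger0_norm v0) ler_wpM2l //.
  by apply: le_trans (ler_cabsD _ _) _; rewrite !cabsM lerD // ler_pM ?cabs_ge0.
have nv : 0 <= n%:R^-1 * v by rewrite mulr_ge0 // invr_ge0 ltW.
apply: le_trans (lerD (ler_wpM2l _ hU) (ler_wpM2l nv hV)) _; first by rewrite invr_ge0 ltW.
rewrite le_eqVlt; apply/orP; left; apply/eqP; field.
by rewrite gt_eqF.
Qed.

(** Replacing the expectation of [s^2] by the square of the expectation of [s] costs [n v] times the
    variance bound [128 B^2 / n]; 134 = 6 + 128 because [v] is at most [k^2]. *)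
Lemma self_consistent : forall m, m = Ec P (fun t => s (X t)) ->
  cabs (1 + z * m + (n%:R * v)%:C%C * m ^+ 2)
    <= 24 * n%:R * k ^+ 3 * B ^+ 3 + 134 * k ^+ 2 * B ^+ 2.
Proof.
move=> m mE; have nr : (0 : R) < n%:R by rewrite ltr0n.
have [v0 vk] := andP v_bound.
have bs : cbf (fun t => s (X t)) := cbf_family (cbf_stieltjes mpsi z0).
have bs2 : cbf (fun t => s (X t) ^+ 2) by under eq_fun do rewrite expr2; exact: cbfM.
have bc (a : R[i]) : cbf (fun _ : T => a) := cbf_cst _ a.
have := self_consistent_square; rewrite EcD; [|by apply: cbfD => //; exact: cbfM|exact: cbfM].
rewrite EcD //; last exact: cbfM.
rewrite Ec_cst (EcZ P z bs) (EcZ P (n%:R * v)%:C%C bs2) => h.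
have {}h : cabs (1 + z * m + (n%:R * v)%:C%C * Ec P (fun t => s (X t) ^+ 2)) <=
    24 * n%:R * k ^+ 3 * B ^+ 3 + 6 * v * B ^+ 2 by rewrite mE.
have -> : 1 + z * m + (n%:R * v)%:C%C * m ^+ 2 =
  (1 + z * m + (n%:R * v)%:C%C * Ec P (fun t => s (X t) ^+ 2)) -
  (n%:R * v)%:C%C * (Ec P (fun t => s (X t) ^+ 2) - m ^+ 2) by ring.
apply: le_trans (ler_cabsB _ _) _; rewrite cabsM cabs_real ger0_norm ?mulr_ge0 // ?(ltW nr) //.
have nv : 0 <= n%:R * v by rewrite mulr_ge0 ?(ltW nr).
apply: le_trans (lerD h (ler_wpM2l nv _)) _.
  by rewrite mE; exact: stieltjes_variance mpsi.
have -> : n%:R * v * (128 * eta^-1 ^+ 2 * n%:R^-1) = 128 * v * B ^+ 2.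
  by rewrite /B; field; rewrite !gt_eqF.
have : v * B ^+ 2 <= k ^+ 2 * B ^+ 2 by rewrite ler_wpM2r ?exprn_ge0.
rewrite -addrA lerD2l => h3.
have -> : 6 * v * B ^+ 2 + 128 * v * B ^+ 2 = 134 * (v * B ^+ 2) by ring.
by rewrite -mulrA ler_wpM2l.
Qed.

End SelfConsistent.
End IndependentEntries.

(** * Positive imaginary parts and stability of the quadratic equation *)

Section Stability.
Context {R : rcfType} (n : nat) (H : 'M[R[i]]_n) (z : R[i]).
Hypothesis Hh : hermitian H.
Hypothesis z0 : 0 < complex.Im z.

(** [G = G^* H G - conj(z) G^* G]: the first matrix is hermitian and has a real diagonal, the second
    contributes [Im z] times the squared norm of a column. *)
Lemma resolvent_Im_ge0 i : 0 <= complex.Im (resolvent H z i i).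
Proof.
set G := resolvent H z; have e : G = G ^t* *m H *m G - Num.conj z *: (G ^t* *m G).
  have : G ^t* *m (H - z%:M) ^t* = 1%:M by rewrite -adjmxM resolvent_mulr // tr_scalar_mx map_scalar_mx rmorph1.
  rewrite adjmxB Hh => e; rewrite -{1}[G]mul1mx -e mulmxBr mulmxBl; congr (_ - _).
  by rewrite tr_scalar_mx map_scalar_mx mul_mx_scalar -scalemxAl.
have Kh : (G ^t* *m H *m G) ^t* = G ^t* *m H *m G.
  by rewrite !adjmxM Hh mulmxA; congr (_ *m _ *m _); apply/matrixP => a b; rewrite !mxE conjCK.
have /matrixP/(_ i i) := e; rewrite mxE [X in _ + X]mxE [X in - X]mxE => ->.
rewrite cImD.
have -> : complex.Im ((G ^t* *m H *m G) i i) = 0.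
  have /matrixP/(_ i i) := Kh; rewrite mxE mxE => /(congr1 (@complex.Im R)).
  by rewrite cImJ => h; lra.
have -> : (G ^t* *m G) i i = (\sum_a cabs (G a i) ^+ 2)%:C%C.
  rewrite mxE rmorph_sum; apply: eq_bigr => a _; rewrite /= cabs_conj !mxE mulrC.
  by [].
rewrite add0r -mulNr cImMr mulr_ge0 //; last by apply: sumr_ge0 => a _; exact: sqr_ge0.
by case: (z) z0 => x y /= /ltW; rewrite opprK.
Qed.

Lemma stieltjes_Im_ge0 : 0 <= complex.Im (stieltjes H z).
Proof.
rewrite /stieltjes mulrC (_ : n%:R^-1 = (n%:R^-1)%:C%C); last by rewrite fmorphV rmorph_nat.
rewrite cImMr mulr_ge0 ?invr_ge0 // /mxtrace cIm_sum.
by apply: sumr_ge0 => i _; exact: resolvent_Im_ge0.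
Qed.

(** As the polynomial vanishes at [m], its value at [s] factors as [(s - m) (s + z + m)], and the
    second factor has imaginary part at least [Im z]. *)
Lemma semicircle_stability (s m : R[i]) : 0 <= complex.Im s -> 0 < complex.Im m ->
  m ^+ 2 + z * m + 1 = 0 -> cabs (s - m) <= (complex.Im z)^-1 * cabs (1 + z * s + s ^+ 2).
Proof.
move=> s0 m0 mE; have -> : 1 + z * s + s ^+ 2 = (s - m) * (s + z + m).
  transitivity ((1 + z * s + s ^+ 2) - (m ^+ 2 + z * m + 1)); first by rewrite mE subr0.
  by ring.
rewrite ler_pdivlMl // cabsM mulrC; apply: ler_wpM2l; first exact: cabs_ge0.
apply: le_trans (ler_Im_cabs _); apply: le_trans (ler_norm _); rewrite !cImD; lra.
Qed.

End Stability.

(** * Equality in law, dominated convergence and truncation *)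

Section Laws.
Context {R : realType}.

Definition L1 d (T : measurableType d) (P : probability T R) (f : T -> R) : Prop :=
  P.-integrable setT (EFin \o f).

Lemma same_law_Ex d (T : measurableType d) (P : probability T R)
    d1 (T1 : measurableType d1) (P1 : probability T1 R) (X : T -> R) (Y : T1 -> R) (g : R -> R) :
  measurable_fun setT X -> measurable_fun setT Y -> measurable_fun setT g ->
  same_law P P1 X Y -> L1 P1 (fun t => g (Y t)) ->
  L1 P (fun t => g (X t)) /\ Ex P (fun t => g (X t)) = Ex P1 (fun t => g (Y t)).
Proof.
move=> mX mY mg XY gY.
have mG : measurable_fun setT (fun x : R => (g x)%:E) by exact/measurable_EFinP.
have E (h : R -> \bar R) : measurable_fun setT h -> (forall x, 0 <= h x)%E ->
    (\int[P]_t h (X t) = \int[P1]_t h (Y t))%E.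
  move=> mh h0.
  have E1 := ge0_integral_pushforward mX P measurableT mh (fun x _ => h0 x).
  have E2 := ge0_integral_pushforward mY P1 measurableT mh (fun x _ => h0 x).
  rewrite -[LHS]/(\int[P]_(x in X @^-1` setT) (h \o X) x)%E -E1.
  rewrite -[RHS]/(\int[P1]_(x in Y @^-1` setT) (h \o Y) x)%E -E2.
  by apply: eq_measure_integral => C mC _; exact: XY.
have mgX : measurable_fun setT (fun t => (g (X t))%:E) by exact: measurableT_comp mG mX.
have gX : L1 P (fun t => g (X t)).
  have /integrableP[_ fin] := gY.
  apply/integrableP; split; first exact: mgX.
  by rewrite (E (fun x => `|(g x)%:E|%E)) //; exact: measurableT_comp.
split=> //; rewrite /Ex /Rintegral; congr fine.
have E1 := @integral_pushforward _ _ _ _ R X mX P setT (fun x => (g x)%:E) mG.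
have E2 := @integral_pushforward _ _ _ _ R Y mY P1 setT (fun x => (g x)%:E) mG.
rewrite !preimage_setT in E1 E2.
transitivity (\int[pushforward P X]_y (g y)%:E)%E; first exact/esym/E1.
transitivity (\int[pushforward P1 Y]_y (g y)%:E)%E; last exact: E2.
by apply: eq_measure_integral => C mC _; exact: XY.
Qed.

Lemma dominated_Ex d (T : measurableType d) (P : probability T R) (F : nat -> T -> R)
    (f g : T -> R) : (forall k, measurable_fun setT (F k)) -> L1 P f ->
  L1 P g -> (forall k t, `|F k t| <= g t) ->
  (forall t, F k t @[k --> \oo] --> f t) -> Ex P (F k) @[k --> \oo] --> Ex P f.
Proof.
move=> mF If Ig Fg Ff; apply: fine_cvg; rewrite fineK; last exact: integrable_fin_num.
apply: (dominated_cvg measurableT _ _ _ Ig) => //.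
- by move=> k; apply/measurable_EFinP.
- by move=> t _; apply/fine_cvgP; split; [exact: nearW | exact: Ff].
- by move=> k t _; rewrite lee_fin.
Qed.

Definition trunc (k y : R) : R := if `|y| <= k then y else 0.

Lemma measurable_trunc k : measurable_fun setT (trunc k).
Proof.
apply: measurable_fun_ifT => //.
by apply: measurable_fun_ler => //; exact: measurableT_comp.
Qed.

Lemma trunc_le k y : `|trunc k y| <= `|y|.
Proof. by rewrite /trunc; case: ifP => // _; rewrite normr0. Qed.

Lemma trunc_bound k y : 0 <= k -> `|trunc k y| <= k.
Proof. by rewrite /trunc => k0; case: ifP => // _; rewrite normr0. Qed.

Lemma trunc_sub_le k y : `|y - trunc k y| <= `|y|.
Proof. by rewrite /trunc; case: ifP => _; rewrite ?subr0 // subrr normr0. Qed.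

Lemma near_trunc y : \forall k \near \oo, trunc k%:R y = y.
Proof.
exists (Num.truncn `|y|).+1 => // k /= h; rewrite /trunc ifT //; apply: ltW.
by apply: lt_le_trans (truncnS_gt _) _; rewrite ler_nat.
Qed.

Lemma trunc_cvg (h : R -> R -> R) y : h (trunc k%:R y) y @[k --> \oo] --> h y y.
Proof.
apply: cvg_near_cst; near=> k; congr (h _ y); near: k; exact: near_trunc.
Unshelve. all: by end_near. Qed.

End Laws.

(** * Truncation of the atom variables *)

Section Atoms.
Context {R : realType} d1 (T1 : measurableType d1) (P1 : probability T1 R) (xi : T1 -> R).
Hypothesis mxi : measurable_fun setT xi.
Hypothesis xi_var : 'V_P1[xi] = 1%E.

(** [fine] would send an infinite expectation to 0. Unit variance makes [u] square integrable, hence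
    [xi] integrable, and only then is [a] known to be its mean. *)
Let a : R := fine 'E_P1[xi].
Let u t : R := xi t - a.

Let mu : measurable_fun setT u.
Proof. exact: measurable_funB. Qed.

Let u2 : (\int[P1]_t (u t ^+ 2)%:E = 1)%E.
Proof.
rewrite -xi_var /variance unlock unlock; apply: eq_integral => t _.
by rewrite /u /a unlock expr2.
Qed.

Let I2 : L1 P1 (fun t => u t ^+ 2).
Proof.
apply/integrableP; split; first by apply/measurable_EFinP; exact: measurable_funX.
have -> : (\int[P1]_t `|(EFin \o (fun t => u t ^+ 2)%R) t| = \int[P1]_t (u t ^+ 2)%:E)%E.
  by apply: eq_integral => t _; rewrite /= ger0_norm ?sqr_ge0.
by rewrite u2 ltry.
Qed.

Let Ic c : L1 P1 (fun=> c). Proof. exact: bmf_integrable (bmf_cst _ c). Qed.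

Let I1 : L1 P1 (fun t => `|u t|).
Proof.
have I3 : L1 P1 (fun t => 1 + u t ^+ 2).
  exact: (integrableD measurableT (Ic 1) I2).
apply: (le_integrable _ _ _ I3) => //; first by apply/measurable_EFinP; exact: measurableT_comp.
move=> t _; rewrite /= lee_fin normr_id [leRHS]ger0_norm ?addr_ge0 ?sqr_ge0 //.
by rewrite -[u t ^+ 2]real_normK ?num_real //; have := sqr_ge0 (`|u t| - 1); nra.
Qed.

Let I1' : L1 P1 u.
Proof.
by apply: (le_integrable _ _ _ I1) => //; [exact/measurable_EFinP | move=> t _; rewrite /= normr_id].
Qed.

Let u_mean : Ex P1 u = 0.
Proof.
have Ixi : L1 P1 xi.
  have -> : xi = fun t => u t + a by apply/funext => t; rewrite /u subrK.
  exact: (integrableD measurableT I1' (Ic a)).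
have -> : Ex P1 u = Ex P1 xi - Ex P1 (fun=> a) by exact (RintegralB measurableT Ixi (Ic a)).
by rewrite Ex_cst /a unlock subrr.
Qed.

(** Dominated convergence, with [|u|] for the mean and [u^2] for the second moments. *)
Lemma centered_trunc_cvg :
  [/\ Ex P1 (fun t => trunc k%:R (u t)) @[k --> \oo] --> (0 : R),
     Ex P1 (fun t => trunc k%:R (u t) ^+ 2) @[k --> \oo] --> (1 : R),
     Ex P1 (fun t => (u t - trunc k%:R (u t)) ^+ 2) @[k --> \oo] --> (0 : R) &
     forall k, L1 P1 (fun t => (u t - trunc k%:R (u t)) ^+ 2)].
Proof.
have mt k : measurable_fun setT (fun t => trunc k%:R (u t)).
  exact: measurableT_comp (measurable_trunc _) mu.
have m2 k : measurable_fun setT (fun t => (u t - trunc k%:R (u t)) ^+ 2).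
  by apply: measurable_funX; exact: measurable_funB.
have le2 (x y : R) : `|x| <= `|y| -> `|x ^+ 2| <= y ^+ 2.
  by move=> h; rewrite normrX -[leRHS]real_normK ?num_real // lerXn2r ?nnegrE.
split.
- rewrite -u_mean; apply: (dominated_Ex mt I1' I1) => [k t|t]; first exact: trunc_le.
  exact (@trunc_cvg R (fun x _ => x) (u t)).
- rewrite [X in _ --> X](_ : _ = Ex P1 (fun t => u t ^+ 2)); last by rewrite /Ex /Rintegral u2.
  apply: (dominated_Ex _ I2 I2) => [k|k t|t]; first exact: measurable_funX.
    by apply: le2; exact: trunc_le.
  exact (@trunc_cvg R (fun x _ => x ^+ 2) (u t)).
- rewrite -[X in _ --> X](Ex_cst P1 0).
  apply: (dominated_Ex m2 (Ic 0) I2) => [k t|t].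
    by apply: le2; exact: trunc_sub_le.
  have := @trunc_cvg R (fun x y => (y - x) ^+ 2) (u t).
  by rewrite subrr expr0n.
- move=> k; apply: (le_integrable _ _ _ I2) => //; first exact/measurable_EFinP.
  move=> t _; rewrite /= lee_fin [leRHS]ger0_norm ?sqr_ge0 //.
  by apply: le2; exact: trunc_sub_le.
Qed.

End Atoms.

(** The expected proportion of diagonal entries above the truncation level. It tends to 0 for every
    law, and these entries are then removed as a perturbation of small rank. *)
Lemma tail_cvg (R : realType) d2 (T2 : measurableType d2) (P2 : probability T2 R) (zeta : T2 -> R)
    (a : R) : measurable_fun setT zeta ->
  Ex P2 (fun t => if k%:R < `|zeta t - a| then 1 else 0) @[k --> \oo] --> (0 : R).
Proof.
move=> mz; rewrite -[X in _ --> X](Ex_cst P2 0).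
apply: (dominated_Ex (g := fun=> 1)).
- move=> k; apply: measurable_fun_ifT => //; apply: measurable_fun_ltr => //.
  by apply: measurableT_comp => //; exact: measurable_funB.
- exact: bmf_integrable (bmf_cst _ 0).
- exact: bmf_integrable (bmf_cst _ 1).
- by move=> k t; case: (_ < _); rewrite ?normr1 ?normr0.
- move=> t; apply: cvg_near_cst; exists (Num.truncn `|zeta t - a|).+1 => // k /= h.
  rewrite ltNge (_ : _ <= _) //; apply: ltW.
  by apply: lt_le_trans (truncnS_gt _) _; rewrite ler_nat.
Qed.

(** * Expectations of integrable, possibly unbounded functions *)

Section L1Expectation.
Context {R : realType} d (T : measurableType d) (P : probability T R).
Implicit Types f g : T -> R.

Lemma bmf_L1 f : bmf f -> L1 P f.
Proof. exact: bmf_integrable. Qed.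

Lemma L1D f g : L1 P f -> L1 P g -> L1 P (fun t => f t + g t).
Proof. by move=> If Ig; exact: (integrableD measurableT If Ig). Qed.

Lemma L1Z c f : L1 P f -> L1 P (fun t => c * f t).
Proof. by move=> If; exact: (integrableZl measurableT c If). Qed.

Lemma L1_sum (J : Type) (r : seq J) (F : J -> T -> R) :
  (forall j, L1 P (F j)) -> L1 P (fun t => \sum_(j <- r) F j t).
Proof.
move=> bF; elim: r => [|j r IH].
  by under eq_fun do rewrite big_nil; exact: bmf_L1 (bmf_cst _ 0).
by under eq_fun do rewrite big_cons; exact: L1D.
Qed.

Lemma Ex_L1D f g : L1 P f -> L1 P g -> Ex P (fun t => f t + g t) = Ex P f + Ex P g.
Proof. by move=> If Ig; rewrite /Ex RintegralD. Qed.

Lemma Ex_L1Z c f : L1 P f -> Ex P (fun t => c * f t) = c * Ex P f.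
Proof. by move=> If; rewrite /Ex RintegralZl. Qed.

Lemma Ex_L1_sum (J : Type) (r : seq J) (F : J -> T -> R) : (forall j, L1 P (F j)) ->
  Ex P (fun t => \sum_(j <- r) F j t) = \sum_(j <- r) Ex P (F j).
Proof.
move=> bF; elim: r => [|j r IH].
  by under [in LHS]eq_fun do rewrite big_nil; rewrite big_nil Ex_cst.
under [in LHS]eq_fun do rewrite big_cons.
by rewrite big_cons Ex_L1D ?IH //; exact: L1_sum.
Qed.

End L1Expectation.

(** * Truncation of a matrix: rank and Frobenius estimates *)

Section Truncation.
Context {R : realType} (n : nat) (x : entries R n) (r a k c : R).
Hypothesis n0 : (0 < n)%N.
Hypothesis k0 : 0 <= k.

Definition scale_entry (p : 'I_n * 'I_n) (y : R) : R := r * y.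

(** The intermediate matrix, to be compared with [scale_entry] through the rank and with
    [trunc_entry] through the Frobenius norm. *)
Definition center_entry (p : 'I_n * 'I_n) (y : R) : R :=
  r * (if p.1 == p.2 then trunc k (y - a) else y - a).

Definition trunc_entry (p : 'I_n * 'I_n) (y : R) : R :=
  if p.1 == p.2 then 0 else r * (trunc k (y - a) - c).

Lemma upper_diag i j : ((upper i j).1 == (upper i j).2 :> 'I_n) = (i == j).
Proof. by rewrite /upper; case: ifP => //= _; rewrite eq_sym. Qed.

Lemma rank_diag_le (e : 'rV[R[i]]_n) :
  (\rank (diag_mx e) <= \sum_i (e 0 i != 0)%R)%N.
Proof.
rewrite diag_mx_sum_delta; elim/big_rec2: _ => [|i m A _ IH]; first by rewrite mxrank0.
apply: leq_trans (mxrank_add _ _) _; apply: leq_add => //.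
have [->|e0] := eqVneq (e 0 i) 0; first by rewrite scale0r mxrank0.
by apply: leq_trans (mxrank_scale _ _) _; rewrite mxrank_delta.
Qed.

(** The difference is a constant matrix, of rank at most one, plus a diagonal matrix that is nonzero
    only where the truncation acts. *)
Lemma rank_center :
  (\rank (emx center_entry x - emx scale_entry x))%:R <=
  1 + \sum_i (if k < `|x (upper i i) - a| then 1 else 0) :> R.
Proof.
pose e : 'rV[R[i]]_n :=
  \row_i (r * (trunc k (x (upper i i) - a) - (x (upper i i) - a)))%:C%C.
have -> : emx center_entry x - emx scale_entry x = const_mx (- (r * a)%:C%C) + diag_mx e.
  apply/matrixP => i j; rewrite !mxE /center_entry /scale_entry upper_diag.
  case: eqP => [->|_]; rewrite ?mulr1n ?mulr0n ?addr0 -!rmorphN /= -!rmorphD /=; congr (_%:C)%C; ring.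
have le1 : (\rank (const_mx (- (r * a)%:C%C) + diag_mx e)%R <= 1 + \sum_i (e 0 i != 0)%R)%N.
  apply: leq_trans (mxrank_add _ _) _; apply: leq_add; last exact: rank_diag_le.
  have -> : const_mx (- (r * a)%:C%C) =
      (const_mx (- (r * a)%:C%C) : 'cV[R[i]]_n) *m (const_mx 1 : 'rV[R[i]]_n).
    by apply/matrixP => i j; rewrite !mxE big_ord1 !mxE mulr1.
  exact: leq_trans (mxrankM_maxr _ _) (rank_leq_row _).
apply: (@le_trans _ _ (1 + \sum_i (e 0 i != 0)%R)%N%:R); first by rewrite ler_nat.
rewrite natrD lerD2l natr_sum; apply: ler_sum => i _.
rewrite mxE /trunc; case: leP => [_|_]; first by rewrite subrr mulr0 eqxx.
by case: (_ != _).
Qed.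

(** The diagonal is already cut at level [k], so setting it to 0 costs at most [k^2] in total; off
    the diagonal the change is the part cut off plus the recentring constant. *)
Lemma fro2_trunc : r ^+ 2 = n%:R^-1 ->
  fro2 (emx trunc_entry x - emx center_entry x) <= n%:R^-1 *
  \sum_i \sum_j (if i == j then k ^+ 2 else
    2 * ((x (upper i j) - a - trunc k (x (upper i j) - a)) ^+ 2 + c ^+ 2)).
Proof.
move=> rn; rewrite /fro2 mulr_sumr; apply: ler_sum => i _; rewrite mulr_sumr; apply: ler_sum => j _.
rewrite !mxE -!rmorphN /= -!rmorphD /= cabs_real real_normK ?num_real // /trunc_entry /center_entry upper_diag -rn.
case: eqP => _.
  rewrite sub0r sqrrN exprMn ler_wpM2l ?sqr_ge0 //.
  by rewrite -[leLHS]real_normK ?num_real // lerXn2r ?nnegrE // trunc_bound.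
rewrite -mulrBr exprMn ler_wpM2l ?sqr_ge0 //.
set y := x _ - a; set w := trunc k y.
have -> : w - c - y = - ((y - w) + c) by ring.
by rewrite sqrrN; have := sqr_ge0 ((y - w) - c); nra.
Qed.

End Truncation.

(** * The approximate equation for the expected Stieltjes transform *)

Section MeanEquation.
Context {R : realType} d (T : measurableType d) (P : probability T R).
Context d1 (T1 : measurableType d1) (P1 : probability T1 R) (xi : T1 -> R).
Context d2 (T2 : measurableType d2) (P2 : probability T2 R) (zeta : T2 -> R).
Hypothesis mxi : measurable_fun setT xi.
Hypothesis mzeta : measurable_fun setT zeta.
Variables (a : R).
Let u t : R := xi t - a.
(** At level [k]: [cc] and [vv] are the mean and the variance of the truncated variable, [qq] is the
    second moment that the truncation removes, and [pp] the probability that it acts on a diagonal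
    entry. *)
Let cc (k : nat) : R := Ex P1 (fun t => trunc k%:R (u t)).
Let vv (k : nat) : R := Ex P1 (fun t => trunc k%:R (u t) ^+ 2) - cc k ^+ 2.
Let qq (k : nat) : R := Ex P1 (fun t => (u t - trunc k%:R (u t)) ^+ 2).
Let pp (k : nat) : R := Ex P2 (fun t => if k%:R < `|zeta t - a| then 1 else 0).
Hypothesis tailL : forall k, L1 P1 (fun t => (u t - trunc k%:R (u t)) ^+ 2).

Section FixedSize.
Context (n : nat) (X : T -> 'I_n * 'I_n -> R).
Hypothesis n0 : (0 < n)%N.
Hypothesis mX : forall i, measurable_fun setT (fun t => X t i).
Hypothesis indepX : forall B : 'I_n * 'I_n -> set R, (forall i, measurable (B i)) ->
  P [set t | forall i, B i (X t i)] = (\prod_i P ((fun t => X t i) @^-1` B i))%E.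
Hypothesis law_off : forall p : 'I_n * 'I_n, (p.1 < p.2)%N -> same_law P P1 (fun t => X t p) xi.
Hypothesis law_diag : forall p : 'I_n * 'I_n, p.1 = p.2 -> same_law P P2 (fun t => X t p) zeta.
Variable z : R[i].
Hypothesis z0 : 0 < complex.Im z.
Let B := (complex.Im z)^-1.
Let r : R := (Num.sqrt n%:R)^-1.
Let s t := stieltjes (emx (scale_entry r) (X t)) z.
Let B0 : 0 <= B. Proof. by rewrite invr_ge0 ltW. Qed.

Let r2 : r ^+ 2 = n%:R^-1.
Proof. by rewrite /r exprVn sqr_sqrtr. Qed.

Let nr : (0 : R) < n%:R. Proof. by rewrite ltr0n. Qed.

Let m_scale p : measurable_fun setT (scale_entry (n := n) r p).
Proof. by apply: measurable_funM => //; exact: measurable_cst. Qed.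

Let m_sub : measurable_fun setT (fun y : R => y - a).
Proof. by apply: measurable_funB => //; exact: measurable_cst. Qed.

Let m_trunc (k : R) : measurable_fun setT (fun y : R => trunc k (y - a)).
Proof. exact: measurableT_comp (measurable_trunc k) m_sub. Qed.

Let m_center k p : measurable_fun setT (center_entry (n := n) r a k p).
Proof.
rewrite /center_entry; apply: measurable_funM; first exact: measurable_cst.
by case: (p.1 == p.2).
Qed.

Let m_truncE k c p : measurable_fun setT (trunc_entry (n := n) r a k c p).
Proof.
rewrite /trunc_entry; case: (p.1 == p.2); first exact: measurable_cst.
apply: measurable_funM; first exact: measurable_cst.
by apply: measurable_funB => //; exact: measurable_cst.
Qed.

Let cc_le k : `|cc k| <= k%:R.
Proof.
apply: Ex_bound => [|t]; last exact: trunc_bound.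
split; last by exists k%:R => t; exact: trunc_bound.
apply: measurableT_comp (measurable_trunc _) _.
by apply: measurable_funB => //; exact: measurable_cst.
Qed.

Let b_tr (k : nat) : bmf (fun y : R => trunc k%:R (y - a)).
Proof. by split; [exact: m_trunc | exists k%:R => t; exact: trunc_bound]. Qed.

Let trunc_stieltjes k t := stieltjes (emx (trunc_entry r a k%:R (cc k)) (X t)) z.

(** The comparison passes through [center_entry]. On average [n pp] diagonal entries exceed the
    level, and going from a pointwise bound to [Ec] doubles it. *)
Lemma mean_trunc (k : nat) (al : R) : 0 < al ->
  cabs (Ec P s - Ec P (trunc_stieltjes k)) <=
  4 * B * (n%:R^-1 + pp k) +
  (al * B ^+ 4 + al^-1 * (k%:R ^+ 2 * n%:R^-1 + 2 * (qq k + cc k ^+ 2))).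
Proof.
move=> al0.
pose N t := \sum_i (if k%:R < `|X t (upper i i) - a| then 1 else 0) : R.
pose F i j t : R := if i == j then k%:R ^+ 2 else
    2 * ((X t (upper i j) - a - trunc k%:R (X t (upper i j) - a)) ^+ 2 + cc k ^+ 2).
pose h t := 2 * B * (n%:R^-1 * (1 + N t)) +
  (al * B ^+ 4 + al^-1 * (n%:R^-1 * (n%:R^-1 * \sum_i \sum_j F i j t))) / 2.
have up i j : i != j -> ((upper i j : 'I_n * 'I_n).1 < (upper i j).2)%N.
  move=> ij; rewrite /upper; case: (leqP i j) => //= le; rewrite ltn_neqAle le andbT.
  by apply: contraNneq ij => /ord_inj ->.
have m2 : measurable_fun setT (fun y : R => (y - a - trunc k%:R (y - a)) ^+ 2).
  by apply: measurable_funX; apply: measurable_funB => //; exact: m_trunc.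
have LF i j : L1 P (F i j) /\ Ex P (F i j) <= (if i == j then k%:R ^+ 2 else 0) + 2 * (qq k + cc k ^+ 2).
  have q0 : 0 <= 2 * (qq k + cc k ^+ 2).
    by rewrite mulr_ge0 // addr_ge0 ?sqr_ge0 //; apply: Ex_ge0 => t; exact: sqr_ge0.
  rewrite /F; have [ij|ij] := eqVneq i j.
    by split; [exact: bmf_L1 (bmf_cst _ _) | rewrite Ex_cst lerDl].
  have [L E] := same_law_Ex (mX _) mxi m2 (law_off (up i j ij)) (tailL k).
  have Lc : L1 P (fun=> cc k ^+ 2) := bmf_L1 P (bmf_cst _ _).
  split; first exact: L1Z (L1D L Lc).
  by rewrite add0r Ex_L1Z ?Ex_L1D ?Ex_cst ?E //; exact: L1D.
have mI : measurable_fun setT (fun y : R => if k%:R < `|y - a| then 1 else 0 : R).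
  by apply: measurable_fun_ifT => //; apply: measurable_fun_ltr => //; exact: measurableT_comp.
have bI : bmf (fun y : R => if k%:R < `|y - a| then 1 else 0 : R).
  by split=> //; exists 1 => y; case: ifP => _; rewrite ?normr1 ?normr0.
have bN : bmf N by apply: bmf_sum => i; exact: (bmf_comp (mX (upper i i)) bI).
have EN : Ex P N = n%:R * pp k.
  rewrite Ex_sum; last by move=> i; exact: (bmf_comp (mX (upper i i)) bI).
  rewrite -[X in X%:R * _]card_ord mulr_natl -sumr_const; apply: eq_bigr => i _.
  have ui : (upper i i).1 = (upper i i).2 by apply/eqP; rewrite upper_diag.
  have [_ ->] := same_law_Ex (mX _) mzeta mI (law_diag ui) (bmf_L1 P2 (bmf_comp mzeta bI)).
  by [].
have LS : L1 P (fun t => \sum_i \sum_j F i j t).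
  by apply: L1_sum => i; apply: L1_sum => j; exact: (LF i j).1.
have LN : L1 P (fun t => 2 * B * (n%:R^-1 * (1 + N t))).
  by apply/L1Z/L1Z/L1D; apply: bmf_L1 => //; exact: bmf_cst.
have LS2 : L1 P (fun t => al^-1 * (n%:R^-1 * (n%:R^-1 * \sum_i \sum_j F i j t))).
  exact/L1Z/L1Z/L1Z.
have LA : L1 P (fun=> al * B ^+ 4) := bmf_L1 P (bmf_cst _ _).
have Lh : L1 P h.
  apply: L1D => //; under eq_fun do rewrite mulrC.
  exact/L1Z/L1D.
have bs : cbf s by apply: (cbf_family mX (f := fun x => stieltjes (emx (scale_entry r) x) z)); exact: cbf_stieltjes.
have bt : cbf (trunc_stieltjes k).
  by apply: (cbf_family mX (f := fun x => stieltjes (emx (trunc_entry r a k%:R (cc k)) x) z)); exact: cbf_stieltjes.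
rewrite -EcB //; apply: (@le_trans _ _ (2 * Ex P h)).
  apply: cabs_Ec_le => // [|t]; first exact: cbfB.
  rewrite -[_ - _](subrKA (stieltjes (emx (center_entry r a k%:R) (X t)) z)).
  apply: le_trans (ler_cabsD _ _) _; apply: lerD.
    apply: le_trans (stieltjes_sub_rank (emx_hermitian _ _) (emx_hermitian _ _) z0 n0) _.
    rewrite ler_wpM2l ?mulr_ge0 // ler_wpM2l ?invr_ge0 ?(ltW nr) //; exact: rank_center.
  apply: le_trans (stieltjes_sub_fro2 (emx_hermitian _ _) (emx_hermitian _ _) z0 n0 al0) _.
  rewrite ler_pM2r ?invr_gt0 // lerD2l ler_wpM2l ?invr_ge0 ?(ltW al0) //.
  rewrite ler_wpM2l ?invr_ge0 ?(ltW nr) //; exact: fro2_trunc.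
rewrite /h Ex_L1D //; last by under eq_fun do rewrite mulrC; exact/L1Z/L1D.
under [X in _ + X]eq_Ex do rewrite mulrC.
rewrite (Ex_L1Z _ (L1D LA LS2)) (Ex_L1D LA LS2) Ex_cst.
have L1N : L1 P (fun t => 1 + N t) by apply: L1D; apply: bmf_L1 => //; exact: bmf_cst.
rewrite (Ex_L1Z _ (L1Z _ L1N)) (Ex_L1Z _ L1N) Ex_L1D; last 2 first.
- exact: bmf_L1 (bmf_cst _ _).
- exact: bmf_L1.
rewrite Ex_cst EN (Ex_L1Z _ (L1Z _ (L1Z _ LS))) (Ex_L1Z _ (L1Z _ LS)) (Ex_L1Z _ LS).
have ES : Ex P (fun t => \sum_i \sum_j F i j t) <=
    n%:R * k%:R ^+ 2 + n%:R * (n%:R * (2 * (qq k + cc k ^+ 2))).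
  rewrite Ex_L1_sum; last by move=> i; apply: L1_sum => j; exact: (LF i j).1.
  rewrite -mulrDr -[X in X%:R * (_ + _)]card_ord mulr_natl -sumr_const; apply: ler_sum => i _.
  rewrite Ex_L1_sum; last by move=> j; exact: (LF i j).1.
  apply: le_trans (ler_sum _ (fun j _ => (LF i j).2)) _; rewrite big_split /=; apply: lerD.
    by rewrite (bigD1 i) //= eqxx big1 ?addr0 // => j ji; rewrite eq_sym (negbTE ji).
  by rewrite sumr_const card_ord [n%:R * _]mulr_natl.
have h1 : n%:R^-1 * (n%:R^-1 * Ex P (fun t => \sum_i \sum_j F i j t)) <=
    k%:R ^+ 2 * n%:R^-1 + 2 * (qq k + cc k ^+ 2).
  rewrite ler_pdivrMl // ler_pdivrMl //; apply: le_trans ES _; rewrite le_eqVlt; apply/orP; left; apply/eqP.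
  by field; rewrite gt_eqF.
have al1 : 0 <= al^-1 by rewrite invr_ge0 ltW.
have h2 := ler_wpM2l al1 h1.
have -> : 2 * B * (n%:R^-1 * (1 + n%:R * pp k)) = 2 * B * (n%:R^-1 + pp k).
  by field; rewrite gt_eqF.
have -> : 4 * B * (n%:R^-1 + pp k) = 2 * (2 * B * (n%:R^-1 + pp k)) by ring.
by rewrite [2 * (_ + _)]mulrDr [2 * (2^-1 * _)]mulrA divff // mul1r lerD2l lerD2l.
Qed.

(** Off the diagonal the truncated entries are bounded by [2 k r] and have variance [r^2 vv]. Since
    [n r^2 = 1], the coefficient of the square is [vv] and the error is O(r) at fixed [k]. *)
Lemma trunc_equation (k : nat) (m : R[i]) : m = Ec P (trunc_stieltjes k) ->
  cabs (1 + z * m + (vv k)%:C%C * m ^+ 2) <=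
  24 * n%:R * (2 * k%:R * r) ^+ 3 * B ^+ 3 + 134 * (2 * k%:R * r) ^+ 2 * B ^+ 2.
Proof.
move=> ->; have r0 : 0 <= r by rewrite invr_ge0 sqrtr_ge0.
have btu : bmf (fun t => trunc k%:R (u t)).
  by apply: (bmf_comp _ (b_tr k)) => //; exact: measurable_funB.
have tc_le y : `|trunc k%:R y - cc k| <= 2 * k%:R.
  apply: le_trans (ler_normB _ _) _; rewrite mulr_natl mulr2n; apply: lerD => //.
  exact: trunc_bound.
have -> : (vv k)%:C%C = (n%:R * (r ^+ 2 * vv k))%:C%C by rewrite r2 mulVKf // gt_eqF.
have vE : vv k = Ex P1 (fun t => (trunc k%:R (u t) - cc k) ^+ 2).
  have -> : Ex P1 (fun t => (trunc k%:R (u t) - cc k) ^+ 2) =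
    Ex P1 (fun t => trunc k%:R (u t) ^+ 2 - (2 * cc k * trunc k%:R (u t) - cc k ^+ 2)).
    by apply: eq_Ex => t; ring.
  have b1 : bmf (fun t => 2 * cc k * trunc k%:R (u t)) by apply: bmfM => //; exact: bmf_cst.
  have bc := bmf_cst T1 (cc k ^+ 2).
  rewrite ExB //; [|exact: bmfX|exact: bmfB].
  by rewrite ExB // ExZ // Ex_cst /vv -/(cc k); ring.
have bX p : bmf (fun t => trunc k%:R (X t p - a)) := bmf_comp (mX p) (b_tr k).
have bXc p : bmf (fun t => trunc k%:R (X t p - a) - cc k) by apply: bmfB => //; exact: bmf_cst.
have btc : bmf (fun t => trunc k%:R (u t) - cc k) by apply: bmfB => //; exact: bmf_cst.
have lawX (p : 'I_n * 'I_n) (g : R -> R) : (p.1 < p.2)%N -> measurable_fun setT g ->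
    bmf (fun y : R => g (trunc k%:R (y - a))) ->
    Ex P (fun t => g (trunc k%:R (X t p - a))) = Ex P1 (fun t => g (trunc k%:R (u t))).
  move=> p12 mg bgt.
  have [_ ->] := same_law_Ex (mX p) mxi bgt.1 (law_off p12) (bmf_L1 P1 (bmf_comp mxi bgt)).
  by [].
have bcc : bmf (fun y : R => trunc k%:R (y - a) - cc k) by apply: bmfB => //; exact: bmf_cst.
have mcc : measurable_fun setT (fun y : R => y - cc k).
  by apply: measurable_funB => //; exact: measurable_cst.
have pF (p : 'I_n * 'I_n) : (p.1 < p.2)%N -> (p.1 == p.2) = false.
  by move=> p12; apply/eqP => e; move: p12; rewrite e ltnn.
apply: (self_consistent n0 mX indepX z0 (psi := trunc_entry r a k%:R (cc k))) => //.
- move=> p y; rewrite /trunc_entry; case: ifP => _; first by rewrite normr0 !mulr_ge0.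
  by rewrite normrM (ger0_norm r0) mulrC ler_wpM2r.
- by move=> p y /eqP p12; rewrite /trunc_entry p12.
- move=> p p12; rewrite /trunc_entry pF // ExZ //.
  rewrite (lawX p (fun y => y - cc k)) // ExB //; last exact: bmf_cst.
  by rewrite Ex_cst subrr mulr0.
- move=> p p12; rewrite /trunc_entry pF //; under eq_Ex do rewrite exprMn.
  rewrite ExZ; last exact: bmfX.
  rewrite (lawX p (fun y => (y - cc k) ^+ 2)) // -?vE //; first exact: measurable_funX.
  exact: (bmfX 2 bcc).
- rewrite vE mulr_ge0 ?sqr_ge0 //=; last by apply: Ex_ge0 => t; exact: sqr_ge0.
  rewrite exprMn mulrC ler_wpM2r ?sqr_ge0 //.
  apply: le_trans (ler_norm _) _; apply: Ex_bound => [|t]; first exact: bmfX.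
  by rewrite normrX lerXn2r ?nnegrE // mulr_ge0.
Qed.

(** Three terms for three successive limits: the first is small with [al], the second vanishes as
    [k] grows at fixed [al], the third as [n] grows at fixed [al] and [k]. *)
Lemma mean_equation (k : nat) (al : R) : 0 < al ->
  cabs (1 + z * Ec P s + Ec P s ^+ 2) <=
  (cabs z + 4 * B) * (al * B ^+ 4) +
  ((cabs z + 4 * B) * (4 * B * pp k + 2 * al^-1 * (qq k + cc k ^+ 2)) +
   4 * B ^+ 2 * `|1 - vv k|) +
  ((cabs z + 4 * B) * (4 * B + al^-1 * k%:R ^+ 2) + 192 * k%:R ^+ 3 * B ^+ 3 +
   536 * k%:R ^+ 2 * B ^+ 2) * r.
Proof.
move=> al0; have r0 : 0 <= r by rewrite invr_ge0 sqrtr_ge0.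
have r1 : r ^+ 2 <= r.
  rewrite expr2 ler_piMl // /r invf_le1 ?sqrtr_gt0 // -[leLHS]sqrtr1 ler_wsqrtr //.
  by rewrite ler1n.
have bs : cbf s by apply: (cbf_family mX (f := fun x => stieltjes (emx (scale_entry r) x) z)); exact: cbf_stieltjes.
have bt : cbf (trunc_stieltjes k).
  by apply: (cbf_family mX (f := fun x => stieltjes (emx (trunc_entry r a k%:R (cc k)) x) z)); exact: cbf_stieltjes.
have sB : cabs (Ec P s) <= 2 * B.
  by apply: cabs_Ec_bound => // t; apply: stieltjes_le => //; exact: emx_hermitian.
have tB : cabs (Ec P (trunc_stieltjes k)) <= 2 * B.
  by apply: cabs_Ec_bound => // t; apply: stieltjes_le => //; exact: emx_hermitian.
have h1 := mean_trunc k al0; have h2 := trunc_equation (erefl (Ec P (trunc_stieltjes k))).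
move: sB tB h1 h2; move: (Ec P s) (Ec P (trunc_stieltjes k)) => m m' sB tB h1 h2.
have -> : 1 + z * m + m ^+ 2 = (1 + z * m' + (vv k)%:C%C * m' ^+ 2) +
    ((z * (m - m') + (m + m') * (m - m')) + (1 - vv k)%:C%C * m' ^+ 2).
  by have -> : (1 - vv k)%:C%C = 1 - (vv k)%:C%C; [rewrite rmorphB | ring].
apply: le_trans (ler_cabsD _ _) _; apply: le_trans (lerD h2 (ler_cabsD _ _)) _.
rewrite -mulrDl [cabs ((_ + _) * _)]cabsM [cabs (_%:C%C * _)]cabsM cabs_real.
have z4 : cabs (z + (m + m')) <= cabs z + 4 * B.
  apply: le_trans (ler_cabsD _ _) _; rewrite lerD2l; apply: le_trans (ler_cabsD _ _) _.
  by have := lerD sB tB; lra.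
have z40 : 0 <= cabs z + 4 * B by rewrite addr_ge0 ?cabs_ge0 ?mulr_ge0.
have h3 := ler_pM (cabs_ge0 _) (cabs_ge0 _) z4 h1.
have h4 : `|1 - vv k| * cabs (m' ^+ 2) <= 4 * B ^+ 2 * `|1 - vv k|.
  rewrite mulrC cabsX ler_wpM2r // (_ : 4 * B ^+ 2 = (2 * B) ^+ 2); last by ring.
  by rewrite lerXn2r ?nnegrE ?cabs_ge0 ?mulr_ge0.
apply: le_trans (lerD (lexx _) (lerD h3 h4)) _.
have kk : (0 : R) <= k%:R by [].
have e1 : 24 * n%:R * (2 * k%:R * r) ^+ 3 * B ^+ 3 = 192 * k%:R ^+ 3 * B ^+ 3 * r.
  have -> : 24 * n%:R * (2 * k%:R * r) ^+ 3 * B ^+ 3 = 192 * k%:R ^+ 3 * B ^+ 3 * r * (n%:R * r ^+ 2) by ring.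
  by rewrite r2 divff ?mulr1 // gt_eqF.
have e2 : 134 * (2 * k%:R * r) ^+ 2 * B ^+ 2 <= 536 * k%:R ^+ 2 * B ^+ 2 * r.
  have -> : 134 * (2 * k%:R * r) ^+ 2 * B ^+ 2 = 536 * k%:R ^+ 2 * B ^+ 2 * r ^+ 2 by ring.
  exact: (ler_wpM2l (mulr_ge0 (mulr_ge0 (ler0n R 536) (sqr_ge0 _)) (sqr_ge0 _)) r1).
have al1 : 0 <= al^-1 by rewrite invr_ge0 ltW.
have e3 : (cabs z + 4 * B) * (4 * B * (n%:R^-1 + pp k) +
     (al * B ^+ 4 + al^-1 * (k%:R ^+ 2 * n%:R^-1 + 2 * (qq k + cc k ^+ 2)))) <=
   (cabs z + 4 * B) * (al * B ^+ 4) +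
   (cabs z + 4 * B) * (4 * B * pp k + 2 * al^-1 * (qq k + cc k ^+ 2)) +
   (cabs z + 4 * B) * (4 * B + al^-1 * k%:R ^+ 2) * r.
  rewrite -!mulrA -!mulrDr ler_wpM2l // -r2.
  have : (4 * B + al^-1 * k%:R ^+ 2) * r ^+ 2 <= (4 * B + al^-1 * k%:R ^+ 2) * r.
    by rewrite ler_wpM2l // addr_ge0 ?mulr_ge0 ?exprn_ge0.
  move=> h; rewrite -subr_ge0; move: h; rewrite -subr_ge0 => h.
  apply: le_trans h _; rewrite le_eqVlt; apply/orP; left; apply/eqP; ring.
rewrite e1; apply: le_trans (lerD (lerD (lexx _) e2) (lerD e3 (lexx _))) _.
by rewrite le_eqVlt; apply/orP; left; apply/eqP; ring.
Qed.

End FixedSize.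

Section Limit.
Context (X : forall n, T -> 'I_n * 'I_n -> R).
Arguments X : clear implicits.
Hypothesis mX : forall n, (0 < n)%N -> forall i, measurable_fun setT (fun t => X n t i).
Hypothesis indepX : forall n, (0 < n)%N -> forall (B : 'I_n * 'I_n -> set R), (forall i, measurable (B i)) ->
  P [set t | forall i, B i (X n t i)] = (\prod_i P ((fun t => X n t i) @^-1` B i))%E.
Hypothesis law_off : forall n, (0 < n)%N -> forall (p : 'I_n * 'I_n), (p.1 < p.2)%N -> same_law P P1 (fun t => X n t p) xi.
Hypothesis law_diag : forall n, (0 < n)%N -> forall (p : 'I_n * 'I_n), p.1 = p.2 -> same_law P P2 (fun t => X n t p) zeta.
Variable z : R[i].
Hypothesis z0 : 0 < complex.Im z.
Let B := (complex.Im z)^-1.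
Let s n t := stieltjes (emx (scale_entry (Num.sqrt n%:R)^-1) (X n t)) z.
Hypothesis cc0 : cc k @[k --> \oo] --> (0 : R).
Hypothesis vv1 : Ex P1 (fun t => trunc k%:R (u t) ^+ 2) @[k --> \oo] --> (1 : R).
Hypothesis qq0 : qq k @[k --> \oo] --> (0 : R).

Let pp0 : pp k @[k --> \oo] --> (0 : R).
Proof. exact: tail_cvg. Qed.

Lemma cvg_inv_sqrt : (Num.sqrt n%:R)^-1 @[n --> \oo] --> (0 : R).
Proof.
apply/cvgrPdist_lt => e e0; exists (Num.truncn (e^-1 ^+ 2)).+1 => // n /= h.
have h1 : e^-1 ^+ 2 < n%:R by apply: lt_le_trans (truncnS_gt _) _; rewrite ler_nat.
rewrite sub0r normrN ger0_norm ?invr_ge0 ?sqrtr_ge0 // invf_plt ?posrE //.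
  rewrite -(@ltr_pXn2r _ 2) ?nnegrE ?sqrtr_ge0 ?invr_ge0 ?(ltW e0) // sqr_sqrtr //.
by rewrite sqrtr_gt0; apply: le_lt_trans h1; exact: sqr_ge0.
Qed.

Lemma mean_equation_cvg :
  cabs (1 + z * Ec P (s n) + Ec P (s n) ^+ 2) @[n --> \oo] --> (0 : R).
Proof.
have B0 : 0 < B by rewrite invr_gt0.
pose A := cabs z + 4 * B; have A0 : 0 < A by rewrite ltr_wpDl ?cabs_ge0 ?mulr_gt0.
apply/cvgrPdist_lt => e e0.
have AB : 0 < A * B ^+ 4 by rewrite mulr_gt0 ?exprn_gt0.
(* Makes the first of the three terms equal to [e / 3]. *)
pose al := e / 3 / (A * B ^+ 4).
have al0 : 0 < al by rewrite !divr_gt0.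
have ale : A * (al * B ^+ 4) = e / 3 by rewrite /al; field; rewrite !gt_eqF.
have c1 : A * (4 * B * pp k + 2 * al^-1 * (qq k + cc k ^+ 2)) + 4 * B ^+ 2 * `|1 - vv k|
    @[k --> \oo] --> (0 : R).
  have -> : (0 : R) = A * (4 * B * 0 + 2 * al^-1 * (0 + 0 ^+ 2)) + 4 * B ^+ 2 * `|1 - (1 - 0 ^+ 2)|.
    by rewrite expr0n /= subr0 subrr normr0; ring.
  have cM (b l : R) (f : nat -> R) : f k @[k --> \oo] --> l -> b * f k @[k --> \oo] --> b * l.
    by move=> fl; apply: cvgM => //; exact: cvg_cst.
  have cX (l : R) (f : nat -> R) : f k @[k --> \oo] --> l -> f k ^+ 2 @[k --> \oo] --> l ^+ 2.
    by move=> fl; rewrite expr2; under eq_fun do rewrite expr2; exact: cvgM.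
  apply: cvgD.
    apply: (cM); apply: cvgD; apply: (cM) => //.
    by apply: cvgD => //; exact: cX.
  apply: (cM); apply: cvg_norm; apply: cvgB; first exact: cvg_cst.
  by apply: cvgB => //; exact: cX.
have e3 : 0 < e / 3 by rewrite divr_gt0.
have /cvgrPdist_lt/(_ _ e3)[k _ hk] := c1.
have {hk} := hk k (leqnn k); rewrite sub0r normrN => hk.
set E2 := A * (4 * B + al^-1 * k%:R ^+ 2) + 192 * k%:R ^+ 3 * B ^+ 3 + 536 * k%:R ^+ 2 * B ^+ 2.
have c2 : E2 * (Num.sqrt n%:R)^-1 @[n --> \oo] --> (0 : R).
  rewrite -[X in _ --> X](mulr0 E2); apply: cvgM; [exact: cvg_cst | exact: cvg_inv_sqrt].
have /cvgrPdist_lt/(_ _ e3)[N _ hN] := c2.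
exists N.+1 => // n /= Nn; have n0 : (0 < n)%N by exact: leq_trans Nn.
have {hN} := hN n (ltnW Nn); rewrite sub0r normrN => hN.
rewrite sub0r normrN ger0_norm ?cabs_ge0 //.
apply: le_lt_trans (mean_equation n0 (mX n0) (indepX n0) (law_off n0) (law_diag n0) z0 k al0) _.
rewrite -/B -/A -/E2 ale; move: hk hN => /(le_lt_trans (ler_norm _)) hk /(le_lt_trans (ler_norm _)) hN.
by lra.
Qed.

Lemma mean_stieltjes_cvg (m : R[i]) : 0 < complex.Im m -> m ^+ 2 + z * m + 1 = 0 ->
  cabs (Ec P (s n) - m) @[n --> \oo] --> (0 : R).
Proof.
move=> m0 mE; apply: (@squeeze_cvgr _ _ _ _ (fun=> 0)
    (fun n => B * cabs (1 + z * Ec P (s n) + Ec P (s n) ^+ 2))).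
- apply: nearW => n; rewrite cabs_ge0 /=; apply: semicircle_stability => //.
  apply: Ex_ge0 => t; apply: stieltjes_Im_ge0 => //; exact: emx_hermitian.
- exact: cvg_cst.
- rewrite -[X in _ --> X](mulr0 B); apply: cvgM; [exact: cvg_cst | exact: mean_equation_cvg].
Qed.

End Limit.
End MeanEquation.

(** * Almost sure convergence and integrals against the empirical measure *)

Section AlmostSure.
Context {R : realType}.

(** The subtracted term telescopes: [2 / (n + 1) - 2 / (n + 2)] is at least [1 / (n + 1)^2]. *)
Lemma inv_square_sum_le n : \sum_(0 <= i < n) (i.+1%:R^-1 : R) ^+ 2 <= 2 - 2 * n.+1%:R^-1.
Proof.
elim: n => [|n IH]; first by rewrite big_geq // invr1 mulr1 subrr.
rewrite big_nat_recr //=; apply: le_trans (lerD IH (lexx _)) _.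
have n1 : (0 : R) < n.+1%:R by rewrite ltr0n.
have n2 : (0 : R) < n.+2%:R by rewrite ltr0n.
rewrite -subr_ge0.
have -> : 2 - 2 * n.+2%:R^-1 - (2 - 2 * n.+1%:R^-1 + n.+1%:R^-1 ^+ 2) =
   (n%:R : R) * (n.+2%:R^-1 * n.+1%:R^-1 ^+ 2).
  move: n1 n2; rewrite -[n.+2%:R]natr1 -[n.+1%:R]natr1 => n1 n2.
  by field; rewrite !gt_eqF.
by rewrite mulr_ge0 // mulr_ge0 ?sqr_ge0 // invr_ge0 ltW.
Qed.

(** The sum of all fourth powers has finite expectation, so it is finite almost surely and its terms
    tend to 0, whatever the dependence between the [S n]. *)
Lemma as_cvg_fourth_moment d (T : measurableType d) (P : probability T R)
    (S : nat -> T -> R) (K : R) : 0 <= K -> (forall n, bmf (S n)) ->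
  (forall n, Ex P (fun t => S n t ^+ 4) <= K * n.+1%:R^-1 ^+ 2) ->
  {ae P, forall t, S n t @[n --> \oo] --> (0 : R)}.
Proof.
move=> K0 bS SK; have b4 n : bmf (fun t => S n t ^+ 4) by exact: bmfX.
have p4 (x : R) : 0 <= x ^+ 4 by rewrite (exprM x 2 2) sqr_ge0.
pose f n t := (S n t ^+ 4)%:E.
have f0 n t : (0 <= f n t)%E by rewrite lee_fin.
have mf n : measurable_fun setT (f n) by apply/measurable_EFinP; exact: (b4 n).1.
have If : P.-integrable setT (fun t => \sum_(0 <= n <oo) f n t)%E.
  apply/integrableP; split.
    by apply: (ge0_emeasurable_sum (P := xpredT)) => [k x _ _|k _]; [exact: f0 | exact: mf].
  have -> : (\int[P]_t `|\sum_(0 <= n <oo) f n t| = \int[P]_t \sum_(0 <= n <oo) f n t)%E.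
    by apply: eq_integral => t _; rewrite gee0_abs //; exact: nneseries_ge0.
  rewrite integral_nneseries //; apply: (@le_lt_trans _ _ (K * 2)%:E); last exact: ltry.
  apply: lime_le; first by apply: is_cvg_nneseries => n _ _; exact: integral_ge0.
  apply: nearW => n; rewrite (eq_bigr (fun i => (Ex P (fun t => S i t ^+ 4))%:E)); last first.
    by move=> i _; rewrite ExE.
  rewrite sumEFin lee_fin; apply: le_trans (ler_sum _ (fun i _ => SK i)) _.
  rewrite -mulr_sumr ler_wpM2l //; apply: le_trans (inv_square_sum_le n) _.
  by rewrite gerBl mulr_ge0 // invr_ge0.
apply: filterS (integrable_ae measurableT If) => t /(_ I) fin.
have S4 : S n t ^+ 4 @[n --> \oo] --> (0 : R).
  apply: cvg_series_cvg_0; apply: nondecreasing_is_cvgn.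
    by apply: nondecreasing_series => n _ _.
  exists (fine (\sum_(0 <= n <oo) f n t)%E) => _ [n _ <-].
  rewrite -lee_fin fineK // /series /= -sumEFin.
  exact: (@nneseries_lim_ge R (fun n => f n t) xpredT 0 n (fun _ _ _ => f0 _ _)).
apply/cvgrPdist_lt => e e0.
have e4 : 0 < e ^+ 4 by rewrite exprn_gt0.
have /cvgrPdist_lt/(_ _ e4) := S4; apply: filterS => n.
rewrite !sub0r !normrN normrX => h.
by rewrite -(@ltr_pXn2r _ 4) ?nnegrE // ltW.
Qed.

Lemma stieltjes_as d (T : measurableType d) (P : probability T R)
    (X : forall n, T -> 'I_n * 'I_n -> R) (psi : forall n, 'I_n * 'I_n -> R -> R) (z : R[i]) :
  (forall n, (0 < n)%N -> forall i, measurable_fun setT (fun t => X n t i)) ->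
  (forall n, (0 < n)%N -> forall (B : 'I_n * 'I_n -> set R), (forall i, measurable (B i)) ->
    P [set t | forall i, B i (X n t i)] = (\prod_i P ((fun t => X n t i) @^-1` B i))%E) ->
  (forall n p, measurable_fun setT (psi n p)) -> 0 < complex.Im z ->
  {ae P, forall t, cabs (stieltjes (emx (psi n.+1) (X n.+1 t)) z -
    Ec P (fun t => stieltjes (emx (psi n.+1) (X n.+1 t)) z)) @[n --> \oo] --> (0 : R)}.
Proof.
move=> mX indepX mpsi z0; pose s n t := stieltjes (emx (psi n.+1) (X n.+1 t)) z.
have bs n : cbf (s n).
  apply: (cbf_family (mX _ (ltn0Sn n)) (f := fun x => stieltjes (emx (psi n.+1) x) z)).
  exact: cbf_stieltjes.
have h n := stieltjes_fourth_moment (ltn0Sn n) (mX _ (ltn0Sn n)) (indepX _ (ltn0Sn n)) z0 (mpsi n.+1).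
pose K : R := 1024 * (complex.Im z)^-1 ^+ 4.
have K0 : 0 <= K by rewrite mulr_ge0 ?ler0n // exprn_ge0 // invr_ge0 ltW.
have bR n : bmf (fun t => complex.Re (s n t) - Ex P (fun t => complex.Re (s n t))).
  by apply: bmfB; [exact: (bs n).1 | exact: bmf_cst].
have bI n : bmf (fun t => complex.Im (s n t) - Ex P (fun t => complex.Im (s n t))).
  by apply: bmfB; [exact: (bs n).2 | exact: bmf_cst].
have aR := as_cvg_fourth_moment K0 bR (fun n => (h n).1).
have aI := as_cvg_fourth_moment K0 bI (fun n => (h n).2).
apply: filterS2 aR aI => t cR cI.
apply: (@squeeze_cvgr _ _ _ _ (fun=> 0) (fun n =>
  `|complex.Re (s n t) - Ex P (fun t => complex.Re (s n t))| +
  `|complex.Im (s n t) - Ex P (fun t => complex.Im (s n t))|)).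
- apply: nearW => n; rewrite cabs_ge0 /=; apply: le_trans (ler_cabs_ReIm _) _.
  by rewrite cReB cImB.
- exact: cvg_cst.
- rewrite [X in _ --> X](_ : _ = `|0 : R| + `|0 : R|); last by rewrite normr0 addr0.
  by apply: cvgD; exact: cvg_norm.
Qed.

(** Disposes of the weight left by Cauchy-Schwarz: [a] is fixed with [a C] below [e / 2], after
    which [v n] becomes small compared with [a]. *)
Lemma tradeoff_cvg0 (u v : nat -> R) (C : R) : 0 <= C ->
  (forall n, 0 <= u n) -> (forall n a, 0 < a -> u n <= a * C + a^-1 * v n) ->
  v n @[n --> \oo] --> (0 : R) -> u n @[n --> \oo] --> (0 : R).
Proof.
move=> C0 u0 uv v0; apply/cvgrPdist_lt => e e0.
pose a := e / 2 / (C + 1); have C1 : 0 < C + 1 by rewrite ltr_wpDl.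
have a0 : 0 < a by rewrite !divr_gt0.
have ae : 0 < a * (e / 2) by rewrite mulr_gt0 // divr_gt0.
have /cvgrPdist_lt/(_ _ ae) := v0; apply: filterS => n.
rewrite !sub0r !normrN (ger0_norm (u0 n)) => /(le_lt_trans (ler_norm _)) vn.
apply: le_lt_trans (uv n a a0) _.
have h1 : a * C < e / 2.
  rewrite /a mulrAC ltr_pdivrMr //; have := divr_gt0 e0 (ltr0n R 2); move: (e / 2) => x; nra.
have h2 : a^-1 * v n < e / 2 by rewrite ltr_pdivrMl.
by rewrite [e]splitr ltrD.
Qed.

Lemma frobenius_norm_sqr n (A : 'M[R[i]]_n) : frobenius_norm A ^+ 2 = fro2 A.
Proof.
rewrite /frobenius_norm; have -> : \tr (A *m (map_mx Num.conj A)^T) = (fro2 A)%:C%C.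
  by rewrite fro2_trace -map_trmx.
by rewrite /= sqr_sqrtr // fro2_ge0.
Qed.

Section Empirical.
Context (n : nat) (A : 'M[R[i]]_n) (l : 'I_n -> R[i]).
Hypothesis Al : char_poly A = \prod_i ('X - (l i)%:P).

(** Linear factors are unique up to order, so any [l] that splits the characteristic polynomial,
    such as the diagonal of a triangular form, can replace the chosen list of eigenvalues. *)
Lemma eigenvalues_sum (f : R[i] -> R) :
  \sum_(k < n) f (eigenvalues A)`_k = \sum_i f (l i).
Proof.
have pe : perm_eq (eigenvalues A) (codom l).
  apply: prod_XsubC_eq; rewrite big_image /= -Al /eigenvalues.
  case: closed_field_poly_normal => r /= e.
  by rewrite [RHS]e (monicP (char_poly_monic A)) scale1r.
have sz : size (eigenvalues A) = n by rewrite (perm_size pe) size_codom card_ord.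
transitivity (\sum_(x <- eigenvalues A) f x).
  by rewrite (big_nth 0) sz big_mkord.
by rewrite (perm_big _ pe) /= big_image.
Qed.

Let ge0_integral_empirical (h : R[i] -> R) : measurable_fun setT (h : borelC R -> R) ->
  (forall x, 0 <= h x) ->
  (\int[empirical_spectral_measure A]_z (h z)%:E = (n%:R^-1 * \sum_i h (l i))%:E)%E.
Proof.
move=> mh h0; have mH : measurable_fun setT (fun z : borelC R => (h z)%:E) by exact/measurable_EFinP.
rewrite ge0_integral_mscale //; last by move=> x _; rewrite lee_fin.
rewrite ge0_integral_measure_sum //; last by move=> x _; rewrite lee_fin.
under eq_bigr do rewrite integral_dirac // diracT mul1e.
by rewrite sumEFin eigenvalues_sum EFinM.
Qed.

Lemma integral_empirical (f : R[i] -> R) (K : R) : continuous f -> (forall x, `|f x| <= K) ->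
  (\int[empirical_spectral_measure A]_z (f z)%:E = (n%:R^-1 * \sum_i f (l i))%:E)%E.
Proof.
move=> cf fK; have mf := continuous_measurable_borelC cf.
have K0 : 0 <= K by apply: le_trans (fK 0).
have g0 x : 0 <= f x + K by have := fK x; rewrite ler_norml; lra.
have mg : measurable_fun setT ((fun x => f x + K) : borelC R -> R).
  by apply: measurable_funD => //; exact: measurable_cst.
have mK : measurable_fun setT ((fun=> K) : borelC R -> R) by exact: measurable_cst.
have I0 (h : R[i] -> R) : measurable_fun setT (h : borelC R -> R) -> (forall x, 0 <= h x) ->
    (empirical_spectral_measure A).-integrable setT (fun z => (h z)%:E).
  move=> mh h0; apply/integrableP; split; first exact/measurable_EFinP.
  have -> : (\int[empirical_spectral_measure A]_z `|(h z)%:E| =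
      \int[empirical_spectral_measure A]_z (h z)%:E)%E.
    by apply: eq_integral => z _; rewrite gee0_abs // lee_fin.
  by rewrite ge0_integral_empirical // ltry.
have -> : (\int[empirical_spectral_measure A]_z (f z)%:E =
    \int[empirical_spectral_measure A]_z ((f z + K)%:E - K%:E))%E.
  by apply: eq_integral => z _; rewrite -EFinB addrK.
rewrite integralB //; [|exact: I0|exact: I0].
rewrite ge0_integral_empirical // (ge0_integral_empirical mK) // -EFinB -mulrBr -sumrB.
by under eq_bigr do rewrite addrK.
Qed.

End Empirical.
End AlmostSure.

(** * From a Wigner matrix to a family of independent coordinates *)

Section WignerEntries.
Context {R : realType} d (T : measurableType d) (P : probability T R).
Context d1 (T1 : measurableType d1) (P1 : probability T1 R) (xi : T1 -> R).
Context d2 (T2 : measurableType d2) (P2 : probability T2 R) (zeta : T2 -> R).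
Context (n : nat) (W : T -> 'M[R]_n) (wW : wigner_matrix P P1 xi P2 zeta W).

(* Zero below the diagonal, so that the whole family of coordinates is independent. *)
Definition wigner_entry (t : T) (p : 'I_n * 'I_n) : R :=
  if (p.1 <= p.2)%N then W t p.1 p.2 else 0.

Lemma measurable_wigner_entry p : measurable_fun setT (fun t => wigner_entry t p).
Proof.
rewrite /wigner_entry; case: (p.1 <= p.2)%N; first exact: (wigner_measurable wW).
exact: measurable_cst.
Qed.

Lemma wigner_entry_off (p : 'I_n * 'I_n) : (p.1 < p.2)%N ->
  same_law P P1 (fun t => wigner_entry t p) xi.
Proof. by move=> p12; rewrite /wigner_entry ltnW //; exact: (wigner_offdiag wW). Qed.

Lemma wigner_entry_diag (p : 'I_n * 'I_n) : p.1 = p.2 ->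
  same_law P P2 (fun t => wigner_entry t p) zeta.
Proof. by move=> p12; rewrite /wigner_entry p12 leqnn; exact: (wigner_diag wW). Qed.

Lemma wigner_entry_indep (B : 'I_n * 'I_n -> set R) : (forall p, measurable (B p)) ->
  P [set t | forall p, B p (wigner_entry t p)] =
  (\prod_p P ((fun t => wigner_entry t p) @^-1` B p))%E.
Proof.
move=> mB; pose D := [set ij : 'I_n * 'I_n | (ij.1 <= ij.2)%N]%SET.
(* A coordinate below the diagonal is constantly 0: if its [B p] omits 0 both sides vanish,
   otherwise its factor is 1. *)
have [B0|] := pselect (forall p, p \notin D -> B p 0); last first.
  move=> /existsNP[p /not_implyP[pD Bp]].
  have pF : (p.1 <= p.2)%N = false by move: pD; rewrite inE => /negbTE.
  have e0 (S : set T) : S = set0 -> P S = 0%E by move=> ->; exact: measure0.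
  rewrite (bigD1 p) //= [X in (X * _)%E]e0 ?mul0e; last first.
    by apply/seteqP; split=> t //=; rewrite /wigner_entry pF.
  by apply: e0; apply/seteqP; split=> t //= /(_ p); rewrite /wigner_entry pF.
have -> : [set t | forall p, B p (wigner_entry t p)] =
    \bigcap_(p in [set` D]) ((fun t => W t p.1 p.2) @^-1` B p).
  apply/seteqP; split=> t /= h p.
    by rewrite /= inE => pD; have := h p; rewrite /wigner_entry pD.
  rewrite /wigner_entry; case: ifP => pD; first by apply: h; rewrite /= inE.
  by apply: B0; rewrite inE pD.
rewrite (wigner_independent wW) // [RHS](bigID (mem D)) /= [X in (_ * X)%E]big1 ?mule1 => [|p pD].
  apply: eq_bigr => p; rewrite inE => pD; congr (P _).
  by apply/seteqP; split=> t; rewrite /= /wigner_entry pD.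
have pF : (p.1 <= p.2)%N = false by move: pD; rewrite inE => /negbTE.
rewrite (_ : _ @^-1` _ = setT) ?probability_setT //.
by apply/seteqP; split=> t //= _; rewrite /wigner_entry pF; exact: B0.
Qed.

Lemma map_wigner (r : R) t :
  map_mx (real_complex R) (r *: W t) = emx (scale_entry r) (wigner_entry t).
Proof.
apply/matrixP => i j; rewrite !mxE /scale_entry /wigner_entry /upper.
case: (leqP i j) => ij /=; first by rewrite ij.
rewrite (ltnW ij); congr (_%:C)%C; congr (_ * _).
by have /matrixP/(_ i j) := wigner_symmetric wW t; rewrite mxE.
Qed.

End WignerEntries.

Lemma bounded_funP (R : realType) (T : Type) (f : T -> R) : bounded_fun f ->
  exists K, forall x, `|f x| <= K.
Proof.
move=> [K [_ hK]]; exists (K + 1) => x; apply: (hK (K + 1)) => //.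
by rewrite ltrDl.
Qed.

(** * Almost sure limits for Wigner matrices and their perturbations *)

Section MainTheorem.
Context (R : realType)
    (d : measure_display) (T : measurableType d) (P : probability T R)
    (d1 : measure_display) (T1 : measurableType d1) (P1 : probability T1 R)
    (d2 : measure_display) (T2 : measurableType d2) (P2 : probability T2 R)
    (xi : {RV P1 >-> R}) (zeta : {RV P2 >-> R})
    (W : forall n : nat, T -> 'M[R]_n).
Hypothesis xi_var : 'V_P1[xi] = 1%E.
Hypothesis wW : forall n : nat, (0 < n)%N -> wigner_matrix P P1 xi P2 zeta (W n).

Let H n t : 'M[R[i]]_n := map_mx (real_complex R) ((Num.sqrt n%:R)^-1 *: W n t).

Lemma wigner_stieltjes_as (z m : R[i]) : 0 < complex.Im z -> 0 < complex.Im m ->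
  m ^+ 2 + z * m + 1 = 0 ->
  {ae P, forall t, cabs (stieltjes (H n.+1 t) z - m) @[n --> \oo] --> (0 : R)}.
Proof.
move=> z0 m0 mE.
have mxi : measurable_fun setT xi by exact: measurable_funPT.
have mzeta : measurable_fun setT zeta by exact: measurable_funPT.
pose X n := wigner_entry (W n).
have mX n (n0 : (0 < n)%N) := measurable_wigner_entry (wW n0).
have iX n (n0 : (0 < n)%N) := wigner_entry_indep (wW n0).
have oX n (n0 : (0 < n)%N) := wigner_entry_off (wW n0).
have dX n (n0 : (0 < n)%N) := wigner_entry_diag (wW n0).
have [c0 v1 q0 tL] := centered_trunc_cvg mxi xi_var.
have mc := mean_stieltjes_cvg mxi mzeta tL mX iX oX dX z0 c0 v1 q0 m0 mE.
have ms n (p : 'I_n * 'I_n) : measurable_fun setT (scale_entry (n := n) (Num.sqrt (n%:R : R))^-1 p).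
  by apply: measurable_funM => //; exact: measurable_cst.
have as_ := stieltjes_as (psi := fun n => scale_entry (Num.sqrt n%:R)^-1) mX iX ms z0.
apply: filterS as_ => t ct.
rewrite -cvg_shiftS in mc.
apply: (@squeeze_cvgr _ _ _ _ (fun=> 0) (fun n =>
  cabs (stieltjes (emx (scale_entry (Num.sqrt n.+1%:R)^-1) (X n.+1 t)) z -
    Ec P (fun t => stieltjes (emx (scale_entry (Num.sqrt n.+1%:R)^-1) (X n.+1 t)) z)) +
  cabs (Ec P (fun t => stieltjes (emx (scale_entry (Num.sqrt n.+1%:R)^-1) (X n.+1 t)) z) - m))).
- apply: nearW => n; rewrite cabs_ge0 /= /H (map_wigner (wW (ltn0Sn n))).
  apply: le_trans (ler_cabsD _ _); rewrite le_eqVlt; apply/orP; left; apply/eqP; congr cabs.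
  by rewrite subrKA.
- exact: cvg_cst.
- rewrite -[X in _ --> X](addr0 (0 : R)); apply: cvgD; [exact: ct | exact: mc].
Qed.

(** A single null set for all rational centres and all heights [1 / (k + 1)]; the imaginary part of
    a Stieltjes transform at such a point is a mean of the Poisson kernel. *)
Lemma wigner_stieltjes_as_countable :
  {ae P, forall t, forall (k : nat) (p : rat),
    complex.Im (stieltjes (H n.+1 t) (Complex (ratr p) k.+1%:R^-1)) @[n --> \oo] -->
    sc_mean (poisson k.+1%:R (ratr p) : R -> R)}.
Proof.
have key (k : nat) (p : rat) : {ae P, forall t,
    complex.Im (stieltjes (H n.+1 t) (Complex (ratr p) k.+1%:R^-1)) @[n --> \oo] -->
    sc_mean (poisson k.+1%:R (ratr p) : R -> R)}.
  have z0 : 0 < complex.Im (Complex (ratr p) k.+1%:R^-1 : R[i]) by rewrite /= invr_gt0.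
  have [m [m0 mE ms]] := sc_mean_stieltjes z0.
  have -> : sc_mean (poisson k.+1%:R (ratr p) : R -> R) = complex.Im m.
    have := ms (- 'i)%C; have -> : complex.Re (- 'i * m)%C = complex.Im m by case: (m) => a b /=; ring.
    move=> <-; congr sc_mean; apply/funext => x; rewrite poissonE //.
    by case: (_^-1) => a b /=; ring.
  apply: filterS (wigner_stieltjes_as z0 m0 mE) => t ct.
  apply/cvgrPdist_lt => e e0; have /cvgrPdist_lt/(_ _ e0) := ct; apply: filterS => n.
  rewrite sub0r normrN (ger0_norm (cabs_ge0 _)) distrC -cImB; apply: le_lt_trans.
  exact: ler_Im_cabs.
(* The pairs of parameters are enumerated through [unpickle], so that the events indexed by integers
   can be intersected. *)
have := @ae_foralln _ _ _ P (fun N t => forall kp, unpickle N = Some kp :> option (nat * rat) ->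
    complex.Im (stieltjes (H n.+1 t) (Complex (ratr kp.2) kp.1.+1%:R^-1)) @[n --> \oo] -->
    sc_mean (poisson kp.1.+1%:R (ratr kp.2) : R -> R)).
move=> h; have {}h := h _; apply: filterS (h _) => [t ht k p|N].
  exact: (ht (pickle (k, p)) (k, p) (pickleK _)).
case: (unpickle N) => [kp|]; last by apply: nearW.
by apply: filterS (key kp.1 kp.2) => t ht _ [<-].
Qed.

End MainTheorem.

Theorem theorem2p5 (R : realType)
    (d : measure_display) (T : measurableType d) (P : probability T R)
    (d1 : measure_display) (T1 : measurableType d1) (P1 : probability T1 R)
    (d2 : measure_display) (T2 : measurableType d2) (P2 : probability T2 R)
    (xi : {RV P1 >-> R}) (zeta : {RV P2 >-> R})
    (W : forall n : nat, T -> 'M[R]_n) (M : forall n : nat, 'M[R[i]]_n) :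
  'V_P1[xi] = 1%E ->
  (forall n : nat, (0 < n)%N -> wigner_matrix P P1 xi P2 zeta (W n)) ->
  (Num.sqrt n%:R)^-1 * frobenius_norm (M n) @[n --> \oo] --> (0 : R) ->
  weak_cvg_as P
    (fun n t => empirical_spectral_measure
       (map_mx (real_complex R) ((Num.sqrt n%:R)^-1 *: W n t) + M n))
    (semicircle_law R).
Proof.
move=> xi_var wW M0 f cf /bounded_funP[F fF].
have Mfro : n.+1%:R^-1 * fro2 (M n.+1) @[n --> \oo] --> (0 : R).
  have : ((Num.sqrt n%:R)^-1 * frobenius_norm (M n)) ^+ 2 @[n --> \oo] --> (0 : R).
    rewrite [X in _ --> X](_ : _ = 0 * 0 :> R); last by rewrite mul0r.
    by under eq_fun do rewrite expr2; exact: cvgM.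
  rewrite -cvg_shiftS; under eq_fun do rewrite exprMn frobenius_norm_sqr exprVn sqr_sqrtr //.
  by [].
apply: filterS (wigner_stieltjes_as_countable xi_var wW) => t ht.
pose H n : 'M[R[i]]_n := map_mx (real_complex R) ((Num.sqrt n%:R)^-1 *: W n t).
have Hh n : hermitian (H n.+1) by rewrite /H (map_wigner (wW _ (ltn0Sn n))); exact: emx_hermitian.
have sp n := cid (schur_perturbation (M n.+1) (Hh n) (ltn0Sn n)).
pose l n := projT1 (sp n).
have lA n : char_poly (H n.+1 + M n.+1) = \prod_i ('X - (l n i)%:P).
  by have [] := projT2 (sp n).
have lIm n : \sum_i complex.Im (l n i) ^+ 2 <= fro2 (M n.+1) by have [] := projT2 (sp n).
have lS n (z : R[i]) (a : R) : 0 < complex.Im z -> 0 < a ->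
    cabs (stieltjes (H n.+1) z - n.+1%:R^-1 * \sum_i ((complex.Re (l n i))%:C%C - z)^-1) <=
    (a * (complex.Im z)^-1 ^+ 4 + a^-1 * (2 * (n.+1%:R^-1 * fro2 (M n.+1)))) / 2.
  by have [_ _ h] := projT2 (sp n); exact: h.
(* Size 0 is dropped by a shift, since triangularisation and averages over points require a nonempty
   matrix. *)
rewrite -cvg_shiftS (integral_sc_mean cf fF).
rewrite (_ : [sequence _]_n = fun n => (n.+1%:R^-1 * \sum_i f (l n i))%:E); last first.
  by apply/funext => n; exact: (integral_empirical (lA n) cf fF).
apply: cvg_EFin; first exact: nearW.
apply: (weak_cvg_points cf fF) => [|k p].
  apply: (@squeeze_cvgr _ _ _ _ (fun=> 0) (fun n => n.+1%:R^-1 * fro2 (M n.+1))) => //; last exact: cvg_cst.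
  apply: nearW => n; have n1 : (0 : R) <= n.+1%:R^-1 by rewrite invr_ge0.
  rewrite mulr_ge0 ?sumr_ge0 //= => [|i _]; last exact: sqr_ge0.
  exact: (ler_wpM2l n1 (lIm n)).
pose z : R[i] := Complex (ratr p) k.+1%:R^-1.
have z0 : 0 < complex.Im z by rewrite /= invr_gt0.
pose u n := cabs (stieltjes (H n.+1) z - n.+1%:R^-1 * \sum_i ((complex.Re (l n i))%:C%C - z)^-1).
have u0 : u n @[n --> \oo] --> (0 : R).
  apply: (tradeoff_cvg0 (C := (complex.Im z)^-1 ^+ 4 / 2) (v := fun n => n.+1%:R^-1 * fro2 (M n.+1))) => //.
  - by rewrite divr_ge0 // exprn_ge0 // invr_ge0 ltW.
  - by move=> n; exact: cabs_ge0.
  - move=> n a a0; apply: le_trans (lS n z a z0 a0) _; rewrite le_eqVlt; apply/orP; left; apply/eqP.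
    move: ((complex.Im z)^-1 ^+ 4) (n.+1%:R^-1 * fro2 _) => b c.
    by field; rewrite gt_eqF.
have ht' := ht k p.
apply/cvgrPdist_lt => e e0; have e2 : 0 < e / 2 by rewrite divr_gt0.
have /cvgrPdist_lt/(_ _ e2) h1 := ht'; have /cvgrPdist_lt/(_ _ e2) h2 := u0.
apply: filterS2 h1 h2 => n h1 h2.
(* On the real parts of the eigenvalues the Poisson mean is the imaginary part of their Stieltjes
   transform, which [u0] compares with that of the Wigner matrix. *)
have -> : point_mean (fun i => complex.Re (l n i)) (poisson k.+1%:R (ratr p)) =
    complex.Im (n.+1%:R^-1 * \sum_i ((complex.Re (l n i))%:C%C - z)^-1).
  rewrite /point_mean mulrC (_ : n.+1%:R^-1 = (n.+1%:R^-1)%:C%C); last by rewrite fmorphV rmorph_nat.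
  rewrite [in RHS]mulrC cImMr cIm_sum; congr (_ * _); apply: eq_bigr => i _.
  by rewrite poissonE.
rewrite -[_ - _](subrKA (complex.Im (stieltjes (H n.+1) z))) [e]splitr.
apply: le_lt_trans (ler_normD _ _) _; apply: ltrD; first exact: h1.
move: h2; rewrite sub0r normrN /u (ger0_norm (cabs_ge0 _)); apply: le_lt_trans.
by rewrite -cImB; exact: ler_Im_cabs.
Qed.
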